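(* Let $F$ be a Clairaut semi-invariant Riemannian map with $s=e^f$ from a Riemannian manifold $(M,g_M)$ to a Kähler manifold $(N,g_N,P)$ such that $(\mathrm{range}\,F_\ast)^\perp$ is totally geodesic and $\dim(D_2)>1$. Then $(\ker F_\ast)^\perp$ is a locally product manifold of $\bar D_1$ and $\bar D_2$ if and only if (i) $(\nabla F_\ast)(X,U)$ has no component in $D_1$, and (ii) $(\nabla F_\ast)(X_2,U)$ has no component in $D_2$, for $X\in\Gamma(\bar D_1)$, $X_2\in\Gamma(\bar D_2)$ and $U\in\Gamma(\ker F_\ast)$.
   Context: $\nabla^M,\nabla^N$ are the Levi-Civita connections and $\Gamma(\cdot)$ denotes sections. $F:M\to N$ is smooth with $0<\mathrm{rank}\,F<\min\{\dim M,\dim N\}$; $(\ker F_\ast)^\perp\subset TM$ and $(\mathrm{range}\,F_\ast)^\perp\subset TN$ are orthogonal complements, and $\mathrm{range}\,F_\ast$, $(\mathrm{range}\,F_\ast)^\perp$ are regarded as complementary orthogonal distributions on $N$. $F$ is a Riemannian map if $g_N(F_\ast X,F_\ast Y)=g_M(X,Y)$ for all $X,Y\in\Gamma((\ker F_\ast)^\perp)$. The second fundamental form of $F$ is $(\nabla F_\ast)(X,Y)=\nabla^F_XF_\ast Y-F_\ast(\nabla^M_XY)$, $\nabla^F$ being the pullback of $\nabla^N$. $(\mathrm{range}\,F_\ast)^\perp$ is totally geodesic if $\nabla^N_UV\in\Gamma((\mathrm{range}\,F_\ast)^\perp)$ for all $U,V\in\Gamma((\mathrm{range}\,F_\ast)^\perp)$.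 $(N,g_N,P)$ is Kähler: $P$ is a $(1,1)$ tensor with $P^2=-I$, $g_N(P\cdot,P\cdot)=g_N$, $\nabla^NP=0$. A Riemannian map $F$ to $N$ is semi-invariant if there are subbundles $D_1,D_2$ with $\mathrm{range}\,F_\ast=D_1\oplus D_2$ (orthogonal), $P(D_1)=D_1$ and $P(D_2)\subseteq(\mathrm{range}\,F_\ast)^\perp$. $\bar D_1,\bar D_2$ are the corresponding orthogonal distributions with $(\ker F_\ast)^\perp=\bar D_1\oplus\bar D_2$ and $F_\ast(\bar D_i)=D_i$. A distribution $\bar D_i$ on $M$ defines a totally geodesic foliation if $\nabla^M_XY\in\Gamma(\bar D_i)$ for all $X,Y\in\Gamma(\bar D_i)$. $(\ker F_\ast)^\perp$ is called a locally product manifold of $\bar D_1$ and $\bar D_2$ if and only if both $\bar D_1$ and $\bar D_2$ define totally geodesic foliations. $F$ is Clairaut if there is a function $s:N\to\mathbb R^+$ such that for every geodesic $\beta$ on $N$ the function $(s\circ\beta)\sin\theta(t)$ is constant, where $F_\ast X\in\Gamma(\mathrm{range}\,F_\ast)$ and $V\in\Gamma((\mathrm{range}\,F_\ast)^\perp)$ are the components of $\dot\beta(t)$ and $\theta(t)$ is the angle between $\dot\beta(t)$ and $V$. A Clairaut semi-invariant Riemannian map is a semi-invariant Riemannian map to a Kähler manifold that is Clairaut in this sense; ''with $s=e^f$'' means $s=e^f$ for a smooth function $f$ on $N$. *)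

(* Defs.v *)
From HB Require Import structures.
From mathcomp Require Import all_boot all_order all_algebra.
From mathcomp Require Import all_classical all_reals all_analysis.

Set Implicit Arguments.
Unset Strict Implicit.
Unset Printing Implicit Defensive.
Import Order.TTheory GRing.Theory Num.Theory.
Import numFieldNormedType.Exports.
Local Open Scope classical_set_scope.
Local Open Scope ring_scope.

(* [U] is meant to be open. *)
Fixpoint Ck (R : realType) (V W : normedModType R) (k : nat) (U : set V)
    (f : V -> W) : Prop :=
  match k with
  | 0 => forall x, U x -> {for x, continuous f}
  | k'.+1 => (forall x, U x -> differentiable f x) /\
             (forall v : V, Ck k' U (fun x => 'd f x v))
  end.

Definition smooth_on (R : realType) (V W : normedModType R) (U : set V)
    (f : V -> W) : Prop := forall k, Ck k U f.

Record chart (R : realType) (n : nat) (T : topologicalType) := Chart {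
  chart_dom : set T;
  chart_cod : set 'rV[R]_n;
  chart_map : T -> 'rV[R]_n;
  chart_inv : 'rV[R]_n -> T;
  chart_dom_open : open chart_dom;
  chart_cod_open : open chart_cod;
  chart_map_cod : forall p, chart_dom p -> chart_cod (chart_map p);
  chart_inv_dom : forall x, chart_cod x -> chart_dom (chart_inv x);
  chart_mapK : forall p, chart_dom p -> chart_inv (chart_map p) = p;
  chart_invK : forall x, chart_cod x -> chart_map (chart_inv x) = x;
  chart_map_cont : forall p, chart_dom p -> {for p, continuous chart_map};
  chart_inv_cont : forall x, chart_cod x -> {for x, continuous chart_inv} }.

(* The smooth structure is given by an atlas indexed by the points: a preferred
   chart around each point, any two of them being smoothly compatible.  Every
   maximal atlas is generated by such a choice. *)
Record manifold (R : realType) (n : nat) := Manifold {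
  mcarrier :> topologicalType;
  chart_at : mcarrier -> chart R n mcarrier;
  mem_chart_at : forall p, chart_dom (chart_at p) p;
  chart_compat : forall p q,
    smooth_on [set x | chart_cod (chart_at p) x /\
                       chart_dom (chart_at q) (chart_inv (chart_at p) x)]
              (chart_map (chart_at q) \o chart_inv (chart_at p));
  manifold_hausdorff : hausdorff_space mcarrier;
  manifold_second_countable : @second_countable mcarrier }.

(* A tangent vector at [p] is represented by its coordinates in the preferred
   chart at [p]; hence all tangent spaces are copies of R^n, and vectors at
   different points may only be compared through [coord_change]. *)
Definition tangent (R : realType) (n : nat) (M : manifold R n) (p : M) : Type :=
  'rV[R]_n.

Section Calculus.
Context {R : realType}.

Definition to_coord n (M : manifold R n) (p : M) : M -> 'rV[R]_n :=
  chart_map (chart_at p).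
Definition of_coord n (M : manifold R n) (p : M) : 'rV[R]_n -> M :=
  chart_inv (chart_at p).

(* Coordinates, in the preferred chart at [p], of a vector tangent at a point
   [q] of the domain of that chart. *)
Definition coord_change n (M : manifold R n) (p q : M) (v : tangent q) :
    'rV[R]_n :=
  'd (to_coord p \o of_coord q) (to_coord q q) v.
Global Arguments coord_change {n M} p q v.

Definition smooth_fun n (M : manifold R n) (U : set M) (h : M -> R) : Prop :=
  forall p : M,
    smooth_on (W := R^o) [set x | chart_cod (chart_at p) x /\ U (of_coord p x)]
              (h \o of_coord p).

Definition fun_deriv n (M : manifold R n) (h : M -> R) (p : M) (v : tangent p) :
    R :=
  'd (h \o of_coord p : 'rV[R]_n -> R^o) (to_coord p p) v.
Global Arguments fun_deriv {n M} h p v.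

Definition smooth_map m n (M : manifold R m) (N : manifold R n) (F : M -> N) :
    Prop :=
  continuous F /\
  forall p : M,
    smooth_on [set x | chart_cod (chart_at p) x /\
                       chart_dom (chart_at (F p)) (F (of_coord p x))]
              (to_coord (F p) \o F \o of_coord p).

Definition tangent_map m n (M : manifold R m) (N : manifold R n) (F : M -> N)
    (p : M) : {linear 'rV[R]_m -> 'rV[R]_n} :=
  'd (to_coord (F p) \o F \o of_coord p) (to_coord p p).

(* A section along [F], i.e. of the pullback bundle [F^* TN]; vector fields are
   the sections along the identity. *)
Definition section_along m n (M : manifold R m) (N : manifold R n)
    (F : M -> N) : Type := forall p : M, tangent (F p).

Definition vector_field n (M : manifold R n) : Type := forall p : M, tangent p.

Definition local_repr m n (M : manifold R m) (N : manifold R n) (F : M -> N)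
    (W : section_along F) (p : M) (x : 'rV[R]_m) : 'rV[R]_n :=
  coord_change (F p) (F (of_coord p x)) (W (of_coord p x)).

Definition smooth_along m n (M : manifold R m) (N : manifold R n) (F : M -> N)
    (U : set M) (W : section_along F) : Prop :=
  forall p : M,
    smooth_on [set x | [/\ chart_cod (chart_at p) x, U (of_coord p x) &
                           chart_dom (chart_at (F p)) (F (of_coord p x))]]
              (local_repr W p).

Definition smooth_field n (M : manifold R n) (U : set M) (X : vector_field M) :
    Prop :=
  @smooth_along n n M M id U X.

Definition local_deriv m n (M : manifold R m) (N : manifold R n) (F : M -> N)
    (W : section_along F) (p : M) (v : tangent p) : tangent (F p) :=
  'd (local_repr W p) (to_coord p p) v.
Global Arguments local_deriv {m n M N F} W p v.

Definition field_deriv n (M : manifold R n) (Y : vector_field M) (p : M)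
    (v : tangent p) : tangent p :=
  @local_deriv n n M M id Y p v.
Global Arguments field_deriv {n M} Y p v.

(* In coordinates, [X,Y]^k = X^i d_i Y^k - Y^i d_i X^k. *)
Definition lie_bracket n (M : manifold R n) (X Y : vector_field M) :
    vector_field M :=
  fun p => (field_deriv Y p (X p) : 'rV[R]_n) - field_deriv X p (Y p).

Record metric n (M : manifold R n) := Metric {
  ip :> forall p : M, tangent p -> tangent p -> R;
  ip_linear : forall (p : M) (u : 'rV[R]_n), scalar (@ip p u : 'rV[R]_n -> R);
  ip_sym : forall (p : M) (u v : tangent p), @ip p u v = @ip p v u;
  ip_pos : forall (p : M) (u : 'rV[R]_n), u != 0 -> 0 < @ip p u u;
  ip_smooth : forall (U : set M) (X Y : vector_field M), open U ->
    smooth_field U X -> smooth_field U Y ->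
    smooth_fun U (fun p => @ip p (X p) (Y p)) }.

(* A connection on TM is determined by its Christoffel symbols: [chris p u v] is
   the vector with k-th coordinate [Gamma^k_ij u^i v^j], the symbols being those
   of the preferred chart at [p], evaluated at [p]. *)
Definition cov_deriv n (M : manifold R n)
    (chris : forall p : M, tangent p -> tangent p -> tangent p)
    (X Y : vector_field M) : vector_field M :=
  fun p => (field_deriv Y p (X p) : 'rV[R]_n) + chris p (X p) (Y p).

Record connection n (M : manifold R n) := Connection {
  chris : forall p : M, tangent p -> tangent p -> tangent p;
  chris_linearl : forall (p : M) (v : 'rV[R]_n),
    linear ((fun u => @chris p u v) : 'rV[R]_n -> tangent p);
  chris_linearr : forall (p : M) (u : 'rV[R]_n),
    linear (@chris p u : 'rV[R]_n -> tangent p);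
  cov_deriv_smooth : forall (U : set M) (X Y : vector_field M), open U ->
    smooth_field U X -> smooth_field U Y ->
    smooth_field U (cov_deriv chris X Y) }.
Global Arguments chris {n M} C p u v : rename.

Definition nabla n (M : manifold R n) (C : connection M)
    (X Y : vector_field M) : vector_field M :=
  cov_deriv (chris C) X Y.

Definition levi_civita n (M : manifold R n) (g : metric M) (C : connection M) :
    Prop :=
  forall (U : set M) (X Y Z : vector_field M), open U ->
    smooth_field U X -> smooth_field U Y -> smooth_field U Z ->
    forall p, U p ->
      [/\ (nabla C X Y p : 'rV[R]_n) - nabla C Y X p = lie_bracket X Y p &
          fun_deriv (fun q => g q (Y q) (Z q)) p (X p) =
          g p (nabla C X Y p) (Z p) + g p (Y p) (nabla C X Z p)].

(* The pullback connection: its local expression is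
   X^i d_i W^k + (Gamma^k_ij o F) (F_* X)^i W^j. *)
Definition nabla_pullback m n (M : manifold R m) (N : manifold R n)
    (F : M -> N) (C : connection N) (X : vector_field M)
    (W : section_along F) : section_along F :=
  fun p => (local_deriv W p (X p) : 'rV[R]_n) +
           chris C (F p) (tangent_map F p (X p)) (W p).

Definition second_fundamental_form m n (M : manifold R m) (N : manifold R n)
    (F : M -> N) (CM : connection M) (CN : connection N)
    (X Y : vector_field M) : section_along F :=
  fun p =>
    (nabla_pullback CN X (fun q => tangent_map F q (Y q) : tangent (F q)) p
       : 'rV[R]_n)
    - tangent_map F p (nabla CM X Y p).

Definition smooth_curve n (N : manifold R n) (I : set R) (b : R -> N) : Prop :=
  (forall t, I t -> {for t, continuous b}) /\
  (forall t0, I t0 ->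
     smooth_on (V := R^o)
       [set t | I t /\ chart_dom (chart_at (b t0)) (b t)]
       (to_coord (b t0) \o b)).

Definition velocity n (N : manifold R n) (b : R -> N) (t : R) : tangent (b t) :=
  derive1 (to_coord (b t) \o b) t.

Definition nabla_curve n (N : manifold R n) (C : connection N) (b : R -> N)
    (W : forall t : R, tangent (b t)) (t : R) : tangent (b t) :=
  (derive1 (fun s => coord_change (b t) (b s) (W s)) t : 'rV[R]_n)
  + chris C (b t) (velocity b t) (W t).

Definition geodesic n (N : manifold R n) (C : connection N) (I : set R)
    (b : R -> N) : Prop :=
  smooth_curve I b /\
  forall t, I t -> nabla_curve C (velocity b) t = (0 : 'rV[R]_n).

Definition subbundle_along m n (M : manifold R m) (N : manifold R n)
    (F : M -> N) (k : nat) (D : forall p : M, set (tangent (F p))) : Prop :=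
  forall p : M, exists (U : set M) (W : 'I_k -> section_along F),
    [/\ open U, U p, forall i, smooth_along U (W i) &
      forall q, U q ->
        let e : k.-tuple 'rV[R]_n := [tuple W i q | i < k] in
        free e /\ D q = [set v : 'rV[R]_n | v \in <<e>>%VS]].

Definition is_distribution n (M : manifold R n) (k : nat)
    (D : forall p : M, set (tangent p)) : Prop :=
  @subbundle_along n n M M id k D.

Definition section n (M : manifold R n) (D : forall p : M, set (tangent p))
    (X : vector_field M) : Prop :=
  smooth_field setT X /\ forall p, D p (X p).

Definition orth n (M : manifold R n) (g : metric M) (p : M)
    (A : set (tangent p)) : set (tangent p) :=
  [set v | forall w, A w -> g p v w = 0].
Global Arguments orth {n M} g p A.

Definition totally_geodesic n (M : manifold R n) (C : connection M)
    (D : forall p : M, set (tangent p)) : Prop :=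
  forall X Y, section D X -> section D Y -> section D (nabla C X Y).

Section Maps.
Context {m n : nat} {M : manifold R m} {N : manifold R n}.

Definition ker_map (F : M -> N) (p : M) : set (tangent p) :=
  [set v | tangent_map F p v = 0].
Global Arguments ker_map F p : clear implicits.

Definition range_map (F : M -> N) (p : M) : set (tangent (F p)) :=
  range (tangent_map F p).
Global Arguments range_map F p : clear implicits.

Definition horizontal (gM : metric M) (F : M -> N) (p : M) : set (tangent p) :=
  orth gM p (ker_map F p).
Global Arguments horizontal gM F p : clear implicits.

Definition has_rank (F : M -> N) (r : nat) : Prop :=
  forall p : M, \rank (lin1_mx (tangent_map F p)) = r.

Definition riemannian_map (gM : metric M) (gN : metric N) (F : M -> N) : Prop :=
  forall X Y, section (horizontal gM F) X -> section (horizontal gM F) Y ->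
    forall p, gN (F p) (tangent_map F p (X p)) (tangent_map F p (Y p)) =
              gM p (X p) (Y p).

(* As a subset of TN, [range F_*] only lives over the image of [F], a proper
   subset of [N] when [rank F < dim N]; regarding it as a distribution on [N]
   means giving a distribution [Ran] which restricts to it over the image. *)
Definition range_distribution (gN : metric N) (F : M -> N) (r : nat)
    (Ran : forall q : N, set (tangent q)) : Prop :=
  [/\ is_distribution r Ran,
      is_distribution (n - r) (fun q => orth gN q (Ran q)) &
      forall p, Ran (F p) = range_map F p].

Definition kahler (gN : metric N) (CN : connection N)
    (P : forall q : N, tangent q -> tangent q) : Prop :=
  [/\ forall q : N, linear (P q : 'rV[R]_n -> 'rV[R]_n),
      forall (U : set N) (X : vector_field N), open U ->
        smooth_field U X -> smooth_field U (fun q => P q (X q)),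
      forall (q : N) (v : 'rV[R]_n), P q (P q v) = - v,
      forall (q : N) (u v : tangent q), gN q (P q u) (P q v) = gN q u v &
      forall (U : set N) (X Y : vector_field N), open U ->
        smooth_field U X -> smooth_field U Y ->
        forall q, U q ->
          nabla CN X (fun q' => P q' (Y q')) q = P q (nabla CN X Y q)].

(* [D1] and [D2], of ranks [k1] and [k2], are subbundles of [range F_*] viewed
   as a bundle over [M], i.e. as a subbundle of [F^* TN]. *)
Definition semi_invariant (gN : metric N)
    (P : forall q : N, tangent q -> tangent q) (F : M -> N) (k1 k2 : nat)
    (D1 D2 : forall p : M, set (tangent (F p))) : Prop :=
  [/\ subbundle_along k1 D1,
      subbundle_along k2 D2,
      forall p, range_map F p =
        [set w | exists u v : 'rV[R]_n, [/\ D1 p u, D2 p v & w = u + v]],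
      forall p (u v : tangent (F p)), D1 p u -> D2 p v -> gN (F p) u v = 0 &
      forall p, P (F p) @` D1 p = D1 p /\
                P (F p) @` D2 p `<=` orth gN (F p) (range_map F p)].

(* Since [F_*] is injective on [(ker F_* )^\perp], this is the only
   subdistribution of [(ker F_* )^\perp] that [F_*] maps onto [D]. *)
Definition horizontal_lift (gM : metric M) (F : M -> N)
    (D : forall p : M, set (tangent (F p))) (p : M) : set (tangent p) :=
  [set v | horizontal gM F p v /\ D p (tangent_map F p v)].

Definition locally_product (CM : connection M)
    (D1 D2 : forall p : M, set (tangent p)) : Prop :=
  totally_geodesic CM D1 /\ totally_geodesic CM D2.

End Maps.

(* As [x / 0 = 0] and [acos 0 = pi / 2], the angle with a zero vector is a right
   angle; for [v] the normal component of [u] this is the value for which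
   [sin (angle g u v)] is the ratio of the norms of the tangential component
   and of [u]. *)
Definition angle n (N : manifold R n) (g : metric N) (q : N)
    (u v : tangent q) : R :=
  acos (g q u v / (Num.sqrt (g q u u) * Num.sqrt (g q v v))).
Global Arguments angle {n N} g q u v.

Definition clairaut n (N : manifold R n) (g : metric N) (C : connection N)
    (Ran : forall q : N, set (tangent q)) (s : N -> R) : Prop :=
  (forall q, 0 < s q) /\
  forall (I : set R) (b : R -> N) (H V : forall t : R, tangent (b t)),
    open I -> is_interval I -> geodesic C I b ->
    (forall t, I t -> [/\ Ran (b t) (H t), orth g (b t) (Ran (b t)) (V t) &
       velocity b t = (H t : 'rV[R]_n) + (V t : 'rV[R]_n)]) ->
    forall t t', I t -> I t' ->
      s (b t) * sin (angle g (b t) (velocity b t) (V t)) =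
      s (b t') * sin (angle g (b t') (velocity b t') (V t')).

End Calculus.

(* Main.v *)
(** Idea.  Let [V] be a section of [(range F_* )^\perp] and [h] a tangent vector
    in [range F_*].  Along the geodesic with initial velocity [h + V], the Clairaut
    relation gives the squared norm of the normal part of the velocity as a function
    of [f] alone; the Cauchy-Schwarz inequality between that normal part and [V] is
    an equality at time 0, so its derivative vanishes there, which reads
    [g(h, nabla_h V) = g(h, h) V(f)] once [(range F_* )^\perp] is totally geodesic.
    As the second fundamental form of a Riemannian map takes horizontal vectors into
    [(range F_* )^\perp], polarization makes [F] umbilical:
    [(nabla F_* )(X, Y) = - g(X, Y) grad f] on horizontal vectors, [grad f] being
    taken in [(range F_* )^\perp].  Since [P] is parallel and [dim D2 > 1], this
    forces [grad f] to be orthogonal to [P(D2)], whence [nabla_X Y] never has a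
    component mixing [\bar D1] and [\bar D2].  What remains is its vertical part:
    [g_M(nabla_X Y, U) = g_N((nabla F_* )(X, U), F_* Y)] for [U] in [ker F_*]. *)
From HB Require Import structures.
Require Import Defs.
From mathcomp Require Import all_boot all_order all_algebra.
From mathcomp Require Import all_classical all_reals all_analysis.
From mathcomp Require Import ring lra.
Import Order.TTheory GRing.Theory Num.Theory.
Import numFieldNormedType.Exports.
Local Open Scope classical_set_scope.
Local Open Scope ring_scope.
Set Implicit Arguments.
Unset Strict Implicit.
Unset Printing Implicit Defensive.

(** * Calculus on normed spaces *)

(** The hypotheses quantify over global sections and over existing geodesics, while the argument is
    pointwise. Three preparations bridge this gap. Every vector is extended to a global section of
    the relevant bundle, by smooth linear algebra at constant rank or by a local frame, followed by
    a cutoff. Geodesics with prescribed initial velocity are built from an existence theorem for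
    ordinary differential equations. Since vectors are coordinates in the preferred chart of their
    foot point, covariant derivatives are computed at the centre of that chart, where the coordinate
    change is the identity, and are carried to other points by the transformation laws.

    The gradient of [f] is never formed: its pairing with a normal vector [w] is [fun_deriv f q w].

    The initial velocity [h + V] has a nonzero normal part because the equality case of
    Cauchy-Schwarz is divided by the squared norm of [V]; comparing [h] with [- h] afterwards
    separates the terms even and odd in [h]. *)

Section Differentials.
Variables (R : realType) (V W : normedModType R).
Implicit Types (f g : V -> W) (x : V).

Lemma near_diff f g x : (\forall y \near x, f y = g y) ->
  differentiable f x -> differentiable g x /\ 'd g x = 'd f x :> (V -> W).
Proof.
move=> fg df; have fgx : f x = g x by exact: nbhs_singleton fg.
have dg : g \o shift x = cst (g x) + 'd f x +o_ 0 id.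
  apply/eqaddoP => e e0; have /eqaddoP/(_ e e0) := diff_locally df.
  have fg0 : \forall h \near 0, f (h + x) = g (h + x).
    by move: fg; rewrite (near_shift 0 x) /= subr0.
  move=> h; apply: filterS2 h fg0 => y.
  by rewrite /= !fctE /= => + <-; rewrite -fgx.
have E := diff_unique (diff_continuous df) dg.
split; last exact: E.
apply/diff_locallyP; rewrite E; split; last exact: dg.
exact: diff_continuous.
Qed.

Lemma near_differentiable f g x : (\forall y \near x, f y = g y) ->
  differentiable f x -> differentiable g x.
Proof. by move=> fg df; exact: (proj1 (near_diff fg df)). Qed.

Lemma near_diffE f g x : (\forall y \near x, f y = g y) ->
  differentiable f x -> 'd g x = 'd f x :> (V -> W).
Proof. by move=> fg df; exact: (proj2 (near_diff fg df)). Qed.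

Lemma near_continuous f g x : (\forall y \near x, f y = g y) ->
  {for x, continuous f} -> {for x, continuous g}.
Proof.
move=> fg cf; have fgx : f x = g x by exact: nbhs_singleton fg.
move: cf; rewrite /prop_for /continuous_at fgx => cf.
apply: cvg_trans cf; apply: near_eq_cvg.
exact: fg.
Qed.

Lemma diff_addE f g x v : differentiable f x -> differentiable g x ->
  'd (fun y => f y + g y) x v = 'd f x v + 'd g x v.
Proof. by move=> df dg; exact: (congr1 (@^~ v) (diffD df dg)). Qed.

Lemma diff_mulE (f g : V -> R^o) x v :
  differentiable f x -> differentiable g x ->
  'd (fun y => f y * g y : R^o) x v = f x * 'd g x v + g x * 'd f x v.
Proof. by move=> df dg; exact: (congr1 (@^~ v) (diffM df dg)). Qed.

Lemma differentiable_mul (f g : V -> R^o) x :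
  differentiable f x -> differentiable g x ->
  differentiable (fun y => f y * g y : R^o) x.
Proof. by move=> df dg; exact: (differentiableM df dg). Qed.

Lemma differentiable_add f g x :
  differentiable f x -> differentiable g x ->
  differentiable (fun y => f y + g y) x.
Proof. by move=> df dg; exact: (differentiableD df dg). Qed.

Lemma diff_invE (f : V -> R^o) x v : differentiable f x -> f x != 0 ->
  'd (fun y => (f y)^-1 : R^o) x v = - (f x) ^- 2 * 'd f x v.
Proof. by move=> df f0; exact: (congr1 (@^~ v) (diffV df f0)). Qed.

End Differentials.

Section FiniteDim.
Variable (R : realType).

Lemma row_sum_coord n (v : 'rV[R]_n) : v = \sum_(i < n) v 0 i *: 'e_i.
Proof. exact: row_sum_delta. Qed.

Lemma coord_linear n (i : 'I_n) : linear (fun v : 'rV[R]_n => v 0 i : R^o).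
Proof. by move=> a u v; rewrite !mxE. Qed.

Lemma linear_rV_continuous n (W : normedModType R)
  (f : {linear 'rV[R]_n -> W}) : continuous f.
Proof.
have -> : (f : _ -> _) = \sum_(i < n) (fun v : 'rV[R]_n => v 0 i *: f 'e_i).
  apply/funext => v; rewrite fct_sumE {1}(row_sum_coord v) linear_sum.
  by apply: eq_bigr => i _; rewrite linearZ.
move=> v; apply: differentiable_continuous; apply: differentiable_sum => i.
by apply: differentiableZl; exact: differentiable_coord.
Qed.

Lemma linear_rV_diff n (W : normedModType R) (f : {linear 'rV[R]_n -> W}) x :
  differentiable f x /\ 'd f x = f :> (_ -> _).
Proof.
have cf := @linear_rV_continuous n W f.
by split; [exact: linear_differentiable|exact: diff_lin].
Qed.

Lemma linear_fun_diff n (W : normedModType R) (f : 'rV[R]_n -> W) x :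
  linear f -> differentiable f x /\ 'd f x = f :> (_ -> _).
Proof.
move=> lf; pose fM := GRing.isLinear.Build _ _ _ _ _ lf.
pose fL : {linear _ -> _} := HB.pack f fM.
exact: (linear_rV_diff fL).
Qed.

Lemma diff_row_sum n (W : normedModType R) (f : 'rV[R]_n -> W) (x v : 'rV[R]_n) :
  'd f x v = \sum_(i < n) v 0 i *: 'd f x 'e_i.
Proof.
rewrite {1}(row_sum_coord v) linear_sum; by apply: eq_bigr => i _; rewrite linearZ.
Qed.

Lemma differentiable_coordP n (V : normedModType R) (f : V -> 'rV[R]_n) x :
  differentiable f x <->
  forall i, differentiable (fun y => f y 0 i : R^o) x.
Proof.
split=> [df i|df].
  apply: (@differentiable_comp _ _ _ _ f (fun v : 'rV[R]_n => v 0 i : R^o) _ df).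
  exact: differentiable_coord.
have -> : f = \sum_(i < n) (fun v : V => f v 0 i *: 'e_i).
  by apply/funext => v; rewrite fct_sumE {1}(row_sum_coord (f v)).
by apply: differentiable_sum => i; apply: differentiableZl; exact: df.
Qed.

Lemma diff_coord n (V : normedModType R) (f : V -> 'rV[R]_n) x v i :
  differentiable f x ->
  'd (fun y => f y 0 i : R^o) x v = 'd f x v 0 i.
Proof.
move=> df.
have [d1 d2] := linear_fun_diff (f x) (coord_linear i).
rewrite (_ : (fun y => _) = (fun v : 'rV[R]_n => v 0 i : R^o) \o f) //.
by rewrite diff_comp //= d2.
Qed.

Lemma continuous_coordP n (T : topologicalType) (f : T -> 'rV[R]_n) x :
  {for x, continuous f} <->
  forall i, {for x, continuous (fun y => f y 0 i : R^o)}.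
Proof.
split=> [cf i|cf].
  apply: (@continuous_comp _ _ _ f (fun v : 'rV[R]_n => v 0 i : R^o)) => //.
  exact: coord_continuous.
have -> : f = \sum_(i < n) (fun v : T => f v 0 i *: 'e_i).
  by apply/funext => v; rewrite fct_sumE {1}(row_sum_coord (f v)).
rewrite /prop_for /continuous_at fct_sumE.
apply: (@cvg_big 'rV[R]_n 'I_n +%R 0 xpredT _ T (nbhs x) (index_enum _)
  (fun i v => f v 0 i *: 'e_i) (fun i => f x 0 i *: 'e_i)) => [|i _].
  exact: add_continuous.
by apply: cvgZr_tmp; exact: cf.
Qed.

End FiniteDim.

(** * Closure properties of maps of class C^k *)

Section Ck.
Variables (R : realType) (V W : normedModType R).
Implicit Types (f g : V -> W) (U : set V).

Lemma Ck_sub k U U' f : U' `<=` U -> Ck k U f -> Ck k U' f.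
Proof.
elim: k f => [|k IH] f UU /=; first by move=> h x /UU; exact: h.
by move=> [h1 h2]; split=> [x /UU|v]; [exact: h1|exact: IH].
Qed.

Lemma CkS k U f : Ck k.+1 U f <->
  (forall x, U x -> differentiable f x) /\ forall v, Ck k U (fun x => 'd f x v).
Proof. by []. Qed.

Lemma CkW k U f : Ck k.+1 U f -> Ck k U f.
Proof.
elim: k f => [|k IH] f; first by move=> [h _] x /h; exact: differentiable_continuous.
by move=> [h1 h2]; split=> // v; apply: IH.
Qed.

Lemma Ck_ext k U f g : open U -> (forall x, U x -> f x = g x) ->
  Ck k U f -> Ck k U g.
Proof.
move=> oU; have nearU (f1 g1 : V -> W) x : (forall x, U x -> f1 x = g1 x) -> U x ->
    \forall y \near x, f1 y = g1 y.
  by move=> fg Ux; move: (open_nbhs_nbhs (conj oU Ux)); apply: filterS => y; exact: fg.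
elim: k f g => [|k IH] f g fg.
  by move=> h x Ux; apply: near_continuous (nearU _ _ _ fg Ux) (h x Ux).
move=> [h1 h2]; split=> [x Ux|v].
  exact: near_differentiable (nearU _ _ _ fg Ux) (h1 x Ux).
apply: IH (h2 v) => x Ux.
by rewrite (near_diffE (nearU _ _ _ fg Ux) (h1 x Ux)).
Qed.

Lemma Ck_cst k U (c : W) : Ck k U (fun _ : V => c).
Proof.
elim: k c => [|k IH] c /=; first by move=> x _; exact: cst_continuous.
split=> [x _|v]; first exact: differentiable_cst.
rewrite (_ : (fun x => _) = fun _ => 0) //.
by apply/funext => x; rewrite (diff_cst c x).
Qed.

Lemma CkD k U f g : open U -> Ck k U f -> Ck k U g -> Ck k U (fun x => f x + g x).
Proof.
move=> oU; elim: k f g => [|k IH] f g.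
  by move=> hf hg x Ux; apply: cvgD; [exact: hf|exact: hg].
move=> /CkS[f1 f2] /CkS[g1 g2]; split=> [x Ux|v].
  by apply: differentiable_add; [exact: f1|exact: g1].
apply: Ck_ext (IH _ _ (f2 v) (g2 v)) => // x Ux.
by rewrite (diff_addE v (f1 x Ux) (g1 x Ux)).
Qed.

Lemma Ck_sum k U (I : Type) (r : seq I) (h : I -> V -> W) : open U ->
  (forall i, Ck k U (h i)) -> Ck k U (fun x => \sum_(i <- r) h i x).
Proof.
move=> oU hh; elim: r => [|i r IH].
  apply: Ck_ext (Ck_cst k U 0) => // x _; by rewrite big_nil.
by apply: Ck_ext (CkD oU (hh i) IH) => // x _; rewrite big_cons.
Qed.

End Ck.

Section CkScalar.
Variables (R : realType) (V : normedModType R).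
Implicit Types (f g : V -> R^o) (U : set V).

Lemma CkM k U f g : open U -> Ck k U f -> Ck k U g ->
  Ck k U (fun x => f x * g x : R^o).
Proof.
move=> oU; elim: k f g => [|k IH] f g.
  by move=> hf hg x Ux; apply: cvgM; [exact: hf|exact: hg].
move=> hf hg; have /CkS[f1 f2] := hf; have /CkS[g1 g2] := hg; split=> [x Ux|v].
  by apply: differentiable_mul; [exact: f1|exact: g1].
apply: Ck_ext (CkD oU (IH _ _ (CkW hf) (g2 v)) (IH _ _ (CkW hg) (f2 v))) => // x Ux.
exact: esym (diff_mulE v (f1 x Ux) (g1 x Ux)).
Qed.

(* [A], [c] : a basis of [W] and the coordinates in that basis, so that both
   ['rV_n] and [R^o] are covered. *)
Lemma Ck_comp_basis (W : normedModType R) n (e : 'I_n -> W) (c : 'I_n -> W -> R^o) (k : nat)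
  (U : set V) (O : set W) (f : V -> W) (g : W -> R^o) : open U ->
  (forall w, w = \sum_i c i w *: e i) ->
  (forall k i (h : V -> W), Ck k U h -> Ck k U (c i \o h)) ->
  (forall x, U x -> O (f x)) ->
  Ck k U f -> Ck k O g -> Ck k U (g \o f).
Proof.
move=> oU ce cc UO; elim: k f g UO => [|k IH] f g UO.
  move=> hf hg x Ux; apply: continuous_comp; [exact: hf|apply: hg; exact: UO].
move=> hf hg; have /CkS[f1 f2] := hf; have /CkS[g1 g2] := hg; split=> [x Ux|v].
  by apply: differentiable_comp; [exact: f1|exact/g1/UO].
apply: (@Ck_ext _ _ _ _ _ (fun x => \sum_i (c i ('d f x v) * 'd g (f x) (e i)) : R^o)) => //.
  move=> x Ux; rewrite (diff_comp (f1 x Ux) (g1 _ (UO x Ux))) /=.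
  rewrite [in RHS](ce ('d f x v)) linear_sum; apply: eq_bigr => i _.
  by rewrite linearZ.
apply: Ck_sum => // i; apply: CkM => //; first exact: cc (f2 v).
exact: IH (CkW hf) (g2 (e i)).
Qed.

End CkScalar.

Section CkVector.
Variables (R : realType).

Lemma Ck_coordP (V : normedModType R) n k (U : set V) (f : V -> 'rV[R]_n) : open U ->
  Ck k U f <-> forall i, Ck k U (fun x => f x 0 i : R^o).
Proof.
move=> oU; elim: k f => [|k IH] f.
  split=> [h i x Ux|h x Ux].
    exact: (iffLR (continuous_coordP f x) (h x Ux) i).
  by apply/continuous_coordP => i; exact: h.
split=> [[h1 h2] i|h].
  split=> [x Ux|v]; first exact: (iffLR (differentiable_coordP f x) (h1 x Ux) i).
  apply: Ck_ext (iffLR (IH _) (h2 v) i) => // x Ux.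
  by rewrite diff_coord //; exact: h1.
have df x : U x -> differentiable f x.
  by move=> Ux; apply/differentiable_coordP => i; have [+ _] := h i; exact.
split=> // v; apply/IH => i; have [_ /(_ v)] := h i.
by apply: Ck_ext => // x Ux; rewrite diff_coord //; exact: df.
Qed.

Lemma Ck_comp (V : normedModType R) n m k (U : set V) (O : set 'rV[R]_n) (f : V -> 'rV[R]_n)
   (g : 'rV[R]_n -> 'rV[R]_m) : open U -> open O ->
  (forall x, U x -> O (f x)) -> Ck k U f -> Ck k O g -> Ck k U (g \o f).
Proof.
move=> oU oO UO hf hg; apply/Ck_coordP => // i.
have /(_ i) hgi := iffLR (Ck_coordP k (g : 'rV[R]_n -> _) oO) hg.
apply: (Ck_comp_basis (e := fun i => 'e_i) (c := fun i v => v 0 i) oU _ _ UO hf hgi).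
  exact: row_sum_coord.
by move=> k' j h hh; exact: (iffLR (Ck_coordP k' h oU) hh j).
Qed.

Lemma Ck_compR (V : normedModType R) n k (U : set V) (O : set 'rV[R]_n) (f : V -> 'rV[R]_n)
   (g : 'rV[R]_n -> R^o) : open U ->
  (forall x, U x -> O (f x)) -> Ck k U f -> Ck k O g -> Ck k U (g \o f).
Proof.
move=> oU UO hf hg.
apply: (Ck_comp_basis (e := fun i => 'e_i) (c := fun i v => v 0 i) oU _ _ UO hf hg).
  exact: row_sum_coord.
by move=> k' j h hh; exact: (iffLR (Ck_coordP k' h oU) hh j).
Qed.

Lemma Ck_comp1 (V : normedModType R) k (U : set V) (O : set R^o) (f : V -> R^o)
   (g : R^o -> R^o) : open U ->
  (forall x, U x -> O (f x)) -> Ck k U f -> Ck k O g -> Ck k U (g \o f).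
Proof.
move=> oU UO hf hg.
apply: (Ck_comp_basis (n := 1) (e := (fun=> 1) : 'I_1 -> R^o) (c := fun _ v => v) oU _ _ UO hf hg).
  by move=> w; rewrite big_ord1 [RHS]mulr1.
by move=> k' j h.
Qed.

Lemma CkV (V : normedModType R) k (U : set V) (f : V -> R^o) : open U -> (forall x, U x -> f x != 0) ->
  Ck k U f -> Ck k U (fun x => (f x)^-1 : R^o).
Proof.
move=> oU f0; elim: k => [|k IH].
  by move=> h x Ux; apply: cvgV; [exact: f0|exact: h].
move=> hf; have /CkS[f1 f2] := hf; split=> [x Ux|v].
  by apply: differentiableV; [exact: f1|exact: f0].
have fV := IH (CkW hf).
apply: Ck_ext (CkM oU (CkM oU (Ck_cst k U (-1 : R^o)) (CkM oU fV fV)) (f2 v)) => // x Ux.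
rewrite (diff_invE v (f1 x Ux) (f0 x Ux)) /=.
by rewrite mulN1r -invfM -expr2.
Qed.

Lemma Ck_linear n (W : normedModType R) k (U : set 'rV[R]_n) (f : 'rV[R]_n -> W) :
  linear f -> Ck k U f.
Proof.
move=> lf; case: k => [|k].
  move=> x _; apply: differentiable_continuous.
  exact: (proj1 (linear_fun_diff x lf)).
split=> [x _|v]; first exact: (proj1 (linear_fun_diff x lf)).
rewrite (_ : (fun x => _) = fun _ => f v); first exact: Ck_cst.
by apply/funext => x; rewrite (proj2 (linear_fun_diff x lf)).
Qed.

End CkVector.

(** * Smoothness at a point *)

Lemma nbhs_open (T : topologicalType) (x : T) (A : set T) : nbhs x A ->
  exists Q, [/\ open Q, Q x & Q `<=` A].
Proof. by rewrite nbhsE => -[Q [oQ Qx] QA]; exists Q. Qed.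

(** Smoothness of the germ: sums, products and composites can be formed without tracking open
    domains, and [smooth_onP] converts back to [smooth_on]. *)
Definition smooth_at (R : realType) (V W : normedModType R) (f : V -> W) (x : V) :=
  exists U, [/\ open U, U x & smooth_on U f].

Section SmoothAt.
Variables (R : realType) (V W : normedModType R).
Implicit Types (f g : V -> W) (U : set V) (x : V).

Lemma Ck_local k U f : (forall x, U x -> exists2 U', U' x & Ck k U' f) -> Ck k U f.
Proof.
elim: k f => [|k IH] f h; first by move=> x /h[U' U'x]; exact.
split=> [x /h[U' U'x []]|v]; first by move=> + _; exact.
by apply: (IH (fun x => 'd f x v)) => x /h[U' U'x [_ h']]; exists U'; [exact: U'x|exact: h'].
Qed.

Lemma smooth_onP U f : open U ->
  smooth_on U f <-> forall x, U x -> smooth_at f x.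
Proof.
move=> oU; split=> [h x Ux|h k]; first by exists U.
by apply: Ck_local => x /h[U' [_ U'x h']]; exists U'.
Qed.

Lemma smooth_at_near f g x : (\forall y \near x, f y = g y) ->
  smooth_at f x -> smooth_at g x.
Proof.
move=> /nbhs_open[Q [oQ Qx fg]] [U [oU Ux h]].
exists (Q `&` U); split=> [|//|k]; first exact: openI.
apply: Ck_ext (openI oQ oU) _ (Ck_sub _ (h k)) => [y [/fg]//|y []//].
Qed.

Lemma near_smooth_at f x : smooth_at f x -> \forall y \near x, smooth_at f y.
Proof.
move=> [U [oU Ux h]]; apply: filterS (open_nbhs_nbhs (conj oU Ux)) => y Uy.
by exists U.
Qed.

Lemma smooth_at_differentiable f x : smooth_at f x -> differentiable f x.
Proof. by move=> [U [_ Ux /(_ 1%N)[h _]]]; exact: h. Qed.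

Lemma smooth_at_continuous f x : smooth_at f x -> {for x, continuous f}.
Proof. by move/smooth_at_differentiable/differentiable_continuous. Qed.

Lemma near_smooth_differentiable f x :
  smooth_at f x -> \forall y \near x, differentiable f y.
Proof. by move/near_smooth_at; apply: filterS => y /smooth_at_differentiable. Qed.

Lemma smooth_at_diff f x v : smooth_at f x -> smooth_at (fun y => 'd f y v) x.
Proof.
by move=> [U [oU Ux h]]; exists U; split=> // k; have [_] := h k.+1; exact.
Qed.

Lemma smooth_at_cst (c : W) x : smooth_at (fun _ : V => c) x.
Proof. by exists setT; split=> [||k]; [exact: openT| |exact: Ck_cst]. Qed.

Lemma smooth_atD f g x : smooth_at f x -> smooth_at g x ->
  smooth_at (fun y => f y + g y) x.
Proof.
move=> [U [oU Ux hU]] [Q [oQ Qx hO]].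
exists (U `&` Q); split=> [|//|k]; first exact: openI.
by apply: CkD; [exact: openI|exact: Ck_sub (hU k)|exact: Ck_sub (hO k)].
Qed.

Lemma smooth_at_sum (I : Type) (r : seq I) (P : pred I) (h : I -> V -> W) x :
  (forall i, smooth_at (h i) x) ->
  smooth_at (fun y => \sum_(i <- r | P i) h i y) x.
Proof.
move=> hh; elim: r => [|i r IH].
  by apply: smooth_at_near (smooth_at_cst 0 x); near=> y; rewrite big_nil.
have [Pi|NPi] := boolP (P i).
  apply: smooth_at_near (smooth_atD (hh i) IH).
  by near=> y; rewrite big_cons Pi.
by apply: smooth_at_near IH; near=> y; rewrite big_cons (negbTE NPi).
Unshelve. all: by end_near. Qed.

End SmoothAt.

Section SmoothAtScalar.
Variables (R : realType) (V : normedModType R).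
Implicit Types (f g : V -> R^o) (x : V).

Lemma smooth_atM f g x : smooth_at f x -> smooth_at g x ->
  smooth_at (fun y => f y * g y : R^o) x.
Proof.
move=> [U [oU Ux hU]] [Q [oQ Qx hO]].
exists (U `&` Q); split=> [|//|k]; first exact: openI.
by apply: CkM; [exact: openI|exact: Ck_sub (hU k)|exact: Ck_sub (hO k)].
Qed.

Lemma smooth_at_prod (I : Type) (r : seq I) (h : I -> V -> R^o) x :
  (forall i, smooth_at (h i) x) ->
  smooth_at (fun y => \prod_(i <- r) h i y : R^o) x.
Proof.
move=> hh; elim: r => [|i r IH].
  by apply: smooth_at_near (smooth_at_cst (1 : R^o) x); near=> y; rewrite big_nil.
by apply: smooth_at_near (smooth_atM (hh i) IH); near=> y; rewrite big_cons.
Unshelve. all: by end_near. Qed.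

Lemma smooth_atV f x : f x != 0 -> smooth_at f x ->
  smooth_at (fun y => (f y)^-1 : R^o) x.
Proof.
move=> f0 hf.
have : \forall y \near x, f y != 0.
  exact: (cvgr_neq0 (f x) (smooth_at_continuous hf) f0).
move=> /nbhs_open[Q [oQ Qx O0]]; have [U [oU Ux hU]] := hf.
exists (Q `&` U); split=> [|//|k]; first exact: openI.
apply: CkV; [exact: openI|by move=> y [/O0]|].
by apply: Ck_sub (hU k) => y [].
Qed.

Lemma smooth_at_comp1 f (h : R^o -> R^o) x : smooth_at f x -> smooth_at h (f x) ->
  smooth_at (h \o f) x.
Proof.
move=> hf [Q [oQ Qx hO]]; have [U [oU Ux hU]] := hf.
have : nbhs x (f @^-1` Q) by exact: (smooth_at_continuous hf (open_nbhs_nbhs (conj oQ Qx))).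
rewrite nbhsE => -[B [oB Bx] BO].
exists (B `&` U); split=> [|//|k]; first exact: openI.
apply: (Ck_comp1 (openI oB oU) _ _ (hO k)); first by move=> y [/BO].
by apply: Ck_sub (hU k) => y [].
Qed.

Lemma smooth_at_compR n (f : V -> 'rV[R]_n) (h : 'rV[R]_n -> R^o) x :
  smooth_at f x -> smooth_at h (f x) -> smooth_at (h \o f) x.
Proof.
move=> hf [Q [oQ Qx hO]]; have [U [oU Ux hU]] := hf.
have : nbhs x (f @^-1` Q) by exact: (smooth_at_continuous hf (open_nbhs_nbhs (conj oQ Qx))).
rewrite nbhsE => -[B [oB Bx] BO].
exists (B `&` U); split=> [|//|k]; first exact: openI.
apply: (Ck_compR (openI oB oU) _ _ (hO k)); first by move=> y [/BO].
by apply: Ck_sub (hU k) => y [].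
Qed.

Lemma smooth_at_comp n m (f : V -> 'rV[R]_n) (h : 'rV[R]_n -> 'rV[R]_m) x :
  smooth_at f x -> smooth_at h (f x) -> smooth_at (h \o f) x.
Proof.
move=> hf [Q [oQ Qx hO]]; have [U [oU Ux hU]] := hf.
have : nbhs x (f @^-1` Q) by exact: (smooth_at_continuous hf (open_nbhs_nbhs (conj oQ Qx))).
rewrite nbhsE => -[B [oB Bx] BO].
exists (B `&` U); split=> [|//|k]; first exact: openI.
apply: (Ck_comp (openI oB oU) oQ _ _ (hO k)); first by move=> y [/BO].
by apply: Ck_sub (hU k) => y [].
Qed.

Lemma smooth_at_coordP n (f : V -> 'rV[R]_n) x :
  smooth_at f x <-> forall i, smooth_at (fun y => f y 0 i : R^o) x.
Proof.
split=> [[U [oU Ux hU]] i|h].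
  by exists U; split=> // k; exact: (iffLR (Ck_coordP k f oU) (hU k) i).
have /choice[U hU] := h.
have : \forall y \near x, forall i, U i y.
  by apply: filter_forall => i; have [oU Ux _] := hU i; exact: open_nbhs_nbhs.
move=> /nbhs_open[Q [oQ Qx QU]]; exists Q; split=> // k.
apply/Ck_coordP => // i; have [_ _ /(_ k)] := hU i.
by apply: Ck_sub => y /QU.
Qed.

Lemma smooth_at_scale n f (g : V -> 'rV[R]_n) x : smooth_at f x -> smooth_at g x ->
  smooth_at (fun y => f y *: g y) x.
Proof.
move=> hf /smooth_at_coordP hg; apply/smooth_at_coordP => i.
by apply: smooth_at_near (smooth_atM hf (hg i)); near=> y; rewrite mxE.
Unshelve. all: by end_near. Qed.

Lemma smooth_at_det n (A : V -> 'M[R]_n) x :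
  (forall i j, smooth_at (fun y => A y i j : R^o) x) ->
  smooth_at (fun y => \det (A y) : R^o) x.
Proof.
move=> hA; apply: smooth_at_sum => s; apply: smooth_atM.
  exact: smooth_at_cst.
exact: smooth_at_prod.
Qed.

(** Cramer's rule writes the entries of the inverse as cofactors over the determinant, and the
    determinant stays nonzero nearby. *)
Lemma smooth_at_invmx n (A : V -> 'M[R]_n) x : A x \in unitmx ->
  (forall i j, smooth_at (fun y => A y i j : R^o) x) ->
  (\forall y \near x, A y \in unitmx) /\
  forall i j, smooth_at (fun y => invmx (A y) i j : R^o) x.
Proof.
move=> Au hA; have hd := smooth_at_det hA.
have d0 : \det (A x) != 0 by rewrite -unitfE -unitmxE.
have nu : \forall y \near x, A y \in unitmx.
  have h0 := cvgr_neq0 (\det (A x)) (smooth_at_continuous hd) d0.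
  by apply: filterS (h0 _) => y /=; rewrite unitmxE unitfE.
split=> // i j.
have hc : smooth_at (fun y => cofactor (A y) j i : R^o) x.
  apply: smooth_atM; first exact: smooth_at_cst.
  apply: smooth_at_det => i' j'.
  by apply: smooth_at_near (hA (lift j i') (lift i j')); near=> y; rewrite !mxE.
apply: smooth_at_near (smooth_atM (smooth_atV d0 hd) hc).
by apply: filterS nu => y yu; rewrite /invmx yu !mxE.
Unshelve. all: by end_near. Qed.

Lemma smooth_at_mulmx m n p (A : V -> 'M[R]_(m, n)) (B : V -> 'M[R]_(n, p)) x :
  (forall i j, smooth_at (fun y => A y i j : R^o) x) ->
  (forall i j, smooth_at (fun y => B y i j : R^o) x) ->
  forall i j, smooth_at (fun y => (A y *m B y) i j : R^o) x.
Proof.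
move=> hA hB i j.
apply: smooth_at_near (@smooth_at_sum _ _ _ _ (index_enum _) xpredT
  _ _ (fun k => smooth_atM (hA i k) (hB k j))).
by near=> y; rewrite mxE.
Unshelve. all: by end_near. Qed.

End SmoothAtScalar.

Section SmoothAtRow.
Variables (R : realType).

Lemma smooth_at_linear n (W : normedModType R) (f : 'rV[R]_n -> W) x :
  linear f -> smooth_at f x.
Proof. by move=> lf; exists setT; split=> [||k]; [exact: openT| |exact: Ck_linear]. Qed.

(** [smooth_at_diff] differentiates in a fixed direction only; a moving direction [h y] is expanded
    in the standard basis, which leaves fixed directions with smooth coefficients. *)
Lemma smooth_at_diff_along (V : normedModType R) n m (f : 'rV[R]_n -> 'rV[R]_m)
    (g h : V -> 'rV[R]_n) x :
  smooth_at f (g x) -> smooth_at g x -> smooth_at h x ->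
  smooth_at (fun y => 'd f (g y) (h y)) x.
Proof.
move=> hf hg hh.
have hs i : smooth_at (fun y => h y 0 i *: 'd f (g y) 'e_i) x.
  apply: smooth_at_scale; first exact: (iffLR (smooth_at_coordP _ _) hh i).
  exact: (smooth_at_comp hg (smooth_at_diff 'e_i hf)).
apply: smooth_at_near (@smooth_at_sum _ _ _ _ (index_enum _) xpredT _ _ hs).
near=> y; rewrite [in RHS](row_sum_coord (h y)) linear_sum.
by apply: eq_bigr => i _; rewrite linearZ.
Unshelve. all: by end_near. Qed.

End SmoothAtRow.

(** * Mean value inequality and symmetry of second derivatives *)

Lemma nbhs_norm_ex (R : realType) (V : normedModType R) (x : V) (P : V -> Prop) :
  nbhs x P -> exists2 r, 0 < r & forall y, `|x - y| < r -> P y.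
Proof. by rewrite -nbhs_nbhs_norm => -[r r0 rP]; exists r => // y; exact: rP. Qed.

Lemma norm_coord_le (R : realType) n (v : 'rV[R]_n) i : `|v 0 i| <= `|v|.
Proof. by rewrite [leRHS]/Num.Def.normr/= mx_normrE (le_bigmax _ _ (0, i)). Qed.

Lemma norm_rV_le (R : realType) n (v : 'rV[R]_n) c : 0 <= c ->
  (forall i, `|v 0 i| <= c) -> `|v| <= c.
Proof.
move=> c0 h; rewrite [leLHS]/Num.Def.normr/= mx_normrE.
by apply/bigmax_leP; split=> // -[i j] _ /=; rewrite ord1.
Qed.

Lemma nbhs_norm_lt (R : realType) (V : normedModType R) (b : R) (t : V) :
  `|t| < b -> \forall s \near t, `|s| < b.
Proof.
by move=> tb; exact: (@norm_continuous _ V t _ (lt_nbhsl tb)).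
Qed.

Section MeanValue.
Variables (R : realType) (V : normedModType R).

Lemma is_derive_line (W : normedModType R) (f : V -> W) (a u : V) (s : R) :
  differentiable f (a + s *: u) ->
  is_derive s 1 (fun t => f (a + t *: u)) ('d f (a + s *: u) u).
Proof.
move=> df; pose c : R -> V := fun t => a + t *: u.
have [dc cu] : differentiable c s /\ 'd c s 1 = u.
  split; first by apply: differentiable_add; [exact: differentiable_cst|apply: differentiableZl].
  rewrite diff_addE; [|exact: differentiable_cst|by apply: differentiableZl].
  rewrite (diff_cst a s) diffZl //=.
  have -> : 'd (fun t : R => t) s = id :> (R -> R) by exact: diff_val.
  by rewrite add0r scale1r.
have dfc : differentiable (f \o c) s by apply: differentiable_comp.
have : is_derive s 1 (f \o c) ('D_1 (f \o c) s) by apply/derivableP/derivable1_diffP.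
by rewrite deriveE // diff_comp //= cu.
Qed.

Lemma line_MVT (f : V -> R^o) (a u : V) (h : R) : 0 < h ->
  (forall s, 0 <= s <= h -> differentiable f (a + s *: u)) ->
  exists2 s, 0 <= s <= h & f (a + h *: u) - f a = 'd f (a + s *: u) u * h.
Proof.
move=> h0 df.
have [|//|s] := @MVT R (fun t => f (a + t *: u)) (fun t => 'd f (a + t *: u) u) 0 h h0.
- move=> s; rewrite in_itv /= => /andP[/ltW s0 /ltW sh].
  by apply: is_derive_line; apply: df; rewrite s0.
- apply: derivable_within_continuous => s; rewrite in_itv /= => sh.
  by have [] := is_derive_line (df s sh).
- rewrite in_itv /= => /andP[/ltW s0 /ltW sh].
  by rewrite scale0r addr0 subr0 => ->; exists s; rewrite ?s0.
Qed.

Lemma ball_segment (x0 : V) (r : R) (a b : V) (s : R) :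
  `|x0 - a| < r -> `|x0 - b| < r -> 0 <= s <= 1 -> `|x0 - (a + s *: (b - a))| < r.
Proof.
move=> ar br /andP[s0 s1].
have -> : x0 - (a + s *: (b - a)) = (1 - s) *: (x0 - a) + s *: (x0 - b).
  rewrite scalerBl scale1r -addrA (addrC (- _)) -scalerBr.
  have -> : x0 - b - (x0 - a) = - (b - a) by rewrite addrC opprB addrA subrK opprB.
  by rewrite scalerN opprD addrA.
apply: le_lt_trans (ler_normD _ _) _; rewrite !normrZ ger0_norm ?subr_ge0 // (ger0_norm s0).
have [->|sN0] := eqVneq s 0; first by rewrite subr0 mul1r mul0r addr0.
have sp : 0 < s by rewrite lt_def sN0.
apply: (@lt_le_trans _ _ ((1 - s) * r + s * r)).
  apply: ler_ltD; first by apply: ler_wpM2l; [rewrite subr_ge0|exact: ltW].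
  by rewrite ltr_pM2l.
by rewrite -mulrDl subrK mul1r.
Qed.

(** The mean value equality holds for scalar functions only, so it is used coordinate by coordinate;
    as the norm is the maximum of the coordinates, the constant [L] is not enlarged. *)
Lemma mean_value_ball n (f : V -> 'rV[R]_n) (x0 : V) (r L : R) :
  (forall x, `|x0 - x| < r -> differentiable f x) ->
  (forall x v, `|x0 - x| < r -> `|'d f x v| <= L * `|v|) ->
  forall a b, `|x0 - a| < r -> `|x0 - b| < r -> `|f b - f a| <= L * `|b - a|.
Proof.
move=> df bf a b ar br.
have L0 : 0 <= L * `|b - a| by apply: le_trans (bf a (b - a) ar).
apply: norm_rV_le => // j; rewrite !mxE.
have seg s : 0 <= s <= 1 -> `|x0 - (a + s *: (b - a))| < r by exact: ball_segment.
have [s s01] := @line_MVT (fun y => f y 0 j : R^o) a (b - a) 1 ltr01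
  (fun s hs => iffLR (differentiable_coordP f _) (df _ (seg s hs)) j).
rewrite scale1r mulr1 (addrC a) subrK => ->.
rewrite diff_coord; last exact: df (seg s s01).
apply: le_trans (bf _ (b - a) (seg s s01)).
exact: norm_coord_le.
Qed.

(** The second difference of [f] over the parallelogram with sides [h *: u] and [h *: v], divided by
    [h * h], is symmetric in [u] and [v]. Two mean value steps identify it with either iterated
    derivative at some point of the parallelogram. With [e] half the supposed gap, both lie strictly
    within [e] of the same number, a contradiction. *)
Lemma schwarz (f : V -> R^o) (x0 u v : V) : smooth_at f x0 ->
  'd (fun y => 'd f y u : R^o) x0 v = 'd (fun y => 'd f y v : R^o) x0 u.
Proof.
move=> hf; apply/eqP; apply/negPn/negP => neq.
move: neq; set A := (X in X != _); set B := (X in _ != X) => neq.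
have e0 : 0 < `|A - B| / 2 by rewrite divr_gt0 ?normr_gt0 ?subr_eq0.
set e := `|A - B| / 2 in e0.
have key (w z : V) : \forall x \near x0, differentiable f x /\
    differentiable (fun y => 'd f y w : R^o) x /\
    `|'d (fun y => 'd f y w : R^o) x0 z - 'd (fun y => 'd f y w : R^o) x z| < e.
  have h1 := near_smooth_differentiable hf.
  have h2 := near_smooth_differentiable (smooth_at_diff w hf).
  have h3 := smooth_at_continuous (smooth_at_diff z (smooth_at_diff w hf)).
  have h4 : \forall x \near x0, `|'d (fun y => 'd f y w : R^o) x0 z - 'd (fun y => 'd f y w : R^o) x z| < e.
    by move/cvgrPdist_lt : h3; exact.
  by near=> x; split; [near: x|split; near: x].
have [r r0 br] := nbhs_norm_ex (filterI (key u v) (key v u)).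
(* The whole parallelogram must stay in the ball of radius [r]; the summand 1 covers [u = v = 0]. *)
pose h := r / (`|u| + `|v| + 1).
have d0 : 0 < `|u| + `|v| + 1 by rewrite ltr_wpDl ?addr_ge0.
have h0 : 0 < h by rewrite divr_gt0.
have inb s t : 0 <= s <= h -> 0 <= t <= h -> `|x0 - (x0 + s *: u + t *: v)| < r.
  move=> /andP[s0 sh] /andP[t0 th]; rewrite -addrA opprD addrA subrr add0r normrN.
  apply: le_lt_trans (ler_normD _ _) _; rewrite !normrZ (ger0_norm s0) (ger0_norm t0).
  apply: (@le_lt_trans _ _ (h * (`|u| + `|v|))).
    by rewrite mulrDr lerD // ler_wpM2r.
  by rewrite /h mulrAC ltr_pdivrMr // ltr_pM2l // ltrDl.
have step (w z : V) : (forall s t, 0 <= s <= h -> 0 <= t <= h ->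
      `|x0 - (x0 + s *: w + t *: z)| < r) ->
    (forall x, `|x0 - x| < r -> differentiable f x /\
    differentiable (fun y => 'd f y w : R^o) x /\
    `|'d (fun y => 'd f y w : R^o) x0 z - 'd (fun y => 'd f y w : R^o) x z| < e) ->
    `| 'd (fun y => 'd f y w : R^o) x0 z -
     (f (x0 + h *: w + h *: z) - f (x0 + h *: w) - f (x0 + h *: z) + f x0) / (h * h)| < e.
  move=> inb' kk; have hh : 0 <= h <= h by rewrite lexx ltW.
  have zh : (0 : R) <= 0 <= h by rewrite lexx ltW.
  pose g x : R^o := f (x + h *: z) - f x.
  have dg s : 0 <= s <= h -> differentiable g (x0 + s *: w) /\
     'd g (x0 + s *: w) w = 'd f (x0 + s *: w + h *: z) w - 'd f (x0 + s *: w) w.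
    move=> sh; have d1 := (kk _ (inb' s h sh hh)).1.
    have d2 := (kk _ (inb' s 0 sh zh)).1; rewrite scale0r addr0 in d2.
    have ds : differentiable (fun x => x + h *: z) (x0 + s *: w).
      by apply: differentiable_add; [exact: ex_diff|exact: differentiable_cst].
    have d3 : differentiable (f \o (fun x => x + h *: z)) (x0 + s *: w).
      by apply: differentiable_comp.
    have d4 := differentiableN d2.
    split; first exact: differentiable_add d3 d4.
    have dsE : 'd (fun x => x + h *: z) (x0 + s *: w) w = w.
      rewrite (diff_addE w _ (differentiable_cst _ _)); last exact: ex_diff.
      have -> : 'd (fun x : V => x) (x0 + s *: w) = id :> (V -> V) by exact: diff_val.
      by rewrite (diff_cst (h *: z)) addr0.
    apply: etrans (diff_addE w d3 d4) _; congr (_ + _).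
      by apply: etrans (congr1 (@^~ w) (diff_comp ds d1)) _ => /=; rewrite dsE.
    by rewrite diffN.
  (* First the mean value theorem in direction [w] for the increment [g], then in direction [z] for
     the derivative of [f] along [w]. *)
  have [s sh gE] := line_MVT h0 (fun s hs => (dg s hs).1).
  have [t th fE] := @line_MVT (fun y => 'd f y w : R^o) (x0 + s *: w) z h h0
     (fun t ht => (kk _ (inb' s t sh ht)).2.1).
  have -> : (f (x0 + h *: w + h *: z) - f (x0 + h *: w) - f (x0 + h *: z) + f x0) =
     'd (fun y => 'd f y w : R^o) (x0 + s *: w + t *: z) z * h * h.
    rewrite -fE -(dg s sh).2 -gE /g opprB addrA.
    by rewrite -!addrA; congr (_ + (_ + _)); rewrite addrC.
  rewrite -mulrA mulfK ?mulf_neq0 ?gt_eqF //.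
  exact: (kk _ (inb' s t sh th)).2.2.
have I1 := step u v inb (fun x bx => (br x bx).1).
have inb2 s t : 0 <= s <= h -> 0 <= t <= h -> `|x0 - (x0 + s *: v + t *: u)| < r.
  by move=> hs ht; rewrite addrAC; exact: inb.
have I2 := step v u inb2 (fun x bx => (br x bx).2).
have E2 : f (x0 + h *: v + h *: u) - f (x0 + h *: v) - f (x0 + h *: u) + f x0 =
    f (x0 + h *: u + h *: v) - f (x0 + h *: u) - f (x0 + h *: v) + f x0.
  by rewrite (addrAC x0 (h *: v)); congr (_ + _); rewrite [LHS]addrAC.
rewrite E2 in I2.
set D := (_ / _) in I1 I2.
have : `|A - B| < e + e.
  apply: le_lt_trans (ler_distD D A B) _.
  by apply: ltrD; [exact: I1|rewrite distrC; exact: I2].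
by rewrite /e -splitr ltxx.
Unshelve. all: by end_near. Qed.

Lemma schwarz_rV n (f : V -> 'rV[R]_n) (x0 u v : V) : smooth_at f x0 ->
  'd (fun y => 'd f y u) x0 v = 'd (fun y => 'd f y v) x0 u.
Proof.
move=> hf; apply/rowP => i.
rewrite -!diff_coord; try by apply: smooth_at_differentiable; exact: smooth_at_diff.
have hfi := iffLR (smooth_at_coordP f x0) hf i.
have E w : \forall y \near x0, 'd (fun x => f x 0 i : R^o) y w = 'd f y w 0 i.
  by apply: filterS (near_smooth_differentiable hf) => y dy; rewrite diff_coord.
have D w := smooth_at_differentiable (smooth_at_diff w hfi).
apply: etrans (congr1 (@^~ v) (near_diffE (E u) (D u))) _.
apply: etrans (esym (congr1 (@^~ u) (near_diffE (E v) (D v)))).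
exact: schwarz.
Qed.

End MeanValue.

(** * A smooth function that is flat at the origin *)

Section Bump.
Variables (R : realType).

(* The family [t^-k exp (- 1/t)], extended by 0, is stable under derivation up to
   linear combinations, hence consists of smooth functions. *)
Definition flat_exp (k : nat) (t : R^o) : R^o :=
  if 0 < t then (t^-1) ^+ k * expR (- t^-1) else 0.

Lemma flat_exp_pos k (t : R^o) : 0 < t ->
  is_derive t (1 : R^o) (flat_exp k) (flat_exp k.+2 t - k%:R * flat_exp k.+1 t).
Proof.
move=> t0; have tN0 : t != 0 by rewrite gt_eqF.
(* In the variable [t^-1] the function is a polynomial times an exponential, so the chain rule
   through inversion gives its derivative. *)
pose phi : R -> R := (id ^+ k) * (expR \o (fun u => - u)).
have dphi (u : R) : is_derive u 1 phi (k%:R * u ^+ k.-1 * expR (- u) - u ^+ k * expR (- u)).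
  have d1 : is_derive u 1 (id ^+ k : R -> R) (k%:R * u ^+ k.-1).
    case: k @phi => [|k'] _.
      by rewrite mul0r (_ : id ^+ 0 = cst 1) //; exact: is_derive_cst.
    by apply: is_derive_eq; rewrite scaler1.
  have d2 : is_derive u 1 (expR \o (fun u => - u)) (expR (- u) * -1).
    exact: is_derive1_comp.
  apply: (is_derive_eq (is_deriveM d1 d2)).
  rewrite mulrN1 scalerN addrC; congr (_ - _); last by rewrite exprfctE.
  by rewrite [LHS]mulrC.
have dV : is_derive t 1 (fun y : R => y^-1) (- t ^- 2).
  have := @is_deriveV R id t 1 1 tN0 (is_derive_id _ _).
  by rewrite scaler1.
have dc := is_derive1_comp (dphi t^-1) dV.
have E : \forall y \near t, phi (y^-1) = flat_exp k y.
  near=> y; have y0 : 0 < y by near: y; exact: (@lt_nbhsr R).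
  by rewrite /flat_exp y0 /phi fctE /= exprfctE.
apply: (near_eq_is_derive E).
apply: (is_derive_eq dc).
have -> : t ^- 2 = t^-1 * t^-1 by rewrite -exprVn expr2.
rewrite /flat_exp t0 !exprS.
set u := t^-1; set w := expR _.
case: k {phi dphi dc E} => [|k] /=; first by rewrite !mul0r expr0 sub0r subr0; ring.
by rewrite exprS; ring.
Unshelve. all: by end_near. Qed.

(** From [(x / n) ^+ n <= expR x] at [x = t^-1]: of the exponent [n = k.+2], [k] absorbs the pole
    and 2 is left over. This quadratic bound makes the derivative at the origin vanish in
    [flat_exp_diff]. *)
Lemma flat_exp_le k : exists2 C, 0 < C & forall t : R, `|flat_exp k t| <= C * t ^+ 2.
Proof.
pose n := k.+2; exists (n%:R ^+ n); first by rewrite exprn_gt0 // ltr0n.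
move=> t; rewrite /flat_exp; case: ifPn => [t0|_]; last first.
  by rewrite normr0 mulr_ge0 ?sqr_ge0 // exprn_ge0.
have tV : 0 < t^-1 by rewrite invr_gt0.
rewrite ger0_norm; last by rewrite mulr_ge0 ?expR_ge0 // exprn_ge0 // ltW.
have nN0 : n%:R != 0 :> R by rewrite pnatr_eq0.
have n0 : 0 < n%:R :> R by rewrite ltr0n.
have : (t^-1 / n%:R) ^+ n <= expR (t^-1).
  have E : t^-1 = n%:R * (t^-1 / n%:R) by rewrite mulrCA mulfV // mulr1.
  rewrite [in leRHS]E expRM_natl.
  rewrite lerXn2r ?nnegrE ?expR_ge0 ?divr_ge0 ?ltW //.
  by apply: lt_le_trans (expR_ge1Dx _); rewrite ltrDr.
rewrite expRN => h.
rewrite ler_pdivrMr ?expR_gt0 //.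
apply: le_trans (_ : n%:R ^+ n * t ^+ 2 * (t^-1 / n%:R) ^+ n <= _); last first.
  by apply: ler_wpM2l h; rewrite mulr_ge0 ?sqr_ge0 // exprn_ge0.
rewrite expr_div_n mulrC mulrA divfK ?expf_neq0 //.
rewrite /n !exprS expr0 mulr1.
rewrite [leRHS](_ : _ = (t^-1 ^+ k) * ((t^-1 * t) * (t^-1 * t))); last by ring.
by rewrite mulVf ?gt_eqF // !mulr1.
Qed.

Lemma flat_exp_diff k (t v : R^o) : differentiable (flat_exp k) t /\
  'd (flat_exp k) t v = v * (flat_exp k.+2 t - k%:R * flat_exp k.+1 t).
Proof.
suff H : is_derive t (1 : R^o) (flat_exp k) (flat_exp k.+2 t - k%:R * flat_exp k.+1 t).
  have [dt Dt] := H; have df : differentiable (flat_exp k) t by apply/derivable1_diffP.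
  split=> //; have -> : v = v *: (1 : R^o) by rewrite [RHS]mulr1.
  by rewrite linearZ -deriveE // Dt -[v *: 1]/(v * 1) mulr1.
have [t0|t0|->] := ltgtP t 0; last 1 first.
- have [C C0 hC] := flat_exp_le k.
  rewrite /flat_exp ltxx mulr0 subr0.
  suff D : h^-1 *: (flat_exp k (h *: 1 + 0) - flat_exp k 0) @[h --> (0 : R)^'] --> (0 : R).
    by apply: DeriveDef; [apply/cvg_ex; exists 0|apply: cvg_lim D].
  apply/cvgr0Pnorm_lt => e e0; near=> h.
  have hN0 : h != 0 by near: h; exact: nbhs_dnbhs_neq.
  rewrite {2}/flat_exp ltxx subr0 addr0 [h *: 1]mulr1 normrM normfV.
  rewrite ltr_pdivrMl ?normr_gt0 //; apply: le_lt_trans (hC h) _.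
  rewrite -real_normK ?num_real // expr2 mulrA mulrC ltr_pM2l ?normr_gt0 //.
  rewrite mulrC -ltr_pdivlMr //; near: h; apply: dnbhs0_lt.
  by rewrite divr_gt0.
- rewrite /flat_exp !ltNge ltW //= mulr0 subr0.
  apply: (near_eq_is_derive _ (is_derive_cst (0 : R^o) t (1 : R^o))).
  by near=> y; rewrite ltNge ltW //=; near: y; exact: (@lt_nbhsl R).
exact: flat_exp_pos.
Unshelve. all: by end_near. Qed.

Lemma smooth_flat_exp k (x : R^o) : smooth_at (flat_exp k) x.
Proof.
exists setT; split=> [||j]; [exact: openT|by []|].
elim: j k => [|j IH] k.
  move=> y _; apply: differentiable_continuous; exact: (flat_exp_diff k y 0).1.
split=> [y _|v]; first exact: (flat_exp_diff k y 0).1.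
apply: (@Ck_ext _ _ _ _ _ (fun y => v * flat_exp k.+2 y + (- v * k%:R) * flat_exp k.+1 y : R^o));
  first exact: openT.
  by move=> y _; rewrite (flat_exp_diff k y v).2; ring.
by apply: CkD; [exact: openT| |]; apply: CkM; (try exact: openT);
  [exact: Ck_cst|exact: IH|exact: Ck_cst|exact: IH].
Qed.

End Bump.

(** * Ordinary differential equations *)

Section Antiderivative.
Variables (R : realType).

Lemma antiderivative (u : R -> R) (a : R) : 0 < a -> continuous u ->
  exists U : R -> R, U 0 = 0 /\ forall t : R, `|t| < a -> is_derive t 1 U (u t).
Proof.
move=> a0 cu; set mu := @lebesgue_measure R.
(* Integrating from [- a] instead of 0 makes times of both signs interior points of one interval;
   the value at 0 is subtracted afterwards. *)
pose F x : R := (\int[mu]_(t in [set` `[- a, x]]) (u t))%R.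
have iu : mu.-integrable `[- a, a] (EFin \o u).
  apply: continuous_compact_integrable; first exact: segment_compact.
  exact: continuous_subspaceT.
exists (fun x => F x - F 0); split=> [|t]; first by rewrite subrr.
rewrite ltr_norml => /andP[at0 ta].
have [dF eF] := continuous_FTC1_closed ta iu at0 (cu t).
rewrite derive1E in eF; have dFt : is_derive t 1 F (u t) by exact: (DeriveDef dF eF).
by apply: (is_derive_eq (is_deriveB dFt (is_derive_cst (F 0) t 1))); rewrite subr0.
Qed.

Lemma is_derive_coordP n (z : R -> 'rV[R]_n) (t : R) (w : 'rV[R]_n) :
  is_derive t 1 z w <-> forall i, is_derive t 1 (fun s => z s 0 i) (w 0 i).
Proof.
split=> [[dz zw] i|h].
  have dzt : differentiable z t by apply/derivable1_diffP.
  have dzi := iffLR (differentiable_coordP z t) dzt i.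
  apply: DeriveDef; first by apply/derivable1_diffP.
  by rewrite deriveE // -zw deriveE // (diff_coord (1 : R) i dzt).
have dz : differentiable z t.
  by apply/differentiable_coordP => i; apply/derivable1_diffP; have [] := h i.
apply: DeriveDef; first by apply/derivable1_diffP.
apply/rowP => i; rewrite deriveE // -(diff_coord (1 : R) i dz).
have [di <-] := h i; rewrite deriveE //; exact/derivable1_diffP.
Qed.

Lemma antiderivative_rV n (u : R -> 'rV[R]_n) (a : R) : 0 < a -> continuous u ->
  exists U : R -> 'rV[R]_n, U 0 = 0 /\ forall t : R, `|t| < a -> is_derive t 1 U (u t).
Proof.
move=> a0 cu.
have cui i : continuous (fun t => u t 0 i).
  by move=> t; exact: (iffLR (continuous_coordP u t) (cu t) i).
have /choice[U hU] := fun i => antiderivative a0 (cui i).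
exists (fun t => \row_i U i t); split=> [|t ta].
  by apply/rowP => i; rewrite !mxE (hU i).1.
apply/is_derive_coordP => i.
rewrite (_ : (fun s => _) = U i); first exact: (hU i).2.
by apply/funext => s; rewrite mxE.
Qed.

Lemma is_derive_diff (W : normedModType R) (z : R -> W) (t v : R) w :
  is_derive t 1 z w -> differentiable z t /\ 'd z t v = v *: w.
Proof.
move=> [dz <-]; have d : differentiable z t by apply/derivable1_diffP.
split=> //; rewrite deriveE // -linearZ; congr ('d z t _).
by rewrite -[v *: 1]/(v * 1) mulr1.
Qed.

Lemma mean_value_origin n (z w : R -> 'rV[R]_n) (a K : R) : z 0 = 0 ->
  (forall t : R, `|t| < a -> is_derive t 1 z (w t)) ->
  (forall t, `|w t| <= K) -> 0 <= K -> forall t : R, `|t| < a -> `|z t| <= K * `|t|.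
Proof.
move=> z0 dz wK K0 t ta.
have a0 : 0 < a by apply: le_lt_trans ta.
have := @mean_value_ball R R^o n z 0 a K _ _ 0 t.
rewrite z0 !subr0 !sub0r normrN normr0; apply=> //.
  by move=> x; rewrite sub0r normrN => /dz/(is_derive_diff 0)[].
move=> x v; rewrite sub0r normrN => /dz/(is_derive_diff v)[_ ->].
by rewrite normrZ mulrC; apply: ler_wpM2r.
Qed.

End Antiderivative.

Section Limit.
Variables (R : realType).

(** With [c k] the geometric tail, [u k - c k] increases and [u k + c k] decreases, so the supremum
    of the former is a limit with an explicit rate. The rate is what the passage to the limit in
    Picard's iteration consumes. *)
Lemma geometric_limit (u : nat -> R) (K : R) : 0 <= K ->
  (forall k, `|u k.+1 - u k| <= K / 2 ^+ k) ->
  exists l, forall k, `|u k - l| <= 2 * K / 2 ^+ k.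
Proof.
move=> K0 hu; pose c k : R := 2 * K / 2 ^+ k.
have c0 k : 0 <= c k by rewrite /c divr_ge0 ?mulr_ge0 ?exprn_ge0.
have cS k : c k = K / 2 ^+ k + c k.+1.
  rewrite /c exprS; field; exact: expf_neq0.
have lo : {homo (fun k => u k - c k) : i j / (i <= j)%N >-> i <= j}.
  apply: homo_leq => // [i j k|k]; first exact: le_trans.
  have := hu k; rewrite ler_norml => /andP[+ _]; have := cS k; have := cS k.+1; lra.
have hi : {homo (fun k => - (u k + c k)) : i j / (i <= j)%N >-> i <= j}.
  apply: homo_leq => // [i j k|k]; first exact: le_trans.
  have := hu k; rewrite ler_norml => /andP[_]; have := cS k; have := cS k.+1; lra.
have lohi i j : u i - c i <= u j + c j.
  have := lo _ _ (leq_maxl i j); have := hi _ _ (leq_maxr i j).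
  have := c0 (maxn i j); lra.
pose S := [set u k - c k | k in [set: nat]].
have bS : has_sup S.
  split; first by exists (u 0%N - c 0%N), 0%N.
  by exists (u 0%N + c 0%N) => _ [k _ <-].
exists (sup S) => k; rewrite ler_norml.
have h1 : u k - c k <= sup S by apply: sup_upper_bound => //; exists k.
have h2 : sup S <= u k + c k.
  by apply: ge_sup; [exact: bS.1|move=> _ [j _ <-]].
by apply/andP; move: h1 h2; rewrite /c; split; lra.
Qed.

Lemma geometric_limit_rV n (u : nat -> 'rV[R]_n) (K : R) : 0 <= K ->
  (forall k, `|u k.+1 - u k| <= K / 2 ^+ k) ->
  exists l, forall k, `|u k - l| <= 2 * K / 2 ^+ k.
Proof.
move=> K0 hu.
have hui i k : `|u k.+1 0 i - u k 0 i| <= K / 2 ^+ k.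
  apply: le_trans (hu k); have := norm_coord_le (u k.+1 - u k) i.
  by rewrite !mxE.
have /choice[l hl] := fun i => geometric_limit K0 (hui i).
exists (\row_i l i) => k; apply: norm_rV_le => [|i].
  by rewrite divr_ge0 ?mulr_ge0 ?exprn_ge0.
by rewrite !mxE; exact: hl.
Qed.

Lemma geometric_small (K e : R) : 0 < e -> exists k : nat, K / 2 ^+ k < e.
Proof.
move=> e0; have [k hk] : exists k : nat, K / e < k%:R.
  by exists (Num.truncn (K / e)).+1; exact: truncnS_gt.
exists k; rewrite ltr_pdivrMr ?exprn_gt0 // mulrC -ltr_pdivrMr //.
apply: lt_trans hk _; rewrite -natrX ltr_nat; exact: ltn_expl.
Qed.

End Limit.

Section Picard.
Variables (R : realType) (d : nat).
Implicit Types (G : 'rV[R]_d -> 'rV[R]_d).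

(* Clamping the coordinates extends a vector field that is Lipschitz on a cube to a
   globally Lipschitz one, so that Picard iterates need not be kept in the cube. *)
Definition clamp (a b x : R) : R := Num.max a (Num.min x b).

Lemma clamp_id a b x : a <= x <= b -> clamp a b x = x.
Proof. by move=> /andP[ax xb]; rewrite /clamp min_l // max_r. Qed.

Lemma clamp_mem a b x : a <= b -> a <= clamp a b x <= b.
Proof.
move=> ab; rewrite /clamp le_max lexx /= ge_max ab ge_min lexx orbT.
by [].
Qed.

Lemma clamp_lipschitz a b x y : `|clamp a b x - clamp a b y| <= `|x - y|.
Proof.
have maxL (u v : R) : `|Num.max a u - Num.max a v| <= `|u - v|.
  have := ler_norm (u - v); have := ler_norm (v - u); rewrite distrC.
  set n := `|u - v|; rewrite ler_norml.
  by case: (leP a u) => au; case: (leP a v) => av h1 h2; apply/andP; split; lra.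
have minL (u v : R) : `|Num.min u b - Num.min v b| <= `|u - v|.
  have := ler_norm (u - v); have := ler_norm (v - u); rewrite distrC.
  set n := `|u - v|; rewrite ler_norml.
  by case: (leP u b) => ub; case: (leP v b) => vb h1 h2; apply/andP; split; lra.
exact: le_trans (maxL _ _) (minL _ _).
Qed.

Lemma lipschitz_continuous (V W : normedModType R) (f : V -> W) (L : R) :
  (forall x y, `|f x - f y| <= L * `|x - y|) -> continuous f.
Proof.
move=> hf x; apply/cvgrPdist_lt => e e0; near=> y.
apply: le_lt_trans (hf x y) _; apply: (@le_lt_trans _ _ ((`|L| + 1) * `|x - y|)).
  by apply: ler_wpM2r => //; rewrite -[leLHS]addr0 lerD // ler_norm.
rewrite mulrC -ltr_pdivlMr ?ltr_wpDl //; near: y.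
by apply: cvgr_dist_lt; [exact: cvg_id|rewrite divr_gt0 // ltr_wpDl].
Unshelve. all: by end_near. Qed.

Lemma picard_global G (L : R) (z0 : 'rV[R]_d) : 0 < L ->
  (forall x y, `|G x - G y| <= L * `|x - y|) ->
  exists b (z : R -> 'rV[R]_d), [/\ 0 < b, z 0 = z0 &
    forall t : R, `|t| < b -> is_derive t 1 z (G (z t))].
Proof.
move=> L0 lipG; have cG := lipschitz_continuous lipG.
(* [L * b = 1 / 2] is the contraction factor. Primitives are taken up to radius [2 * b], so that
   times of modulus at most [b] are interior. *)
pose b := (2 * L)^-1; have b0 : 0 < b by rewrite invr_gt0 mulr_gt0.
have a0 : 0 < 2 * b by rewrite mulr_gt0.
have ba : b < 2 * b by rewrite mulr_natl mulr2n ltrDl.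
pose prim (x U : R -> 'rV[R]_d) := U 0 = 0 /\
  forall t : R, `|t| < 2 * b -> is_derive t 1 U (G (x t)).
(* [choice] wants a total operator, so discontinuous functions receive an arbitrary value. *)
have /choice[I hI] (x : R -> 'rV[R]_d) : exists U, continuous x -> prim x U.
  have [cx|ncx] := pselect (continuous x); last by exists (cst 0).
  have cGx : continuous (G \o x) by move=> t; apply: continuous_comp; [exact: cx|exact: cG].
  by have [U hU] := antiderivative_rV a0 cGx; exists U.
(* Freezing time outside [[- b, b]] keeps every iterate continuous on the whole line, as the
   integral operator requires. *)
pose c := clamp (- b) b.
have cb t : `|c t| <= b by rewrite ler_norml; apply: clamp_mem; lra.
have cab t : `|c t| < 2 * b by apply: le_lt_trans (cb t) ba.
pose Phi x t := z0 + I x (c t).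
have cPhi x : continuous x -> continuous (Phi x).
  move=> cx t; apply: cvgD; first exact: cvg_cst.
  have cc : {for t, continuous c}.
    by apply: (@lipschitz_continuous R^o R^o c 1) => y z; rewrite mul1r; exact: clamp_lipschitz.
  apply: (@continuous_comp _ _ _ c (I x) t cc).
  apply: differentiable_continuous.
  exact: (is_derive_diff 0 ((hI x cx).2 _ (cab t))).1.
have contr x y K : continuous x -> continuous y -> 0 <= K ->
    (forall t, `|x t - y t| <= K) -> forall t, `|Phi x t - Phi y t| <= K / 2.
  move=> cx cy K0 xyK t; rewrite /Phi opprD addrACA subrr add0r.
  have LK0 : 0 <= L * K by rewrite mulr_ge0 // ltW.
  have [Ix0 dIx] := hI x cx; have [Iy0 dIy] := hI y cy.
  have := @mean_value_origin R d (fun s => I x s - I y s) (fun s => G (x s) - G (y s)) (2 * b) (L * K).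
  rewrite Ix0 Iy0 subrr => /(_ erefl) h.
  apply: (le_trans (h _ _ LK0 (c t) (cab t))).
  - by move=> s sb; exact: (is_deriveB (dIx s sb) (dIy s sb)).
  - move=> s; apply: le_trans (lipG _ _) _; by rewrite ler_pM2l.
  - apply: (@le_trans _ _ (L * K * b)); first exact: ler_wpM2l.
    rewrite /b invfM le_eqVlt; apply/orP; left; apply/eqP.
    by field; rewrite gt_eqF.
pose x k := iter k Phi (cst z0).
have cx k : continuous (x k) by elim: k => [|k IH]; [move=> t; exact: cvg_cst|exact: cPhi].
pose K := `|G z0| * b.
have K0 : 0 <= K by rewrite mulr_ge0 // ltW.
have hx k : forall t, `|x k.+1 t - x k t| <= K / 2 ^+ k.
  elim: k => [|k IH] t.
    rewrite expr0 divr1 /= /Phi addrC addKr.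
    have [I0 dI] := hI (cst z0) (cx 0%N).
    apply: (@le_trans _ _ (`|G z0| * `|c t|)); last exact: ler_wpM2l.
    exact: (@mean_value_origin R d (I (cst z0)) (fun s => G (cst z0 s)) (2 * b)).
  apply: (le_trans (contr _ _ _ (cx k.+1) (cx k) _ IH t)).
    by rewrite divr_ge0 ?exprn_ge0.
  by rewrite exprSr -mulrA -invfM.
have /choice[z hz] := fun t => geometric_limit_rV K0 (fun k => hx k t).
have cz : continuous z.
  move=> t; apply/cvgrPdist_lt => e e0.
  have e3 : 0 < e / 3 by rewrite divr_gt0.
  have [k hk] := geometric_small (2 * K) e3.
  have := cx k t; move/cvgrPdist_lt => /(_ _ e3); apply: filterS => s hs.
  have h1 := hz t k; have h2 := hz s k.
  have -> : z t - z s = - (x k t - z t) + (x k t - x k s) + (x k s - z s).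
    by rewrite opprB !subrKA.
  apply: le_lt_trans (ler_normD _ _) _; apply: le_lt_trans (lerD (ler_normD _ _) (lexx _)) _.
  rewrite normrN; move: h1 h2 hs hk; lra.
(* By contraction, a positive gap between [Phi z t] and [z t] would lie below [2 * K / 2 ^+ k] for
   every [k]. *)
have Pz : Phi z = z.
  apply/funext => t; apply/eqP; rewrite -subr_eq0 -normr_eq0; apply/negPn/negP => n0.
  have e0 : 0 < `|Phi z t - z t| by rewrite lt_def n0 /=.
  have [k hk] := geometric_small (2 * K) e0.
  have Ck0 : 0 <= 2 * K / 2 ^+ k by apply: divr_ge0; [exact: mulr_ge0|exact: exprn_ge0].
  have h1 := contr _ _ _ (cx k) cz Ck0 (fun s => hz s k) t.
  have h2 := hz t k.+1.
  have : `|Phi z t - z t| <= 2 * K / 2 ^+ k.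
    have -> : Phi z t - z t = - (Phi (x k) t - Phi z t) + (x k.+1 t - z t).
      by rewrite opprB subrKA.
    apply: le_trans (ler_normD _ _) _; rewrite normrN.
    have E : 2 * K / 2 ^+ k.+1 = (2 * K / 2 ^+ k) / 2 by rewrite exprS; field; exact: expf_neq0.
    rewrite E in h2; move: h1 h2; lra.
  by move=> h; move: (le_lt_trans h hk); rewrite ltxx.
have [I0 dI] := hI z cz.
exists b, z; split=> //.
  by rewrite -Pz /Phi /c clamp_id ?I0 ?addr0 // oppr_le0 ltW.
move=> t tb.
apply: (@near_eq_is_derive _ _ _ (fun s => z0 + I z s)).
  near=> s; rewrite -[RHS](congr1 (@^~ s) Pz) /Phi /c clamp_id // -ler_norml ltW //.
  by near: s; exact: (@nbhs_norm_lt R R^o).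
apply: (is_derive_eq (is_deriveD (is_derive_cst z0 t 1) (dI t (lt_trans tb ba)))).
by rewrite add0r.
Unshelve. all: by end_near. Qed.

End Picard.

Section LocalODE.
Variables (R : realType) (d : nat).
Implicit Types (G : 'rV[R]_d -> 'rV[R]_d).

Lemma smooth_ball_bound G (z0 : 'rV[R]_d) : smooth_at G z0 ->
  exists r L, [/\ 0 < r, 0 < L,
    forall x : 'rV[R]_d, `|z0 - x| < r -> smooth_at G x &
    forall x v : 'rV[R]_d, `|z0 - x| < r -> `|'d G x v| <= L * `|v|].
Proof.
move=> sG.
have near_bound i : \forall x \near z0, `|'d G x 'e_i| <= `|'d G z0 'e_i| + 1.
  have := smooth_at_continuous (smooth_at_diff 'e_i sG).
  move=> /cvgrPdist_lt /(_ 1 ltr01); apply: filterS => x hx.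
  rewrite -lerBlDl; apply: le_trans (lerB_dist _ _) _; rewrite distrC.
  exact: ltW.
have [r r0 hr] := nbhs_norm_ex (filterI (near_smooth_at sG) (filter_forall _ near_bound)).
(* The leading 1 keeps the constant positive in dimension 0, where the sum is empty. *)
exists r, (1 + \sum_i (`|'d G z0 'e_i| + 1)); split=> //.
- by rewrite ltr_pwDl // sumr_ge0 // => i _; rewrite addr_ge0.
- by move=> x /hr[].
move=> x v xr; have [_ bx] := hr _ xr;
apply: (eq_ind_r (fun w => `|w| <= _) _ (diff_row_sum G x v)).
apply: le_trans (ler_norm_sum _ _ _) _; rewrite mulrDl mul1r mulr_suml.
apply: (@le_trans _ _ (0 + \sum_i (`|'d G z0 'e_i| + 1) * `|v|)); last by rewrite lerD2r.
rewrite add0r; apply: ler_sum => i _; rewrite normrZ mulrC.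
by apply: ler_pM => //; exact: norm_coord_le.
Qed.

Definition clamp_row (z0 : 'rV[R]_d) (r : R) (x : 'rV[R]_d) : 'rV[R]_d :=
  \row_i clamp (z0 0 i - r) (z0 0 i + r) (x 0 i).

(** The global theorem is applied to [G \o rho], with [rho] clamping to the cube of half side
    [r / 2], inside the ball where [G] is Lipschitz. By continuity at time 0 the solution stays for
    a while in the cube, where [rho] is the identity. *)
Lemma ode_local G (z0 : 'rV[R]_d) : smooth_at G z0 ->
  exists b (z : R -> 'rV[R]_d), [/\ 0 < b, z 0 = z0 &
    forall t : R, `|t| < b -> smooth_at G (z t) /\ is_derive t 1 z (G (z t))].
Proof.
move=> /smooth_ball_bound[r [L [r0 L0 sG bG]]].
have r20 : 0 < r / 2 by rewrite divr_gt0.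
have r2r : r / 2 < r by rewrite ltr_pdivrMr // mulr_natr mulr2n ltrDl.
pose rho := clamp_row z0 (r / 2).
have rho_ball x : `|z0 - rho x| < r.
  apply: le_lt_trans r2r; apply: norm_rV_le => [|i]; first exact: ltW.
  rewrite !mxE distrC ler_norml.
  have /andP[] : z0 0 i - r / 2 <= clamp (z0 0 i - r / 2) (z0 0 i + r / 2) (x 0 i) <= z0 0 i + r / 2.
    by apply: clamp_mem; lra.
  by move=> ? ?; apply/andP; split; lra.
have rho_lip x y : `|rho x - rho y| <= `|x - y|.
  apply: norm_rV_le => // i; rewrite !mxE; apply: le_trans (clamp_lipschitz _ _ _ _) _.
  by have := norm_coord_le (x - y) i; rewrite !mxE.
have rho_id x : `|z0 - x| < r / 2 -> rho x = x.
  move=> xr; apply/rowP => i; rewrite mxE clamp_id //.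
  have := le_lt_trans (norm_coord_le (z0 - x) i) xr; rewrite !mxE ltr_norml.
  by move=> /andP[? ?]; apply/andP; split; lra.
have lipG x y : `|G (rho x) - G (rho y)| <= L * `|x - y|.
  apply: (@le_trans _ _ (L * `|rho x - rho y|)); last by rewrite ler_pM2l.
  apply: (@mean_value_ball _ _ _ G z0 r L) => //.
  by move=> w /sG/smooth_at_differentiable.
have [b [z [b0 zz0 dz]]] := picard_global z0 L0 lipG.
have cz0 : {for 0, continuous z}.
  apply: differentiable_continuous.
  by apply: (is_derive_diff 0 (dz 0 _)).1; rewrite normr0.
have : \forall t \near (0 : R), `|z0 - z t| < r / 2.
  by move/cvgrPdist_lt : cz0 => /(_ _ r20); rewrite zz0.
move=> /nbhs_norm_ex[b' b'0 hb'].
exists (Num.min b b'), z; split=> //; first by rewrite lt_min b0.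
move=> t; rewrite lt_min => /andP[tb tb'].
have zt : `|z0 - z t| < r / 2 by apply: hb'; rewrite sub0r normrN.
split; first by apply: sG; apply: lt_trans r2r.
by have := dz t tb; rewrite rho_id.
Qed.

(** Bootstrapping: if [z] is of class C^k then so is its derivative [G \o z]. *)
Lemma ode_smooth G (b : R) (z : R -> 'rV[R]_d) :
  (forall t : R, `|t| < b -> smooth_at G (z t) /\ is_derive t 1 z (G (z t))) ->
  forall t : R, `|t| < b -> smooth_at (z : R^o -> _) t.
Proof.
move=> hz; pose I := [set t : R^o | `|t| < b].
have oI : open I.
  by rewrite openE => t tb; exact: (@nbhs_norm_lt R R^o).
have dz (t v : R) : I t -> differentiable z t /\ 'd z t v = v *: G (z t).
  by move=> /hz[_ /(is_derive_diff v)].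
suff H k : Ck (V := R^o) k I z by move=> t tb; exists I.
elim: k => [|k IH].
  by move=> t /(dz t 0)[dzt _]; exact: (differentiable_continuous dzt).
split=> [t /(dz t 0)[]//|v].
pose Q := [set x | smooth_at G x].
have oQ : open Q by rewrite openE => x /near_smooth_at.
have QG : Ck k Q G by exact: (iffRL (smooth_onP G oQ) (fun x Qx => Qx) k).
have IQ t : I t -> Q (z t) by move=> /hz[].
have hc : Ck (V := R^o) k I (G \o z) := Ck_comp oI oQ IQ IH QG.
apply: (@Ck_ext _ R^o _ _ _ (fun t => v *: G (z t))) => //.
  by move=> t It; rewrite (dz t v It).2.
apply/Ck_coordP => // i.
apply: Ck_ext oI _ (CkM oI (Ck_cst k I (v : R^o)) (iffLR (Ck_coordP k _ oI) hc i)).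
by move=> t _ /=; rewrite mxE.
Qed.

End LocalODE.

(** * Fields on manifolds in charts *)

Section Charts.
Variables (R : realType) (n : nat) (M : manifold R n).
Implicit Types (p q : M).

Definition dom p : set M := chart_dom (chart_at p).

Lemma dom_open p : open (dom p).
Proof. exact: chart_dom_open. Qed.

Lemma mem_dom p : dom p p.
Proof. exact: mem_chart_at. Qed.

Lemma nbhs_dom p q : dom p q -> nbhs q (dom p).
Proof. by move=> h; apply: open_nbhs_nbhs; split=> //; exact: dom_open. Qed.

Lemma to_coordK p q : dom p q -> of_coord p (to_coord p q) = q.
Proof. exact: chart_mapK. Qed.

Lemma to_coord_continuous p q : dom p q -> {for q, continuous (to_coord p)}.
Proof. exact: chart_map_cont. Qed.

Lemma of_coord_near p q (A : set M) : dom p q -> nbhs q A ->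
  \forall x \near to_coord p q, chart_cod (chart_at p) x /\ A (of_coord p x).
Proof.
move=> pq qA; have cx := chart_map_cod pq.
have h : nbhs (to_coord p q) (of_coord p @^-1` A).
  by apply: (chart_inv_cont cx); rewrite /of_coord chart_mapK.
have h' := open_nbhs_nbhs (conj (@chart_cod_open _ _ _ (chart_at p)) cx).
by apply: filterS2 h' h.
Qed.

Lemma open_of_coord p (A : set M) : open A ->
  open [set x | chart_cod (chart_at p) x /\ A (of_coord p x)].
Proof.
move=> oA; rewrite openE => x [cx Ax].
have dx : dom p (of_coord p x) by exact: chart_inv_dom.
have := of_coord_near dx (open_nbhs_nbhs (conj oA Ax)).
by rewrite /to_coord chart_invK.
Qed.

Definition transition p' p : 'rV[R]_n -> 'rV[R]_n := to_coord p' \o of_coord p.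

Lemma smooth_transition p' p q : dom p q -> dom p' q ->
  smooth_at (transition p' p) (to_coord p q).
Proof.
move=> pq p'q; exists [set x | chart_cod (chart_at p) x /\ dom p' (of_coord p x)].
split; [exact/open_of_coord/dom_open| |exact: chart_compat].
by split; [exact: chart_map_cod|rewrite to_coordK].
Qed.

Lemma transition_to_coord p' p q : dom p q ->
  transition p' p (to_coord p q) = to_coord p' q.
Proof. by move=> pq; rewrite /transition /= to_coordK. Qed.

(* The coordinates at [p'] of the vector at [q] with coordinates [v] at [p]. *)
Definition tchange p' p q : {linear 'rV[R]_n -> 'rV[R]_n} :=
  'd (transition p' p) (to_coord p q).

Lemma coord_changeE p q (v : tangent q) : coord_change p q v = tchange p q q v.
Proof. by []. Qed.

Lemma tchange_comp p'' p' p q v : dom p q -> dom p' q -> dom p'' q ->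
  tchange p'' p' q (tchange p' p q v) = tchange p'' p q v.
Proof.
move=> pq p'q p''q; rewrite /tchange.
have d1 := smooth_at_differentiable (smooth_transition pq p'q).
have d2 := smooth_at_differentiable (smooth_transition p'q p''q).
rewrite -(transition_to_coord p' pq) in d2 *.
apply: etrans (esym (congr1 (@^~ v) (diff_comp d1 d2))) _.
apply: (congr1 (@^~ v) (near_diffE _ _)).
  have := of_coord_near pq (nbhs_dom p'q).
  apply: filterS => x [cx p'x]; rewrite /transition /=.
  by rewrite to_coordK.
exact: smooth_at_differentiable (smooth_transition pq p''q).
Qed.

Lemma tchange_id p q v : dom p q -> tchange p p q v = v.
Proof.
move=> pq; rewrite /tchange.
have d : differentiable (id : 'rV[R]_n -> 'rV[R]_n) (to_coord p q) by [].
have E : \forall x \near to_coord p q, id x = transition p p x.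
  have := of_coord_near pq (nbhs_dom pq).
  by apply: filterS => x [cx _]; rewrite /transition /= /to_coord /of_coord chart_invK.
apply: etrans (congr1 (@^~ v) (near_diffE E d)) _.
by rewrite diff_val.
Qed.

Lemma tchangeK p' p q v : dom p q -> dom p' q ->
  tchange p p' q (tchange p' p q v) = v.
Proof. by move=> pq p'q; rewrite tchange_comp // tchange_id. Qed.

End Charts.

Section Maps.
Variables (R : realType) (m n : nat) (M : manifold R m) (N : manifold R n).
Variables (F : M -> N) (smF : smooth_map F).
Implicit Types (p q : M) (W : section_along F).

Lemma smooth_map_continuous : continuous F.
Proof. by case: smF. Qed.

Definition repr_map p : 'rV[R]_m -> 'rV[R]_n := to_coord (F p) \o F \o of_coord p.

Lemma near_F p q (A : set N) : dom p q -> nbhs (F q) A ->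
  \forall x \near to_coord p q, chart_cod (chart_at p) x /\ A (F (of_coord p x)).
Proof. by move=> pq FA; exact: of_coord_near pq (smooth_map_continuous FA). Qed.

Lemma smooth_repr_map p q : dom p q -> dom (F p) (F q) ->
  smooth_at (repr_map p) (to_coord p q).
Proof.
move=> pq Fpq.
exists [set x | chart_cod (chart_at p) x /\ chart_dom (chart_at (F p)) (F (of_coord p x))].
split; [|by split; [exact: chart_map_cod|rewrite to_coordK]|by case: smF => _; exact].
apply: open_of_coord (_ : open (F @^-1` _)).
by apply: open_comp; [move=> x _; exact: smooth_map_continuous|exact: dom_open].
Qed.

Lemma local_reprE W p q : dom p q -> local_repr W p (to_coord p q) =
  tchange (F p) (F q) (F q) (W q).
Proof. by move=> pq; rewrite /local_repr to_coordK. Qed.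

Lemma near_local_repr_change W p q : dom p q -> dom (F p) (F q) ->
  \forall x \near to_coord p q, local_repr W p x =
  'd (transition (F p) (F q)) (repr_map q (transition q p x))
     (local_repr W q (transition q p x)).
Proof.
move=> pq Fpq.
have h1 := of_coord_near pq (nbhs_dom (mem_dom q)).
have h2 := near_F pq (nbhs_dom Fpq).
have h3 := near_F pq (nbhs_dom (mem_dom (F q))).
apply: filterS2 h1 (filterI h2 h3) => x [cx qx] [[_ Fpx] [_ Fqx]].
rewrite /transition /repr_map /= to_coordK // local_reprE //.
by rewrite -/(tchange (F p) (F q) _ _) tchange_comp //; exact: mem_dom.
Qed.

(** Near [q] the expression of [W] in the chart at [p] is the one in the chart at [q], transported
    by the derivative of a transition map of the target. *)
Lemma smooth_local_repr_change W p q : dom p q -> dom (F p) (F q) ->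
  smooth_at (local_repr W q) (to_coord q q) ->
  smooth_at (local_repr W p) (to_coord p q).
Proof.
move=> pq Fpq hW; have qq := mem_dom q.
have st := smooth_transition pq qq.
have tq := transition_to_coord q pq.
apply: (smooth_at_near (f := fun x => 'd (transition (F p) (F q))
    (repr_map q (transition q p x)) (local_repr W q (transition q p x)))).
  by apply: filterS (near_local_repr_change W pq Fpq) => x /esym; exact.
apply: smooth_at_diff_along.
- rewrite /= tq /repr_map /= to_coordK //.
  by apply: smooth_transition => //; exact: mem_dom.
- apply: smooth_at_comp st _; rewrite tq.
  by apply: smooth_repr_map => //; exact: mem_dom.
- by apply: smooth_at_comp st _; rewrite tq.
Qed.

(** Smoothness has to be checked only at the centre of each preferred chart, where the local
    expression of [W] takes the value [W p] itself. Later smoothness proofs go through this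
    criterion. *)
Lemma smooth_alongP (U : set M) W : open U ->
  smooth_along U W <->
  forall p, U p -> smooth_at (local_repr W p) (to_coord p p).
Proof.
move=> oU.
have oS p : open [set x | [/\ chart_cod (chart_at p) x, U (of_coord p x) &
                           chart_dom (chart_at (F p)) (F (of_coord p x))]].
  rewrite (_ : mkset _ = [set x | chart_cod (chart_at p) x /\
     (U `&` F @^-1` dom (F p)) (of_coord p x)]).
    apply: open_of_coord; apply: openI => //.
    by apply: open_comp; [move=> x _; exact: smooth_map_continuous|exact: dom_open].
  by apply/seteqP; split=> x /=; [case=> ? ? ?|case=> ? [? ?]].
split=> [h p Up|h p].
  have := iffLR (smooth_onP _ (oS p)) (h p); apply; split.
  - exact: chart_map_cod (mem_dom p).
  - by rewrite to_coordK //; exact: mem_dom.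
  - by rewrite to_coordK; exact: mem_dom.
apply/smooth_onP; first exact: oS.
move=> x [cx Ux Fx]; have px : dom p (of_coord p x) by exact: chart_inv_dom.
have -> : x = to_coord p (of_coord p x) by rewrite /to_coord /of_coord chart_invK.
by apply: smooth_local_repr_change => //; exact: h.
Qed.

End Maps.

Section Fields.
Variables (R : realType) (n : nat) (M : manifold R n).
Implicit Types (p q : M) (X Y : vector_field M) (h : M -> R).

Lemma smooth_map_id : smooth_map (id : M -> M).
Proof.
split=> [p|p]; first exact.
apply/smooth_onP; first exact/open_of_coord/dom_open.
move=> x [cx px].
have px' : dom p (of_coord p x) by exact: chart_inv_dom.
have -> : x = to_coord p (of_coord p x) by rewrite /to_coord /of_coord chart_invK.
exact: smooth_transition.
Qed.

Definition field_repr X p : 'rV[R]_n -> 'rV[R]_n := @local_repr R n n M M id X p.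

Lemma smooth_fieldP (U : set M) X : open U ->
  smooth_field U X <->
  forall p, U p -> smooth_at (field_repr X p) (to_coord p p).
Proof. exact: (smooth_alongP smooth_map_id). Qed.

Lemma smooth_funP (U : set M) h : open U ->
  smooth_fun U h <->
  forall p, U p -> smooth_at (h \o of_coord p : 'rV[R]_n -> R^o) (to_coord p p).
Proof.
move=> oU; split=> [hh p Up|hh p].
  have := iffLR (smooth_onP _ (@open_of_coord _ _ _ p _ oU)) (hh p); apply; split.
    exact: chart_map_cod (mem_dom p).
  by rewrite to_coordK //; exact: mem_dom.
apply/smooth_onP; first exact: open_of_coord.
move=> x [cx Ux]; have px : dom p (of_coord p x) by exact: chart_inv_dom.
set q := of_coord p x in Ux px *.
have -> : x = to_coord p q by rewrite /q /to_coord /of_coord chart_invK.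
have qq := mem_dom q; have st := smooth_transition px qq.
apply: (smooth_at_near (f := (h \o of_coord q) \o transition q p : _ -> R^o)).
  have := of_coord_near px (nbhs_dom qq).
  by apply: filterS => y [cy qy] /=; rewrite to_coordK.
apply: (smooth_at_compR st); rewrite transition_to_coord //.
exact: hh.
Qed.

Lemma smooth_fun_at h p q : smooth_fun setT h -> dom p q ->
  smooth_at (h \o of_coord p : 'rV[R]_n -> R^o) (to_coord p q).
Proof.
move=> hh pq; have := iffLR (smooth_onP _ (@open_of_coord _ _ _ p _ openT)) (hh p).
by apply; split=> //; exact: chart_map_cod.
Qed.

(** The field whose coordinates in the chart at [q] are [Y]. Its values are meaningful on [dom q]
    only; elsewhere they are to be killed by a cutoff. *)
Definition field_of q (Y : 'rV[R]_n -> 'rV[R]_n) : vector_field M :=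
  fun q' => tchange q' q q' (Y (to_coord q q')).

Definition coord_field q (u : 'rV[R]_n) : vector_field M := field_of q (fun=> u).

Lemma field_of_repr q (Y : 'rV[R]_n -> 'rV[R]_n) q' : dom q q' ->
  field_repr (field_of q Y) q (to_coord q q') = Y (to_coord q q').
Proof.
move=> qq'; rewrite /field_repr local_reprE //.
by rewrite /field_of tchangeK //; exact: mem_dom.
Qed.

Lemma near_field_of_repr q (Y : 'rV[R]_n -> 'rV[R]_n) q' : dom q q' ->
  \forall x \near to_coord q q', field_repr (field_of q Y) q x = Y x.
Proof.
move=> qq'; have := of_coord_near qq' (nbhs_dom qq').
apply: filterS => x [cx qx].
have -> : x = to_coord q (of_coord q x) by rewrite /to_coord /of_coord chart_invK.
exact: field_of_repr.
Qed.

Lemma field_of_center q (Y : 'rV[R]_n -> 'rV[R]_n) : field_of q Y q = Y (to_coord q q).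
Proof. by rewrite /field_of tchange_id //; exact: mem_dom. Qed.

Lemma smooth_field_of q (Y : 'rV[R]_n -> 'rV[R]_n) q' : dom q q' -> smooth_at Y (to_coord q q') ->
  smooth_at (field_repr (field_of q Y) q') (to_coord q' q').
Proof.
move=> qq' sY; have q'q' := mem_dom q'.
have st := smooth_transition q'q' qq'.
apply: (smooth_at_near (f := fun x => 'd (transition q' q) (transition q q' x)
    (Y (transition q q' x)))).
  have n2 : nbhs q' (dom q `&` dom q') by apply: filterI; exact: nbhs_dom.
  have := of_coord_near q'q' n2.
  apply: filterS => x [cx [qx q'x]].
  have -> : x = to_coord q' (of_coord q' x) by rewrite /to_coord /of_coord chart_invK.
  rewrite /field_repr local_reprE // /field_of transition_to_coord //.
  by apply: esym; apply: tchange_comp => //; exact: mem_dom.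
apply: smooth_at_diff_along.
- by rewrite transition_to_coord //; exact: smooth_transition.
- exact: st.
- by apply: (smooth_at_comp st); rewrite transition_to_coord.
Qed.

Lemma smooth_coord_field q u : smooth_field (dom q) (coord_field q u).
Proof.
apply/smooth_fieldP; first exact: dom_open.
by move=> q' qq'; apply: smooth_field_of => //; exact: smooth_at_cst.
Qed.

Lemma coord_field_center q u : coord_field q u q = u.
Proof. exact: field_of_center. Qed.

Lemma field_deriv_coord_field q u v : field_deriv (coord_field q u) q v = 0.
Proof.
rewrite /field_deriv /local_deriv.
have E := near_field_of_repr (fun=> u) (mem_dom q).
have E' : \forall x \near to_coord q q, u = field_repr (coord_field q u) q x.
  by apply: filterS E => x /esym.
have d : differentiable (fun _ : 'rV[R]_n => u) (to_coord q q) by exact: differentiable_cst.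
apply: etrans (congr1 (@^~ v) (near_diffE E' d)) _.
by rewrite (diff_cst u).
Qed.

Lemma smooth_fun_scale (U : set M) h X : open U -> smooth_fun U h ->
  smooth_field U X -> smooth_field U (fun q => h q *: (X q : 'rV[R]_n)).
Proof.
move=> oU /(smooth_funP _ oU) hh /(smooth_fieldP _ oU) hX; apply/smooth_fieldP => // p Up.
apply: (smooth_at_near (f := fun x => (h \o of_coord p) x *: field_repr X p x)).
  near=> x; rewrite /field_repr /local_repr /= !coord_changeE.
  by rewrite -linearZ.
by apply: smooth_at_scale; [exact: hh|exact: hX].
Unshelve. all: by end_near. Qed.

Lemma smooth_field_add (U : set M) X Y : open U -> smooth_field U X ->
  smooth_field U Y -> smooth_field U (fun q => (X q : 'rV[R]_n) + Y q).
Proof.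
move=> oU /(smooth_fieldP _ oU) hX /(smooth_fieldP _ oU) hY.
apply/smooth_fieldP => // p Up.
apply: (smooth_at_near (f := fun x => field_repr X p x + field_repr Y p x)).
  near=> x; rewrite /field_repr /local_repr !coord_changeE; exact/esym/linearD.
by apply: smooth_atD; [exact: hX|exact: hY].
Unshelve. all: by end_near. Qed.

Lemma smooth_field_sub (U U' : set M) X : open U -> open U' -> U' `<=` U ->
  smooth_field U X -> smooth_field U' X.
Proof.
move=> oU oU' UU /(smooth_fieldP _ oU) hX; apply/smooth_fieldP => // p /UU; exact: hX.
Qed.

End Fields.

(** * Cutoff functions and extension of local fields *)

Section Cutoff.
Variables (R : realType) (n : nat) (M : manifold R n).
Implicit Types (p q : M).

(** The norm of ['rV[R]_n] is a maximum of coordinates, hence not smooth; a bump needs this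
    Euclidean substitute. *)
Definition sqdist (x0 x : 'rV[R]_n) : R^o := \sum_i (x 0 i - x0 0 i) ^+ 2.

Lemma smooth_sqdist x0 x : smooth_at (sqdist x0) x.
Proof.
apply: smooth_at_sum => i; apply: (smooth_at_near (f := fun y : 'rV[R]_n =>
  (y 0 i - x0 0 i) * (y 0 i - x0 0 i) : R^o)).
  by near=> y; rewrite expr2.
have h : smooth_at (fun y : 'rV[R]_n => y 0 i - x0 0 i : R^o) x.
  apply: (smooth_atD (f := fun y : 'rV[R]_n => y 0 i : R^o)); last exact: smooth_at_cst.
  by apply: smooth_at_linear; exact: coord_linear.
exact: smooth_atM.
Unshelve. all: by end_near. Qed.

Lemma sqdist_coord (x0 x : 'rV[R]_n) i : (x 0 i - x0 0 i) ^+ 2 <= sqdist x0 x.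
Proof.
rewrite /sqdist (bigD1 i) //= lerDl; apply: sumr_ge0 => j _; exact: sqr_ge0.
Qed.

Lemma compact_box (x0 : 'rV[R]_n) (r : R) :
  compact [set x : 'rV[R]_n | forall i, `|x 0 i - x0 0 i| <= r].
Proof.
rewrite (_ : mkset _ =
  [set x : 'rV[R]_n | forall i, (fun j => `[x0 0 j - r, x0 0 j + r]%classic) i (x ord0 i)]).
  apply: (@rV_compact R n (fun j => `[x0 0 j - r, x0 0 j + r]%classic)) => i.
  exact: segment_compact.
by apply/seteqP; split=> x h i; have := h i; rewrite /= in_itv /= ler_distl.
Qed.

Lemma cutoff p (U : set M) : open U -> U p -> exists (chi : M -> R) (K : set M),
  [/\ chi p = 1, smooth_fun setT chi, closed K, K `<=` U &
      forall q, ~ K q -> chi q = 0].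
Proof.
move=> oU Up; have pp := mem_dom p; set x0 := to_coord p p.
have [r r0 hr] := nbhs_norm_ex (of_coord_near pp (open_nbhs_nbhs (conj oU Up))).
(* Outside the box [B] some coordinate is off by more than [r / 2], so [sqdist] exceeds [d] and the
   flat function of [d - sqdist] vanishes there. *)
pose d : R := (r / 2) ^+ 2; have r20 : 0 < r / 2 by rewrite divr_gt0.
have d0 : 0 < d by rewrite exprn_gt0.
pose B := [set x : 'rV[R]_n | forall i, `|x 0 i - x0 0 i| <= r / 2].
have Bball x : B x -> `|x0 - x| < r.
  move=> Bx; apply: (@le_lt_trans _ _ (r / 2)).
    by apply: norm_rV_le => [|i]; [exact: ltW|rewrite !mxE distrC].
  by rewrite ltr_pdivrMr // mulr_natr mulr2n ltrDl.
have Bd x : ~ B x -> d < sqdist x0 x.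
  move=> /existsNP[i /negP]; rewrite -ltNge => h.
  apply: lt_le_trans (sqdist_coord x0 x i).
  by rewrite /d -(real_normK (num_real (_ - _))) ltrXn2r // ?nnegrE // ltW.
(* [K] is compact, hence closed as the manifold is Hausdorff. Its complement is then open, which
   makes the extension by zero smooth at points outside the chart. *)
pose K := of_coord p @` B.
have cK : closed K.
  apply: compact_closed; first exact: manifold_hausdorff.
  apply: continuous_compact; last exact: compact_box.
  apply: continuous_in_subspaceT => x /set_mem Bx.
  by apply: (@chart_inv_cont _ _ _ (chart_at p)); exact: (hr x (Bball x Bx)).1.
have KU : K `<=` U by move=> _ [x Bx <-]; exact: (hr x (Bball x Bx)).2.
have Kdom : K `<=` dom p.
  move=> _ [x Bx <-]; apply: (@chart_inv_dom _ _ _ (chart_at p)).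
  exact: (hr x (Bball x Bx)).1.
pose w := @flat_exp R 0 d.
have w0 : w != 0 by rewrite /w /flat_exp d0 expr0 mul1r gt_eqF // expR_gt0.
pose f (x : 'rV[R]_n) : R^o := w^-1 * flat_exp 0 (d - sqdist x0 x).
have sf x : smooth_at f x.
  apply: smooth_atM; first exact: smooth_at_cst.
  apply: (smooth_at_comp1 (h := @flat_exp R 0) (f := fun x => d - sqdist x0 x : R^o));
    last exact: smooth_flat_exp.
  apply: smooth_atD; first exact: smooth_at_cst.
  apply: (smooth_at_near (f := fun y => -1 * sqdist x0 y : R^o)).
    by near=> y; rewrite mulN1r.
  by apply: smooth_atM; [exact: smooth_at_cst|exact: smooth_sqdist].
pose chi q : R := if `[< dom p q >] then f (to_coord p q) else 0.
have chi0 q : ~ K q -> chi q = 0.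
  move=> nK; rewrite /chi; case: asboolP => // pq.
  have nB : ~ B (to_coord p q).
    by move=> Bq; apply: nK; exists (to_coord p q) => //; rewrite to_coordK.
  by rewrite /f /flat_exp subr_gt0 ltNge (ltW (Bd _ nB)) /= mulr0.
exists chi, K; split=> //.
- rewrite /chi; case: asboolP => // _.
  rewrite /f (_ : sqdist _ _ = 0) ?subr0 ?mulVf //.
  by rewrite /sqdist big1 // => i _; rewrite subrr expr0n.
- apply/smooth_funP; first exact: openT.
  move=> q _; have qq := mem_dom q.
  have [Kq|nKq] := pselect (K q).
    have pq := Kdom q Kq; have st := smooth_transition qq pq.
    apply: (smooth_at_near (f := f \o transition p q)); last exact: smooth_at_compR (sf _).
    have := of_coord_near qq (nbhs_dom pq); apply: filterS => x [_ px] /=.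
    by rewrite /chi asboolT.
  apply: (smooth_at_near (f := fun=> (0 : R^o))); last exact: smooth_at_cst.
  have := of_coord_near qq (open_nbhs_nbhs (conj (closed_openC cK) nKq)).
  by apply: filterS => x [_ nKx] /=; rewrite chi0.
Unshelve. all: by end_near. Qed.

(** The extension is a scalar multiple of [X] and vanishes off [U], so it keeps any fibrewise linear
    condition that [X] satisfies on [U]: being vertical, horizontal, or in a subbundle. *)
Lemma extend_field p (U : set M) (X : vector_field M) : open U -> U p ->
  smooth_field U X -> exists chi : M -> R,
  [/\ chi p = 1, forall q, ~ U q -> chi q = 0 &
      smooth_field setT (fun q => chi q *: (X q : 'rV[R]_n))].
Proof.
move=> oU Up sX; have [chi [K [chip schi cK KU chi0]]] := cutoff oU Up.
exists chi; split=> // [q nUq|]; first by apply: chi0 => /KU.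
apply/smooth_fieldP; first exact: openT.
move=> q _; have [Uq|nUq] := pselect (U q).
  apply: (iffLR (smooth_fieldP _ oU) _ q Uq); apply: smooth_fun_scale => //.
  apply/smooth_funP => // q' _.
  exact: (iffLR (smooth_funP _ openT) schi q' I).
apply: (smooth_at_near (f := fun=> (0 : 'rV[R]_n))); last exact: smooth_at_cst.
have nKq : ~ K q by move=> /KU.
have := of_coord_near (mem_dom q) (open_nbhs_nbhs (conj (closed_openC cK) nKq)).
apply: filterS => x [_ nKx]; rewrite /field_repr /local_repr coord_changeE.
by rewrite chi0 // scale0r linear0.
Qed.

End Cutoff.

(** * Directional derivatives *)

Section DirectionalDerivative.
Variables (R : realType) (V : normedModType R).

(** The differential of a non-differentiable map carries no information, so the value is always
    paired with differentiability; the closure rules below then build both at once. *)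
Definition diff_val_at (W : normedModType R) (f : V -> W) (x v : V) (d : W) :=
  differentiable f x /\ 'd f x v = d.

Lemma diff_val_at_near (W : normedModType R) (f g : V -> W) x v d :
  (\forall y \near x, f y = g y) -> diff_val_at f x v d -> diff_val_at g x v d.
Proof.
move=> E [df <-]; split; first exact: near_differentiable E df.
exact: (congr1 (@^~ v) (near_diffE E df)).
Qed.

Lemma diff_val_at_eq (W : normedModType R) (f : V -> W) x v d d' :
  d = d' -> diff_val_at f x v d -> diff_val_at f x v d'.
Proof. by move=> <-. Qed.

Lemma diff_compE (U W : normedModType R) (f : V -> U) (g : U -> W) x y v :
  f x = y -> differentiable f x -> differentiable g y ->
  'd (g \o f) x v = 'd g y ('d f x v).
Proof. by move=> <- df dg; exact: (congr1 (@^~ v) (diff_comp df dg)). Qed.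

Lemma diff_val_at_cst (W : normedModType R) (c : W) (x v : V) :
  diff_val_at (fun=> c) x v 0.
Proof. exact: (conj (differentiable_cst c x) (congr1 (@^~ v) (diff_cst c x))). Qed.

Lemma diff_val_atD (W : normedModType R) (f g : V -> W) x v d e :
  diff_val_at f x v d -> diff_val_at g x v e ->
  diff_val_at (fun y => f y + g y) x v (d + e).
Proof.
by move=> [df <-] [dg <-]; split; [exact: differentiable_add|exact: diff_addE].
Qed.

Lemma diff_val_atM (f g : V -> R^o) x v d e :
  diff_val_at f x v d -> diff_val_at g x v e ->
  diff_val_at (fun y => f y * g y : R^o) x v (f x * e + g x * d).
Proof.
move=> [df <-] [dg <-]; split; first exact: differentiable_mul.
exact: diff_mulE.
Qed.

Lemma diff_val_at_sum (W : normedModType R) (I : Type) (r : seq I) (f : I -> V -> W) x v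
  (d : I -> W) : (forall i, diff_val_at (f i) x v (d i)) ->
  diff_val_at (fun y => \sum_(i <- r) f i y) x v (\sum_(i <- r) d i).
Proof.
move=> h; elim: r => [|i r [IH1 IH2]].
  rewrite big_nil; apply: (diff_val_at_near (f := fun=> 0)).
    by near=> y; rewrite big_nil.
  by split; [exact: differentiable_cst|rewrite (diff_cst (0 : W))].
rewrite big_cons; have [h1 h2] := h i.
apply: (diff_val_at_near (f := fun y => f i y + \sum_(j <- r) f j y)).
  by near=> y; rewrite big_cons.
split; first exact: differentiable_add.
by rewrite (diff_addE v h1 IH1) IH2 h2.
Unshelve. all: by end_near. Qed.

Lemma diff_val_at_coordP n (f : V -> 'rV[R]_n) x v d :
  diff_val_at f x v d <-> forall i, diff_val_at (fun y => f y 0 i : R^o) x v (d 0 i).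
Proof.
split=> [[df <-] i|h].
  by split; [exact: (iffLR (differentiable_coordP f x) df i)|rewrite diff_coord].
have df : differentiable f x by apply/differentiable_coordP => i; have [] := h i.
by split=> //; apply/rowP => i; rewrite -diff_coord //; have [] := h i.
Qed.

Lemma diff_val_at_scale n (f : V -> R^o) (g : V -> 'rV[R]_n) x v d e :
  diff_val_at f x v d -> diff_val_at g x v e ->
  diff_val_at (fun y => f y *: g y) x v (f x *: e + d *: g x).
Proof.
move=> hf /diff_val_at_coordP hg; apply/diff_val_at_coordP => i.
have := diff_val_atM hf (hg i); rewrite !mxE (mulrC (g x 0 i)).
by apply: diff_val_at_near; near=> y; rewrite mxE.
Unshelve. all: by end_near. Qed.

Lemma diff_val_at_comp (U W : normedModType R) (f : V -> U) (g : U -> W) x v d :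
  diff_val_at f x v d -> differentiable g (f x) ->
  diff_val_at (g \o f) x v ('d g (f x) d).
Proof.
move=> [df <-] dg; split; first exact: differentiable_comp.
exact: (congr1 (@^~ v) (diff_comp df dg)).
Qed.

Lemma diff_val_at_compE (U W : normedModType R) (f : V -> U) (g : U -> W) x y v d :
  f x = y -> diff_val_at f x v d -> differentiable g y ->
  diff_val_at (g \o f) x v ('d g y d).
Proof. by move=> <-; exact: diff_val_at_comp. Qed.

End DirectionalDerivative.

Lemma diff_val_at_derive (R : realType) (W : normedModType R) (f : R -> W) (t : R) (w : W) :
  diff_val_at f t 1 w -> f^`()%classic t = w.
Proof. by move=> [df <-]; rewrite derive1E deriveE. Qed.

Lemma linear_comb (R : realType) m n (T : {linear 'rV[R]_m -> 'rV[R]_n})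
    (I : Type) (r : seq I) (c : I -> R) (f : I -> 'rV[R]_m) :
  T (\sum_(i <- r) c i *: f i) = \sum_(i <- r) c i *: T (f i).
Proof. by rewrite linear_sum; apply: eq_bigr => i _; exact: linearZ. Qed.

(** * Metrics and connections *)

Section Metric.
Variables (R : realType) (n : nat) (N : manifold R n) (g : metric N).
Implicit Types (q : N) (u v w : 'rV[R]_n).

Lemma ipDr q u v w : g q u (v + w) = g q u v + g q u w.
Proof. by have := ip_linear g q u 1 v w; rewrite scale1r mul1r. Qed.

Lemma ip0r q u : g q u 0 = 0.
Proof. by apply: (addrI (g q u 0)); rewrite -ipDr !addr0. Qed.

Lemma ipZr q a u v : g q u (a *: v) = a * g q u v.
Proof. by have := ip_linear g q u a v 0; rewrite !addr0 ip0r addr0. Qed.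

Lemma ipC q u v : g q u v = g q v u.
Proof. exact: ip_sym. Qed.

Lemma ipDl q u v w : g q (u + v) w = g q u w + g q v w.
Proof. by rewrite ![g q _ w]ipC ipDr. Qed.

Lemma ip0l q u : g q 0 u = 0.
Proof. by rewrite ipC ip0r. Qed.

Lemma ipZl q a u v : g q (a *: u) v = a * g q u v.
Proof. by rewrite ![g q _ v]ipC ipZr. Qed.

Lemma ipNr q u v : g q u (- v) = - g q u v.
Proof. by rewrite -scaleN1r ipZr mulN1r. Qed.

Lemma ipNl q u v : g q (- u) v = - g q u v.
Proof. by rewrite ![g q _ v]ipC ipNr. Qed.

Lemma ipBr q u v w : g q u (v - w) = g q u v - g q u w.
Proof. by rewrite ipDr ipNr. Qed.

Lemma ipBl q u v w : g q (u - v) w = g q u w - g q v w.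
Proof. by rewrite ipDl ipNl. Qed.

Lemma ip_sumr q u (I : Type) (r : seq I) (f : I -> 'rV[R]_n) :
  g q u (\sum_(i <- r) f i) = \sum_(i <- r) g q u (f i).
Proof. by apply: (big_morph (g q u)); [exact: ipDr|exact: ip0r]. Qed.

Lemma ip_suml q u (I : Type) (r : seq I) (f : I -> 'rV[R]_n) :
  g q (\sum_(i <- r) f i) u = \sum_(i <- r) g q (f i) u.
Proof. by rewrite ipC ip_sumr; apply: eq_bigr => i _; rewrite ipC. Qed.

Lemma ip_ge0 q u : 0 <= g q u u.
Proof. by have [->|/(ip_pos g q)/ltW//] := eqVneq u 0; rewrite ip0r. Qed.

Lemma ip_eq0 q u : g q u u = 0 -> u = 0.
Proof.
by move=> h; apply/eqP; apply/negPn/negP => /(ip_pos g q); rewrite h ltxx.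
Qed.

Lemma ip_coord q u v : g q u v = \sum_i \sum_j u 0 i * v 0 j * g q 'e_i 'e_j.
Proof.
rewrite {1}(row_sum_coord u) ip_suml; apply: eq_bigr => i _.
rewrite ipZl {1}(row_sum_coord v) ip_sumr mulr_sumr; apply: eq_bigr => j _.
by rewrite ipZr mulrA.
Qed.

Lemma cauchy_schwarz q u v : (g q u v) ^+ 2 <= g q u u * g q v v.
Proof.
have [->|v0] := eqVneq v 0; first by rewrite !ip0r expr0n mulr0.
have vv := ip_pos g q v0.
have := ip_ge0 q (g q v v *: u - g q u v *: v).
rewrite !ipBl !ipBr !ipZl !ipZr (ipC q v u) => h.
rewrite -(ler_pM2l vv) -subr_ge0; move: h; congr (_ <= _); ring.
Qed.

(** On basis vectors these are the coefficients g_ij of the metric in the chart at [q], as functions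
    of the coordinates. *)
Definition mcoef q u v (y : 'rV[R]_n) : R^o :=
  g (of_coord q y) (coord_field q u (of_coord q y)) (coord_field q v (of_coord q y)).

Lemma smooth_mcoef q u v : smooth_at (mcoef q u v) (to_coord q q).
Proof.
have := ip_smooth g (@dom_open _ _ N q) (smooth_coord_field q u) (smooth_coord_field q v).
by move=> /(smooth_funP _ (@dom_open _ _ N q))/(_ q (mem_dom q)).
Qed.

Lemma coord_fieldE q u q' : coord_field q u q' = tchange q' q q' u.
Proof. by []. Qed.

Lemma mcoef_coord q u v y :
  mcoef q u v y = \sum_i \sum_j u 0 i * v 0 j * mcoef q 'e_i 'e_j y.
Proof.
rewrite /mcoef !coord_fieldE; set q' := of_coord q y; set T := tchange q' q q'.
have E w : T w = \sum_i w 0 i *: T 'e_i by exact: diff_row_sum.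
rewrite (E u) (E v) ip_suml; apply: eq_bigr => i _.
rewrite ip_sumr; apply: eq_bigr => j _.
by rewrite ipZl ipZr mulrA.
Qed.

Lemma mcoef_center q u v : mcoef q u v (to_coord q q) = g q u v.
Proof.
by rewrite /mcoef to_coordK ?coord_field_center //; exact: mem_dom.
Qed.

End Metric.

Section ConnectionAtCenter.
Variables (R : realType) (n : nat) (N : manifold R n).
Variables (g : metric N) (C : connection N).
Implicit Types (q : N) (u v w : 'rV[R]_n).

Lemma chrisDl q u v w : chris C q (u + v) w = chris C q u w + chris C q v w :> 'rV[R]_n.
Proof. by have := chris_linearl C q w 1 u v; rewrite !scale1r. Qed.

Lemma chrisDr q u v w : chris C q w (u + v) = chris C q w u + chris C q w v :> 'rV[R]_n.
Proof. by have := chris_linearr C q w 1 u v; rewrite !scale1r. Qed.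

Lemma chris0r q u : chris C q u 0 = 0 :> 'rV[R]_n.
Proof. by apply: (addrI (chris C q u 0 : 'rV[R]_n)); rewrite -chrisDr !addr0. Qed.

Lemma chris0l q u : chris C q 0 u = 0 :> 'rV[R]_n.
Proof. by apply: (addrI (chris C q 0 u : 'rV[R]_n)); rewrite -chrisDl !addr0. Qed.

Lemma chrisZr q a u v : chris C q u (a *: v) = a *: (chris C q u v : 'rV[R]_n) :> 'rV[R]_n.
Proof. by have := chris_linearr C q u a v 0; rewrite !addr0 chris0r addr0. Qed.

Lemma chrisZl q a u v : chris C q (a *: u) v = a *: (chris C q u v : 'rV[R]_n) :> 'rV[R]_n.
Proof. by have := chris_linearl C q v a u 0; rewrite !addr0 chris0l addr0. Qed.

Lemma chris_sumr q u (I : Type) (r : seq I) (f : I -> 'rV[R]_n) :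
  chris C q u (\sum_(i <- r) f i) = \sum_(i <- r) (chris C q u (f i) : 'rV[R]_n) :> 'rV[R]_n.
Proof.
elim: r => [|i r IH]; first by rewrite !big_nil; exact: chris0r.
by rewrite !big_cons -IH; exact: chrisDr.
Qed.

Lemma nabla_coord_field q u w :
  nabla C (coord_field q w) (coord_field q u) q = chris C q w u :> 'rV[R]_n.
Proof.
by rewrite /nabla /cov_deriv field_deriv_coord_field !coord_field_center add0r.
Qed.

Hypothesis lc : levi_civita g C.

Lemma chris_sym q u v : chris C q u v = chris C q v u :> 'rV[R]_n.
Proof.
have [+ _] := lc (@dom_open _ _ N q) (smooth_coord_field q u) (smooth_coord_field q v)
  (smooth_coord_field q u) (mem_dom q).
rewrite !nabla_coord_field /lie_bracket !field_deriv_coord_field subrr.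
by move/subr0_eq.
Qed.

Lemma diff_mcoef q u v w : 'd (mcoef g q u v) (to_coord q q) w =
  g q (chris C q w u) v + g q u (chris C q w v).
Proof.
have [_] := lc (@dom_open _ _ N q) (smooth_coord_field q w) (smooth_coord_field q u)
  (smooth_coord_field q v) (mem_dom q).
by rewrite !nabla_coord_field !coord_field_center /fun_deriv.
Qed.

(** Metric compatibility at the centre of a chart, for coordinate expressions [y], [A], [B] over any
    parameter space: the product rule, with [diff_mcoef] for the metric coefficients. It yields the
    compatibility both along maps ([metric_along]) and along curves ([metric_along_curve]). *)
Lemma diff_mcoef_along (V : normedModType R) q (y A B : V -> 'rV[R]_n) (x v : V) dy dA dB :
  y x = to_coord q q -> diff_val_at y x v dy -> diff_val_at A x v dA ->
  diff_val_at B x v dB ->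
  diff_val_at (fun z => mcoef g q (A z) (B z) (y z)) x v
    (g q (dA + chris C q dy (A x)) (B x) + g q (A x) (dB + chris C q dy (B x))).
Proof.
move=> yx hy /diff_val_at_coordP hA /diff_val_at_coordP hB.
have hm i j : diff_val_at (fun z => mcoef g q 'e_i 'e_j (y z)) x v
   (g q (chris C q dy 'e_i) 'e_j + g q 'e_i (chris C q dy 'e_j)).
  rewrite -diff_mcoef -yx; apply: diff_val_at_comp hy _.
  by rewrite yx; apply: smooth_at_differentiable; exact: smooth_mcoef.
have H := diff_val_at_sum (index_enum _) (fun i => diff_val_at_sum (index_enum _)
   (fun j => diff_val_atM (diff_val_atM (hA i) (hB j)) (hm i j))).
have -> : g q (dA + chris C q dy (A x)) (B x) + g q (A x) (dB + chris C q dy (B x)) =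
    \sum_i \sum_j (A x 0 i * B x 0 j *
    (g q (chris C q dy 'e_i) 'e_j + g q 'e_i (chris C q dy 'e_j)) +
    mcoef g q 'e_i 'e_j (y x) * (A x 0 i * dB 0 j + B x 0 j * dA 0 i)).
  have EA w : chris C q dy w = \sum_i w 0 i *: (chris C q dy 'e_i : 'rV[R]_n) :> 'rV[R]_n.
    rewrite {1}(row_sum_coord w) chris_sumr; apply: eq_bigr => i _; exact: chrisZr.
  have gE u w : g q u w = \sum_i \sum_j u 0 i * w 0 j * g q 'e_i 'e_j by exact: ip_coord.
  rewrite ipDl ipDr (gE dA) (gE (A x) dB).
  have -> : g q (chris C q dy (A x)) (B x) =
     \sum_i \sum_j A x 0 i * B x 0 j * g q (chris C q dy 'e_i) 'e_j.
    rewrite EA ip_suml; apply: eq_bigr => i _; rewrite ipZl {1}(row_sum_coord (B x)) ip_sumr.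
    by rewrite mulr_sumr; apply: eq_bigr => j _; rewrite ipZr mulrA.
  have -> : g q (A x) (chris C q dy (B x)) =
     \sum_i \sum_j A x 0 i * B x 0 j * g q 'e_i (chris C q dy 'e_j).
    rewrite EA {1}(row_sum_coord (A x)) ip_suml; apply: eq_bigr => i _; rewrite ipZl ip_sumr.
    by rewrite mulr_sumr; apply: eq_bigr => j _; rewrite ipZr mulrA.
  rewrite -!big_split /=; apply: eq_bigr => i _.
  rewrite -!big_split /=; apply: eq_bigr => j _.
  rewrite yx mcoef_center; ring.
apply: diff_val_at_near H.
near=> z; rewrite [RHS]mcoef_coord; apply: eq_bigr => i _.
by apply: eq_bigr => j _.
Unshelve. all: by end_near. Qed.

End ConnectionAtCenter.

(** * The pullback connection and the second fundamental form *)

Section PullbackConnection.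
Variables (R : realType) (m n : nat) (M : manifold R m) (N : manifold R n).
Variables (g : metric N) (C : connection N) (F : M -> N).
Hypothesis smF : smooth_map F.
Implicit Types (p : M) (W : section_along F) (v : 'rV[R]_m).

Definition diff_along W p :=
  differentiable (local_repr W p) (to_coord p p).

(** [nabla_pullback] depends on its direction only through the value at [p]; here that value is a
    bare vector. *)
Definition nabla_along W p v : 'rV[R]_n :=
  (local_deriv W p v : 'rV[R]_n) + chris C (F p) (tangent_map F p v) (W p).

Lemma repr_map_center p : repr_map F p (to_coord p p) = to_coord (F p) (F p).
Proof. by rewrite /repr_map /= to_coordK //; exact: mem_dom. Qed.

Lemma repr_map_diff p v :
  diff_val_at (repr_map F p) (to_coord p p) v (tangent_map F p v).
Proof.
split=> //; apply: smooth_at_differentiable.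
by apply: smooth_repr_map => //; exact: mem_dom.
Qed.

Lemma local_repr_center W p : local_repr W p (to_coord p p) = W p.
Proof. by rewrite local_reprE ?tchange_id //; exact: mem_dom. Qed.

Lemma near_coord_field_local_repr W p : \forall x \near to_coord p p,
  repr_map F p x = to_coord (F p) (F (of_coord p x)) /\
  of_coord (F p) (repr_map F p x) = F (of_coord p x) /\
  coord_field (F p) (local_repr W p x) (F (of_coord p x)) = W (of_coord p x).
Proof.
have := near_F smF (mem_dom p) (nbhs_dom (mem_dom (F p))).
apply: filterS => x [_ Fx]; split; first by [].
split; first by rewrite /repr_map /= to_coordK.
rewrite coord_fieldE /local_repr coord_changeE tchangeK //; exact: mem_dom.
Qed.

Lemma metric_along W1 W2 p v : levi_civita g C -> diff_along W1 p -> diff_along W2 p ->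
  diff_val_at (fun x => g (F (of_coord p x)) (W1 (of_coord p x)) (W2 (of_coord p x)) : R^o)
    (to_coord p p) v
  (g (F p) (nabla_along W1 p v) (W2 p) + g (F p) (W1 p) (nabla_along W2 p v)).
Proof.
move=> lc d1 d2.
have h1 : diff_val_at (local_repr W1 p) (to_coord p p) v (local_deriv W1 p v) by split.
have h2 : diff_val_at (local_repr W2 p) (to_coord p p) v (local_deriv W2 p v) by split.
have := diff_mcoef_along lc (repr_map_center p) (repr_map_diff p v) h1 h2.
rewrite !local_repr_center; apply: diff_val_at_near.
have E1 := near_coord_field_local_repr W1 p.
have E2 := near_coord_field_local_repr W2 p.
by apply: filterS2 E1 E2 => x [_ [H1 H2]] [_ [_ H3]]; rewrite /mcoef H1 H2 H3.
Qed.

End PullbackConnection.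

Section SecondDerivative.
Variables (R : realType) (m n : nat).

Lemma diff2_coord (f : 'rV[R]_m -> 'rV[R]_n) (x u v : 'rV[R]_m) : smooth_at f x ->
  'd (fun y => 'd f y u) x v = \sum_i u 0 i *: 'd (fun y => 'd f y 'e_i) x v.
Proof.
move=> sf; have h i : diff_val_at (fun y => u 0 i *: 'd f y 'e_i) x v
    (u 0 i *: 'd (fun y => 'd f y 'e_i) x v).
  have hc : diff_val_at (fun=> u 0 i : R^o) x v 0.
    by split; [exact: differentiable_cst|rewrite (diff_cst (u 0 i : R^o))].
  have hd : diff_val_at (fun y => 'd f y 'e_i) x v ('d (fun y => 'd f y 'e_i) x v).
    by split=> //; apply: smooth_at_differentiable; exact: smooth_at_diff.
  by have := diff_val_at_scale hc hd; rewrite scale0r addr0.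
have [] : diff_val_at (fun y => 'd f y u) x v (\sum_i u 0 i *: 'd (fun y => 'd f y 'e_i) x v); last by [].
apply: diff_val_at_near (diff_val_at_sum (index_enum _) h).
by near=> y; rewrite [RHS]diff_row_sum.
Unshelve. all: by end_near. Qed.

Lemma diff_val_at_diff_along (V : normedModType R)
    (f : 'rV[R]_m -> 'rV[R]_n) (g h : V -> 'rV[R]_m) (x v : V) y0 dg dh :
  g x = y0 -> smooth_at f y0 -> diff_val_at g x v dg -> diff_val_at h x v dh ->
  diff_val_at (fun z => 'd f (g z) (h z)) x v
    ('d (fun y => 'd f y (h x)) y0 dg + 'd f y0 dh).
Proof.
move=> <- sf hg /diff_val_at_coordP hh.
have hd i : diff_val_at ((fun y => 'd f y 'e_i) \o g) x v ('d (fun y => 'd f y 'e_i) (g x) dg).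
  apply: (diff_val_at_compE (erefl (g x)) hg).
  by apply: smooth_at_differentiable; exact: smooth_at_diff.
have H := diff_val_at_sum (index_enum _) (fun i => diff_val_at_scale (hh i) (hd i)).
apply: (diff_val_at_eq _ (diff_val_at_near _ H)).
  apply: etrans (big_split _ _ _ _ _) _; congr (_ + _).
    exact: esym (diff2_coord (h x) dg sf).
  exact: esym (diff_row_sum f (g x) dh).
by near=> y; rewrite [RHS]diff_row_sum.
Unshelve. all: by end_near. Qed.

End SecondDerivative.

Section SecondFundamentalForm.
Variables (R : realType) (m n : nat) (M : manifold R m) (N : manifold R n).
Variables (F : M -> N).
Hypothesis smF : smooth_map F.
Implicit Types (p q : M) (X Y : vector_field M) (u v : 'rV[R]_m).

Definition push X : section_along F := fun p => tangent_map F p (X p).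

(** The chain rule for the two ways around the square formed by [F] and the transition maps. It
    expresses the tangent map at a nearby [q] through the single chart expression of [F] at [p]. *)
Lemma tangent_map_change p q v : dom p q -> dom (F p) (F q) ->
  tchange (F p) (F q) (F q) (tangent_map F q v) =
  'd (repr_map F p) (to_coord p q) (tchange p q q v).
Proof.
move=> pq Fpq; have qq := mem_dom q; have FqFq := mem_dom (F q).
have d1 := (repr_map_diff smF q v).1.
have d2 := smooth_at_differentiable (smooth_transition FqFq Fpq).
have d3 := smooth_at_differentiable (smooth_transition qq pq).
have d4 := smooth_at_differentiable (smooth_repr_map smF pq Fpq).
have E : \forall x \near to_coord q q,
    (transition (F p) (F q) \o repr_map F q) x = (repr_map F p \o transition p q) x.
  have h1 := near_F smF qq (nbhs_dom FqFq).
  have h2 := of_coord_near qq (nbhs_dom pq).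
  apply: filterS2 h1 h2 => x [_ Fx] [_ px].
  by rewrite /transition /repr_map /= !to_coordK.
have d5 : differentiable (transition (F p) (F q) \o repr_map F q) (to_coord q q).
  by apply: differentiable_comp; [exact: d1|rewrite repr_map_center; exact: d2].
apply: etrans (esym (diff_compE v (repr_map_center F q) d1 d2)) _.
apply: etrans (esym (congr1 (@^~ v) (near_diffE E d5))) _.
exact: diff_compE v (transition_to_coord p qq) d3 d4.
Qed.

Lemma near_local_repr_push X p : \forall x \near to_coord p p,
  local_repr (push X) p x = 'd (repr_map F p) x (field_repr X p x).
Proof.
have h1 := near_F smF (mem_dom p) (nbhs_dom (mem_dom (F p))).
have h2 := of_coord_near (mem_dom p) (nbhs_dom (mem_dom p)).
apply: filterS2 h1 h2 => x [cx Fx] [_ px].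
set q := of_coord p x in Fx px *.
have <- : to_coord p q = x by rewrite /q /to_coord /of_coord chart_invK.
apply: etrans (local_reprE _ px) _; apply: etrans (tangent_map_change _ px Fx) _.
exact: esym (congr1 ('d (repr_map F p) (to_coord p q)) (local_reprE _ px)).
Qed.

Lemma field_repr_center X p : field_repr X p (to_coord p p) = X p.
Proof. exact: local_repr_center. Qed.

Lemma smooth_push X p : smooth_at (field_repr X p) (to_coord p p) ->
  smooth_at (local_repr (push X) p) (to_coord p p).
Proof.
move=> sX; have E := near_local_repr_push X p.
apply: (smooth_at_near (f := fun x => 'd (repr_map F p) x (field_repr X p x))).
  by apply: filterS E => x /esym.
apply: smooth_at_diff_along => //; last exact: smooth_at_linear.
by apply: smooth_repr_map => //; exact: mem_dom.
Qed.

Definition hessian p u v : 'rV[R]_n :=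
  'd (fun x => 'd (repr_map F p) x v) (to_coord p p) u.

Lemma hessian_sym p u v : hessian p u v = hessian p v u.
Proof.
apply: schwarz_rV; apply: smooth_repr_map => //; exact: mem_dom.
Qed.

Lemma local_deriv_push X p v : differentiable (field_repr X p) (to_coord p p) ->
  diff_val_at (local_repr (push X) p) (to_coord p p) v
    (hessian p v (X p) + tangent_map F p (field_deriv X p v)).
Proof.
move=> dX; have hX : diff_val_at (field_repr X p) (to_coord p p) v (field_deriv X p v) by split.
have sF : smooth_at (repr_map F p) (to_coord p p).
  by apply: smooth_repr_map => //; exact: mem_dom.
have hid : diff_val_at (id : 'rV[R]_m -> 'rV[R]_m) (to_coord p p) v v.
  have [d e] := linear_fun_diff (to_coord p p) (fun a (u w : 'rV[R]_m) => erefl (a *: u + w)).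
  by split=> //; exact: (congr1 (@^~ v) e).
have := diff_val_at_diff_along (erefl (to_coord p p)) sF hid hX; rewrite field_repr_center.
apply: diff_val_at_near; apply: filterS (near_local_repr_push X p) => x /esym.
exact.
Qed.

Variables (gM : metric M) (gN : metric N) (CM : connection M) (CN : connection N).
Hypotheses (lcM : levi_civita gM CM) (lcN : levi_civita gN CN).

(** The second fundamental form as a bilinear form on vectors: in [second_fundamental_form] the
    first derivatives of the field [Y] cancel ([sffE]). It is symmetric because the Hessian is and
    both connections are torsion free. *)
Definition sff p u v : 'rV[R]_n :=
  hessian p u v + chris CN (F p) (tangent_map F p u) (tangent_map F p v)
  - tangent_map F p (chris CM p u v).

Lemma sff_sym p u v : sff p u v = sff p v u.
Proof.
rewrite /sff hessian_sym (chris_sym lcM) (chris_sym lcN).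
by [].
Qed.

Lemma sffE X Y p : differentiable (field_repr Y p) (to_coord p p) ->
  second_fundamental_form F CM CN X Y p = sff p (X p) (Y p) :> 'rV[R]_n.
Proof.
move=> dY; have [_ E] := local_deriv_push (X p) dY.
have L : tangent_map F p (nabla CM X Y p) = tangent_map F p (field_deriv Y p (X p)) +
  tangent_map F p (chris CM p (X p) (Y p)) by exact: linearD.
have cancel (V : zmodType) (a b c d : V) : a + b + c - (b + d) = a + c - d.
  by rewrite opprD addrA (addrAC a) addrK.
apply: etrans (cancel _ _ _ _ _).
exact: (congr2 (fun a b : 'rV[R]_n =>
  a + chris CN (F p) (tangent_map F p (X p)) (tangent_map F p (Y p)) - b) E L).
Qed.

Lemma nabla_along_push X Y p : differentiable (field_repr Y p) (to_coord p p) ->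
  nabla_along CN (push Y) p (X p) =
  sff p (X p) (Y p) + tangent_map F p (nabla CM X Y p).
Proof. by move=> dY; rewrite -(sffE X dY) /second_fundamental_form subrK. Qed.

End SecondFundamentalForm.

(** * Maps of constant rank *)

Section ConstantRank.
Variables (R : realType) (V : normedModType R) (m n : nat).
Variables (A : V -> 'M[R]_(m, n)) (x0 : V).
Hypothesis smA : forall i j, smooth_at (fun x => A x i j : R^o) x0.
Hypothesis rkA : \forall x \near x0, \rank (A x) = \rank (A x0).

(* Near [x0] the inverse of [T x] carries the row kernel of [A x0] to that of
   [A x], because constancy of the rank makes [Q *m A x0] injective on the row
   space of [A x]. *)
Let Q := pinvmx (A x0).
Let T x := A x *m Q + (1%:M - A x0 *m Q).

Let A0QA0 : A x0 *m Q *m A x0 = A x0.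
Proof. exact: mulmxKpV. Qed.

Let T0 : T x0 = 1%:M.
Proof. by rewrite /T addrC subrK. Qed.

Let TA0 x : T x *m A x0 = A x *m (Q *m A x0).
Proof. by rewrite /T mulmxDl mulmxBl mul1mx A0QA0 subrr addr0 -mulmxA. Qed.

Let smT i j : smooth_at (fun x => T x i j : R^o) x0.
Proof.
apply: (smooth_at_near (f := fun x => (A x *m Q) i j + (1%:M - A x0 *m Q) i j : R^o)).
  by near=> x; rewrite [in RHS]mxE.
apply: smooth_atD; last exact: smooth_at_cst.
by apply: smooth_at_mulmx => // k l; exact: smooth_at_cst.
Unshelve. all: by end_near. Qed.

Let invT : (\forall x \near x0, T x \in unitmx) /\
  forall i j, smooth_at (fun x => invmx (T x) i j : R^o) x0.
Proof. by apply: smooth_at_invmx => //; rewrite T0 unitmx1. Qed.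

(** Since [T x] is invertible, [A x *m (Q *m A x0) = T x *m A x0] has the rank of [A x0], which is
    that of [A x]; rank-nullity leaves no kernel in the row space of [A x]. *)
Let inj x (c : 'rV[R]_n) : \rank (A x) = \rank (A x0) -> T x \in unitmx ->
  (c <= A x)%MS -> c *m (Q *m A x0) = 0 -> c = 0.
Proof.
move=> rk Tu cA c0; have := mxrank_mul_ker (A x) (Q *m A x0).
have Tf : row_full (T x) by rewrite row_full_unit.
rewrite -{1}TA0 (eqmxMfull _ Tf) rk -[RHS]addn0 => /addnI/eqP.
rewrite mxrank_eq0 => /eqP cap0.
apply/eqP; rewrite -submx0 -cap0 sub_capmx cA; exact/sub_kermxP.
Qed.

Lemma smooth_kernel (w0 : 'rV[R]_m) : w0 *m A x0 = 0 ->
  exists w : V -> 'rV[R]_m, [/\ smooth_at w x0, w x0 = w0 &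
    \forall x \near x0, w x *m A x = 0].
Proof.
move=> w0A; have [nT smI] := invT.
exists (fun x => w0 *m invmx (T x)); split.
- apply/smooth_at_coordP => i.
  by apply: (smooth_at_mulmx (A := fun=> w0)) => // k l; exact: smooth_at_cst.
- by rewrite T0 invmx1 mulmx1.
apply: filterS2 rkA nT => x rk Tu; apply: (inj rk Tu); first exact: submxMl.
by rewrite -mulmxA -TA0 mulmxA mulmxKV.
Qed.

Lemma smooth_solve (b : V -> 'rV[R]_n) : smooth_at b x0 ->
  (\forall x \near x0, (b x <= A x)%MS) ->
  exists y : V -> 'rV[R]_m, smooth_at y x0 /\ \forall x \near x0, y x *m A x = b x.
Proof.
move=> smb bA; have [nT smI] := invT.
(* [T x *m A x0 = A x *m (Q *m A x0)] shows that [y x *m A x] and [b x] agree after multiplication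
   by [Q *m A x0]; both lie in the row space of [A x], so [inj] equates them. *)
exists (fun x => b x *m Q *m invmx (T x)); split.
  apply/smooth_at_coordP => i; apply: smooth_at_mulmx => // k l.
  apply: smooth_at_mulmx => [k' l'|k' l']; last exact: smooth_at_cst.
  by rewrite ord1; exact: (iffLR (smooth_at_coordP b x0) smb).
apply: filterS3 rkA nT bA => x rk Tu bx.
apply/eqP; rewrite -subr_eq0; apply/eqP; apply: (inj rk Tu).
  by rewrite addmx_sub ?submxMl // eqmx_opp.
by rewrite mulmxBl -[X in X - _]mulmxA -TA0 mulmxA mulmxKV // -mulmxA subrr.
Qed.

End ConstantRank.

Section PosdefMatrix.
Variables (R : realType) (m n : nat) (G : 'M[R]_m).
Hypothesis symG : G^T = G.
Hypothesis posG : forall u : 'rV[R]_m, u *m G *m u^T = 0 -> u = 0.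

Lemma posdef_unitmx : G \in unitmx.
Proof.
rewrite -row_free_unit -kermx_eq0; apply/eqP/row_matrixP => i.
rewrite row0; apply: posG.
by rewrite -row_mul mulmx_ker row0 mul0mx.
Qed.

Lemma posdef_inv (u : 'rV[R]_m) : u *m invmx G *m u^T = 0 -> u = 0.
Proof.
have Gu := posdef_unitmx; move=> h.
suff : u *m invmx G = 0 by move/(congr1 (mulmx^~ G)); rewrite mulmxKV // mul0mx.
by apply: posG; rewrite mulmxKV // trmx_mul trmx_inv symG mulmxA.
Qed.

(** If [u] kills the Gram matrix on the left, then [u *m A^T] has zero length for the inverse of
    [G], so it vanishes. The Gram matrix thus has the rank of [A], and its row space lies in that of
    [A]. *)
Lemma gram_eqmx (A : 'M[R]_(m, n)) : (A^T *m invmx G *m A :=: A)%MS.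
Proof.
set S := A^T *m _ *m A.
apply/eqmxP; rewrite submxMl /=.
rewrite -(geq_leqif (mxrank_leqif_sup (submxMl (A^T *m invmx G) A))).
rewrite -[X in (X <= _)%N]mxrank_tr.
have kS : (kermx S <= kermx A^T)%MS.
  apply/rV_subP => u /sub_kermxP uS; apply/sub_kermxP; apply: posdef_inv.
  by rewrite trmx_mul trmxK !mulmxA -(mulmxA u) -(mulmxA u) -/S uS mul0mx.
have := mxrankS kS; rewrite !mxrank_ker.
have := rank_leq_row S; have := rank_leq_row A^T.
by move=> h1 h2; rewrite leq_sub2lE.
Qed.

End PosdefMatrix.

(** * Derivatives of fields along a map *)

Section FieldsAlongMaps.
Variables (R : realType) (m n : nat) (M : manifold R m) (N : manifold R n).
Variables (F : M -> N) (C : connection N).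
Hypothesis smF : smooth_map F.

Definition nabla_at (Y : vector_field N) (q : N) (v : 'rV[R]_n) : 'rV[R]_n :=
  (field_deriv Y q v : 'rV[R]_n) + chris C q v (Y q).

Lemma nabla_along_comp (Y : vector_field N) p v :
  differentiable (field_repr Y (F p)) (to_coord (F p) (F p)) ->
  diff_along (fun p => Y (F p) : tangent (F p)) p /\
  nabla_along C (fun p => Y (F p) : tangent (F p)) p v =
    nabla_at Y (F p) (tangent_map F p v).
Proof.
move=> dY; set W := fun p => Y (F p) : tangent (F p).
have E : \forall x \near to_coord p p,
    (field_repr Y (F p) \o repr_map F p) x = local_repr W p x.
  have := near_F smF (mem_dom p) (nbhs_dom (mem_dom (F p))).
  by apply: filterS => x [_ Fx]; exact: local_reprE.
have [dW eW] := diff_val_at_near E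
  (diff_val_at_compE (repr_map_center F p) (repr_map_diff smF p v) dY).
split; first exact: dW.
by rewrite /nabla_along /nabla_at; congr (_ + _); exact: eW.
Qed.

Variables (g : metric N) (P : forall q : N, tangent q -> tangent q).
Arguments P : clear implicits.
Hypothesis kah : kahler g C P.
Implicit Types (q : N).

Lemma kahlerD q (u v : 'rV[R]_n) : P q (u + v) = (P q u : 'rV[R]_n) + P q v :> 'rV[R]_n.
Proof. by case: kah => lP _ _ _ _; have := lP q 1 u v; rewrite !scale1r. Qed.

Lemma kahler0 q : P q (0 : 'rV[R]_n) = 0 :> 'rV[R]_n.
Proof. by apply: (addrI (P q (0 : 'rV[R]_n) : 'rV[R]_n)); rewrite -kahlerD !addr0. Qed.

Lemma kahlerZ q a (u : 'rV[R]_n) : P q (a *: u) = a *: (P q u : 'rV[R]_n) :> 'rV[R]_n.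
Proof. by case: kah => lP _ _ _ _; have := lP q a u 0; rewrite kahler0 !addr0. Qed.

Lemma kahler_sum q (I : Type) (r : seq I) (f : I -> 'rV[R]_n) :
  P q (\sum_(i <- r) f i) = \sum_(i <- r) (P q (f i) : 'rV[R]_n) :> 'rV[R]_n.
Proof.
elim: r => [|i r IH]; first by rewrite !big_nil; exact: kahler0.
by rewrite !big_cons -IH; exact: kahlerD.
Qed.

Let Pcoord q u : 'rV[R]_n -> 'rV[R]_n :=
  field_repr (fun q' => P q' (coord_field q u q')) q.

Lemma diff_Pcoord q u v :
  diff_val_at (Pcoord q u) (to_coord q q) v
    ((P q (chris C q v u) : 'rV[R]_n) - chris C q v (P q u)).
Proof.
case: kah => _ sP _ _ nP.
have sPu := sP (dom q) (coord_field q u) (@dom_open _ _ N q) (smooth_coord_field q u).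
have := iffLR (smooth_fieldP _ (@dom_open _ _ N q)) sPu q (mem_dom q) => sc.
split; first exact: smooth_at_differentiable.
have := nP (dom q) (coord_field q v) (coord_field q u) (@dom_open _ _ N q)
  (smooth_coord_field q v) (smooth_coord_field q u) q (mem_dom q).
rewrite nabla_coord_field /nabla /cov_deriv !coord_field_center => <-.
by rewrite addrK.
Qed.

(** Parallelism of [P] is given for fields on [N], while a section along [F] need not come from such
    a field. [W] is therefore expanded in coordinate fields of the chart at [F p], with coefficients
    that are functions on [M]; Leibniz reduces the claim to [diff_Pcoord]. *)
Lemma kahler_along (W : section_along F) p v : diff_along W p ->
  diff_along (fun p => P (F p) (W p)) p /\
  nabla_along C (fun p => P (F p) (W p)) p v = P (F p) (nabla_along C W p v).
Proof.
move=> dW; set q := F p; set x0 := to_coord p p.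
set PW := fun p => P (F p) (W p).
have hW : diff_val_at (local_repr W p) x0 v (local_deriv W p v) by split.
have hF := repr_map_diff smF p v.
have hP i : diff_val_at (Pcoord q 'e_i \o repr_map F p) x0 v
    ((P q (chris C q (tangent_map F p v) 'e_i) : 'rV[R]_n) -
      chris C q (tangent_map F p v) (P q 'e_i)).
  have [d e] := diff_Pcoord q 'e_i (tangent_map F p v).
  by rewrite -e; exact: (diff_val_at_compE (repr_map_center F p) hF d).
have H := diff_val_at_sum (index_enum _) (fun i =>
  diff_val_at_scale (iffLR (diff_val_at_coordP _ _ _ _) hW i) (hP i)).
have Pc i : (Pcoord q 'e_i \o repr_map F p) x0 = P q 'e_i.
  rewrite /= repr_map_center; apply: etrans (field_repr_center _ _) _.
  by rewrite coord_field_center.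
have E : \forall x \near x0, \sum_i local_repr W p x 0 i *: (Pcoord q 'e_i \o repr_map F p) x =
    local_repr PW p x.
  have h1 := near_coord_field_local_repr smF W p.
  have h2 := near_F smF (mem_dom p) (nbhs_dom (mem_dom (F p))).
  apply: filterS2 h1 h2 => x [E1 [E2 E3]] [_ Fx].
  set q' := F (of_coord p x) in E1 E2 E3 Fx; set w := local_repr W p x in E3 *.
  transitivity (tchange q q' q' (PW (of_coord p x))); last by [].
  have -> : PW (of_coord p x) = \sum_i w 0 i *: (P q' (tchange q' q q' 'e_i) : 'rV[R]_n) :> 'rV[R]_n.
    have Tw : tchange q' q q' w = \sum_i w 0 i *: tchange q' q q' 'e_i by exact: diff_row_sum.
    rewrite /PW -E3 coord_fieldE; apply: etrans (congr1 _ Tw) _.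
    by rewrite kahler_sum; apply: eq_bigr => i _; exact: kahlerZ.
  have Pi i : (Pcoord q 'e_i \o repr_map F p) x =
      tchange q q' q' (P q' (tchange q' q q' 'e_i)).
    by rewrite /= E1; exact: (@local_reprE R n n N N id _ _ _ Fx).
  apply: esym; apply: etrans (linear_comb (tchange q q' q') _ _ _) _.
  by apply: eq_bigr => i _; rewrite (Pi i).
have [dPW ePW] := diff_val_at_near E H; split; first exact: dPW.
apply: etrans (congr1 (fun d : 'rV[R]_n => d + chris C q (tangent_map F p v) (PW p)) ePW) _.
have -> : nabla_along C W p v =
  (local_deriv W p v : 'rV[R]_n) + chris C q (tangent_map F p v) (W p) by [].
rewrite kahlerD (local_repr_center W p).
move: (local_deriv W p v : 'rV[R]_n) (tangent_map F p v : 'rV[R]_n) Pc => L t Pc.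
have Wp : W p = \sum_i W p 0 i *: 'e_i :> 'rV[R]_n by exact: row_sum_coord.
have -> : PW p = \sum_i W p 0 i *: (P q 'e_i : 'rV[R]_n) :> 'rV[R]_n.
  by rewrite /PW {1}Wp kahler_sum; apply: eq_bigr => i _; exact: kahlerZ.
have -> : P q L = \sum_i L 0 i *: (P q 'e_i : 'rV[R]_n) :> 'rV[R]_n.
  by rewrite {1}(row_sum_coord L) kahler_sum; apply: eq_bigr => i _; exact: kahlerZ.
have -> : P q (chris C q t (W p)) =
   \sum_i W p 0 i *: (P q (chris C q t 'e_i) : 'rV[R]_n) :> 'rV[R]_n.
  rewrite {1}Wp chris_sumr kahler_sum; apply: eq_bigr => i _.
  by rewrite chrisZr; exact: kahlerZ.
rewrite chris_sumr -!big_split; apply: eq_bigr => i _.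
rewrite chrisZr Pc scalerBr.
have cancel (U : zmodType) (a b c : U) : a - b + c + b = c + a.
  by rewrite addrAC subrK addrC.
exact: cancel.
Qed.

End FieldsAlongMaps.

(** The condition on [y x *m G x] says that [y x] is [G]-orthogonal to the kernel of [A x]. Seeking
    [y] as [z *m (A^T *m invmx G)] turns the system into one for the Gram matrix, which has constant
    rank by [gram_eqmx]. *)
Lemma smooth_horizontal_solve (R : realType) (V : normedModType R) m n
    (A : V -> 'M[R]_(m, n)) (G : V -> 'M[R]_m) (b : V -> 'rV[R]_n) (x0 : V) :
  (forall i j, smooth_at (fun x => A x i j : R^o) x0) ->
  (forall i j, smooth_at (fun x => G x i j : R^o) x0) ->
  (\forall x \near x0, (G x)^T = G x /\
     forall u : 'rV[R]_m, u *m G x *m u^T = 0 -> u = 0) ->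
  (\forall x \near x0, \rank (A x) = \rank (A x0)) ->
  smooth_at b x0 -> (\forall x \near x0, (b x <= A x)%MS) ->
  exists y : V -> 'rV[R]_m, smooth_at y x0 /\
    \forall x \near x0, y x *m A x = b x /\ exists z, y x *m G x = z *m (A x)^T.
Proof.
move=> smA smG nG rkA smb bA; have [_ posG0] := nbhs_singleton nG.
have [_ smI] := smooth_at_invmx (posdef_unitmx posG0) smG.
pose S x := (A x)^T *m invmx (G x) *m A x.
have smAT i j : smooth_at (fun x => (A x)^T i j : R^o) x0.
  by apply: smooth_at_near (smA j i); near=> x; rewrite [RHS]mxE.
have smATI := smooth_at_mulmx smAT smI.
have smS : forall i j, smooth_at (fun x => S x i j : R^o) x0 by exact: smooth_at_mulmx.
have eqS : \forall x \near x0, (S x :=: A x)%MS.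
  by apply: filterS nG => x [sG pG]; exact: gram_eqmx.
have eqS0 := nbhs_singleton eqS.
have rkS : \forall x \near x0, \rank (S x) = \rank (S x0).
  apply: filterS2 eqS rkA => x ES rk.
  by rewrite ES rk eqS0.
have bS : \forall x \near x0, (b x <= S x)%MS.
  by apply: filterS2 eqS bA => x ES; rewrite ES.
have [z [sz nz]] := smooth_solve smS rkS smb bS.
exists (fun x => z x *m ((A x)^T *m invmx (G x))); split.
  apply/smooth_at_coordP => i; apply: smooth_at_mulmx => // k l.
  by rewrite ord1; exact: (iffLR (smooth_at_coordP _ _) sz l).
apply: filterS2 nG nz => x [sG pG] zS; split; first by rewrite -mulmxA.
by exists (z x); rewrite -mulmxA mulmxKV //; exact: posdef_unitmx.
Unshelve. all: by end_near. Qed.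

Lemma nbhsI (T : topologicalType) (x : T) (A B : set T) :
  nbhs x A -> nbhs x B -> nbhs x (A `&` B).
Proof. exact: filterI. Qed.

Lemma rank_equiv (R : fieldType) m n (T : 'M[R]_m) (S : 'M[R]_n) (A B : 'M[R]_(m, n)) :
  T \in unitmx -> S \in unitmx -> T *m A = B *m S -> \rank A = \rank B.
Proof.
rewrite -row_full_unit -row_free_unit => Tf Sf E.
by rewrite -(eqmxMfull _ Tf) E mxrankMfree.
Qed.

Section TangentMapLinear.
Variables (R : realType) (m n : nat) (M : manifold R m) (N : manifold R n).
Variables (F : M -> N).
Implicit Types (p : M) (u v : 'rV[R]_m).

Lemma tangent_mapD p u v : tangent_map F p (u + v) = tangent_map F p u + tangent_map F p v.
Proof. exact: linearD. Qed.

Lemma tangent_mapB p u v : tangent_map F p (u - v) = tangent_map F p u - tangent_map F p v.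
Proof. exact: linearB. Qed.

Lemma tangent_mapZ p a v : tangent_map F p (a *: v) = a *: tangent_map F p v.
Proof. exact: linearZ. Qed.

Lemma tangent_map0 p : tangent_map F p 0 = 0.
Proof. exact: linear0. Qed.

End TangentMapLinear.

(** * Vertical fields and horizontal lifts for a map of constant rank *)

Section Lifts.
Variables (R : realType) (m n r : nat) (M : manifold R m) (N : manifold R n).
Variables (F : M -> N) (gM : metric M).
Hypothesis smF : smooth_map F.
Hypothesis rkF : has_rank F r.
Implicit Types (p q : M) (u v : 'rV[R]_m).

Definition jac p (x : 'rV[R]_m) : 'M[R]_(m, n) := lin1_mx ('d (repr_map F p) x).

Lemma mul_jac p x u : u *m jac p x = 'd (repr_map F p) x u.
Proof. exact: mul_rV_lin1. Qed.

Lemma smooth_jac p i j : smooth_at (fun x => jac p x i j : R^o) (to_coord p p).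
Proof.
have sF : smooth_at (repr_map F p) (to_coord p p).
  by apply: smooth_repr_map => //; exact: mem_dom.
apply: smooth_at_near (iffLR (smooth_at_coordP _ _) (smooth_at_diff 'e_i sF) j).
by near=> x; rewrite [RHS]mxE.
Unshelve. all: by end_near. Qed.

Lemma tchange_unitmx (k : nat) (K : manifold R k) (a b q : K) : dom a q -> dom b q ->
  lin1_mx (tchange a b q) \in unitmx.
Proof.
move=> aq bq.
have h : lin1_mx (tchange a b q) *m lin1_mx (tchange b a q) = 1%:M.
  apply/row_matrixP => i; rewrite !rowE mulmxA !mul_rV_lin1 mulmx1.
  exact: tchangeK.
exact: (mulmx1_unit h).1.
Qed.

Lemma rank_jac p q : dom p q -> dom (F p) (F q) -> \rank (jac p (to_coord p q)) = r.
Proof.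
move=> pq Fpq; rewrite -(rkF q).
have Tu : lin1_mx (tchange p q q) \in unitmx by apply: tchange_unitmx => //; exact: mem_dom.
have Su : lin1_mx (tchange (F p) (F q) (F q)) \in unitmx.
  by apply: tchange_unitmx => //; exact: mem_dom.
have E : lin1_mx (tchange p q q) *m jac p (to_coord p q) =
    lin1_mx (tangent_map F q) *m lin1_mx (tchange (F p) (F q) (F q)).
  apply/row_matrixP => i; rewrite !rowE !mulmxA mul_rV_lin1 mul_jac !mul_rV_lin1.
  exact: esym (tangent_map_change smF _ pq Fpq).
exact: rank_equiv Tu Su E.
Qed.

Lemma near_rank_jac p : \forall x \near to_coord p p,
  \rank (jac p x) = \rank (jac p (to_coord p p)).
Proof.
have E0 := rank_jac (mem_dom p) (mem_dom (F p)).
have h1 := near_F smF (mem_dom p) (nbhs_dom (mem_dom (F p))).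
have h2 := of_coord_near (mem_dom p) (nbhs_dom (mem_dom p)).
apply: filterS2 h1 h2 => x [cx Fx] [_ px].
have <- : to_coord p (of_coord p x) = x by rewrite /to_coord /of_coord chart_invK.
by apply: etrans (esym E0); exact: rank_jac.
Qed.

Lemma near_open_chart p (A : 'rV[R]_m -> Prop) : nbhs (to_coord p p) A ->
  exists U : set M, [/\ open U, U p, U `<=` dom p & forall q, U q -> A (to_coord p q)].
Proof.
move=> hA; have h : nbhs p (fun q => A (to_coord p q)) by exact: (to_coord_continuous (mem_dom p)).
have [U [oU Up UA]] := nbhs_open (nbhsI h (nbhs_dom (mem_dom p))).
by exists U; split=> // q /UA[].
Qed.

Lemma tangent_map_repr p q v : dom p q -> dom (F p) (F q) ->
  tangent_map F q (tchange q p q v) =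
  tchange (F q) (F p) (F q) ('d (repr_map F p) (to_coord p q) v).
Proof.
move=> pq Fpq; have qq := mem_dom q; have FqFq := mem_dom (F q).
have E := tangent_map_change smF (tchange q p q v) pq Fpq.
have E2 := congr1 ('d (repr_map F p) (to_coord p q)) (tchangeK v pq qq).
have E3 := congr1 (tchange (F q) (F p) (F q)) (etrans E E2).
exact: etrans (esym (tchangeK _ FqFq Fpq)) E3.
Qed.

(** Supplies the vertical test fields: whether a vector is horizontal at [p] can then be decided by
    global sections of the kernel. *)
Lemma extend_kernel p v : tangent_map F p v = 0 ->
  exists U : vector_field M, section (ker_map F) U /\ U p = v.
Proof.
move=> kv; have pp := mem_dom p.
have v0 : v *m jac p (to_coord p p) = 0 by rewrite mul_jac.
have [w [sw wp nw]] := smooth_kernel (smooth_jac p) (near_rank_jac p) v0.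
have nF := near_F smF pp (nbhs_dom (mem_dom (F p))).
have nA := nbhsI (near_smooth_at sw) nw.
have [U [oU Up Udom UA]] := near_open_chart (nbhsI nA nF).
have sU : smooth_field U (field_of p w).
  apply/smooth_fieldP => // q Uq; apply: smooth_field_of; first exact: Udom.
  exact: (UA q Uq).1.1.
have [chi [chip chi0 sX]] := extend_field oU Up sU.
exists (fun q => chi q *: (field_of p w q : 'rV[R]_m)); split; last first.
  by rewrite chip scale1r field_of_center.
split=> // q; rewrite /ker_map /=.
have [Uq|nUq] := pselect (U q); last by rewrite chi0 // scale0r; exact: tangent_map0.
have [[_ kq] [_ Fq]] := UA q Uq; rewrite to_coordK in Fq; last exact: Udom.
rewrite mul_jac in kq.
apply: etrans (tangent_mapZ _ _ _ _) _.
have -> : tangent_map F q (field_of p w q) = 0.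
  apply: etrans (tangent_map_repr _ (Udom q Uq) Fq) _.
  by apply: etrans (congr1 _ kq) _; exact: linear0.
exact: scaler0.
Qed.

Definition gmat p (x : 'rV[R]_m) : 'M[R]_m := \matrix_(i, j) mcoef gM p 'e_i 'e_j x.

Lemma mul_gmat p x u v : (u *m gmat p x *m v^T) 0 0 = mcoef gM p u v x.
Proof.
rewrite mcoef_coord mxE exchange_big; apply: eq_bigr => j _.
rewrite !mxE mulr_suml; apply: eq_bigr => i _.
by rewrite !mxE mulrAC.
Qed.

Lemma gmat_sym p x : (gmat p x)^T = gmat p x.
Proof. by apply/matrixP => i j; rewrite !mxE /mcoef ipC. Qed.

Lemma gmat_pos p q u : dom p q ->
  u *m gmat p (to_coord p q) *m u^T = 0 -> u = 0.
Proof.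
move=> pq h; have := mul_gmat p (to_coord p q) u u; rewrite h mxE /mcoef to_coordK //.
move=> /esym/ip_eq0; rewrite coord_fieldE => T0.
exact: etrans (esym (tchangeK u pq (mem_dom q))) (etrans (congr1 _ T0) (linear0 _)).
Qed.

Lemma smooth_gmat p i j : smooth_at (fun x => gmat p x i j : R^o) (to_coord p p).
Proof.
apply: smooth_at_near (smooth_mcoef gM p 'e_i 'e_j).
by near=> x; rewrite [RHS]mxE.
Unshelve. all: by end_near. Qed.

(** The horizontal lift is determined pointwise; its smooth dependence on the point is
    [smooth_horizontal_solve] for the Jacobian of [F] and the matrix of [gM]. *)
Lemma lift_section p (W : section_along F) (O : set M) : open O -> O p ->
  smooth_along O W -> (forall q, O q -> range_map F q (W q)) ->
  exists (U : set M) (Y : vector_field M), [/\ open U, U p, U `<=` O, smooth_field U Y &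
    forall q, U q -> horizontal gM F q (Y q) /\ tangent_map F q (Y q) = W q].
Proof.
move=> oO Op sW rW; have pp := mem_dom p.
have sb := iffLR (smooth_alongP smF W oO) sW p Op.
have nF := near_F smF pp (nbhs_dom (mem_dom (F p))).
have nO := of_coord_near pp (nbhsI (nbhs_dom pp) (open_nbhs_nbhs (conj oO Op))).
have nG : \forall x \near to_coord p p, (gmat p x)^T = gmat p x /\
    forall u : 'rV[R]_m, u *m gmat p x *m u^T = 0 -> u = 0.
  apply: filterS nO => x [cx [px _]]; split; first exact: gmat_sym.
  have <- : to_coord p (of_coord p x) = x by rewrite /to_coord /of_coord chart_invK.
  by move=> u; apply: gmat_pos.
have bA : \forall x \near to_coord p p, (local_repr W p x <= jac p x)%MS.
  apply: filterS2 nO nF => x [cx [px Ox]] [_ Fx].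
  have [q [{}px {}Ox {}Fx <-]] : exists q, [/\ dom p q, O q, dom (F p) (F q) & to_coord p q = x].
    by exists (of_coord p x); split=> //; rewrite /to_coord /of_coord chart_invK.
  have [v _ vW] := rW q Ox.
  suff -> : local_repr W p (to_coord p q) = tchange p q q v *m jac p (to_coord p q).
    exact: submxMl.
  rewrite mul_jac; apply: etrans (local_reprE _ px) _.
  apply: etrans (congr1 _ (esym vW)) _.
  have H := tangent_map_change smF v px Fx.
  exact: H.
have [y [sy ny]] := smooth_horizontal_solve (smooth_jac p) (smooth_gmat p) nG
  (near_rank_jac p) sb bA.
have nA := nbhsI (near_smooth_at sy) ny.
have [U [oU Up Udom UA]] := near_open_chart (nbhsI nA (nbhsI nF nO)).
exists U, (field_of p y); split=> //.
- by move=> q Uq; have [_ [_ [_ [_]]]] := UA q Uq; rewrite to_coordK //; exact: Udom.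
- apply/smooth_fieldP => // q Uq; apply: smooth_field_of; first exact: Udom.
  exact: (UA q Uq).1.1.
move=> q Uq; have [[_ [yA [z yG]]] [[_ Fq] _]] := UA q Uq; have pq := Udom q Uq.
rewrite to_coordK // in Fq.
split.
  (* A vertical [k] has coordinates [k'] killed by the Jacobian; since [y *m G] is a multiple of the
     transposed Jacobian, its product with [k'] is zero. *)
  move=> k kk; set k' := tchange p q q k.
  have kE : tchange q p q k' = k by apply: tchangeK => //; exact: mem_dom.
  have kA : k' *m jac p (to_coord p q) = 0.
    rewrite mul_jac; apply: etrans (esym (tangent_map_change smF k pq Fq)) _.
    by apply: etrans (congr1 _ kk) _; exact: linear0.
  have := mul_gmat p (to_coord p q) (y (to_coord p q)) k'.
  rewrite yG -mulmxA -trmx_mul kA trmx0 mulmx0 mxE /mcoef to_coordK //.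
  by rewrite !coord_fieldE kE => ->.
apply: etrans (tangent_map_repr _ pq Fq) _.
have E : 'd (repr_map F p) (to_coord p q) (y (to_coord p q)) = local_repr W p (to_coord p q).
  by rewrite -mul_jac.
apply: etrans (congr1 _ E) _; apply: etrans (congr1 _ (local_reprE _ pq)) _.
by apply: tchangeK => //; exact: mem_dom.
Qed.

End Lifts.

(** * Geodesics *)

Section Geodesics.
Variables (R : realType) (n : nat) (N : manifold R n) (C : connection N).
Implicit Types (q : N) (u v w : 'rV[R]_n).

(** [chris] at a point uses that point's own preferred chart. A differential equation in the fixed
    chart at [q] needs the symbols of that chart at nearby points, and these are read off covariant
    derivatives of coordinate fields. *)
Definition christoffel q (i j : 'I_n) : 'rV[R]_n -> 'rV[R]_n :=
  field_repr (nabla C (coord_field q 'e_i) (coord_field q 'e_j)) q.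

Lemma smooth_christoffel q i j : smooth_at (christoffel q i j) (to_coord q q).
Proof.
have := cov_deriv_smooth C (@dom_open _ _ N q) (smooth_coord_field q 'e_i)
  (smooth_coord_field q 'e_j).
by move/(smooth_fieldP _ (@dom_open _ _ N q))/(_ q (mem_dom q)).
Qed.

Definition christoffel_form q (x u w : 'rV[R]_n) : 'rV[R]_n :=
  \sum_i \sum_j (u 0 i * w 0 j) *: christoffel q i j x.

Lemma field_deriv_coord_field_at q q' u w : dom q q' ->
  field_deriv (coord_field q w) q' (tchange q' q q' u) =
  'd (fun y => 'd (transition q' q) y w) (to_coord q q') u.
Proof.
move=> qq'; have q'q' := mem_dom q'.
have st := smooth_transition q'q' qq'.
have tE := transition_to_coord q q'q'.
have sT : smooth_at (transition q' q) (to_coord q q') by exact: smooth_transition.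
have hg : diff_val_at (transition q q') (to_coord q' q') (tchange q' q q' u) u.
  split; first exact: smooth_at_differentiable.
  exact: tchangeK.
have hw : diff_val_at (fun _ : 'rV[R]_n => w) (to_coord q' q') (tchange q' q q' u) 0.
  exact: diff_val_at_cst.
have H := diff_val_at_diff_along tE sT hg hw.
have E : \forall x \near to_coord q' q',
   'd (transition q' q) (transition q q' x) w = field_repr (coord_field q w) q' x.
  have n2 : nbhs q' (dom q `&` dom q') by apply: nbhsI; exact: nbhs_dom.
  apply: filterS (of_coord_near q'q' n2) => x [cx [qx q'x]].
  have -> : x = to_coord q' (of_coord q' x) by rewrite /to_coord /of_coord chart_invK.
  rewrite /field_repr local_reprE // coord_fieldE transition_to_coord //.
  by apply: esym; apply: tchange_comp => //; exact: mem_dom.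
have [_ D] := diff_val_at_near E H.
have L0 := linear0 ('d (transition q' q) (to_coord q q')).
exact: etrans D (etrans (congr1 (fun a : 'rV[R]_n => _ + a) L0) (addr0 _)).
Qed.

(** The transformation law of the Christoffel symbols, with its inhomogeneous second derivative
    term. Checked on basis vectors through covariant derivatives of coordinate fields, then extended
    bilinearly. *)
Lemma tchange_christoffel q q' u w : dom q q' ->
  tchange q' q q' (christoffel_form q (to_coord q q') u w) =
  'd (fun y => 'd (transition q' q) y w) (to_coord q q') u +
  chris C q' (tchange q' q q' u) (tchange q' q q' w) :> 'rV[R]_n.
Proof.
move=> qq'; have q'q' := mem_dom q'; set T := tchange q' q q'.
pose D i j := 'd (fun y => 'd (transition q' q) y ('e_j : 'rV[R]_n)) (to_coord q q') 'e_i.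
have TG i j : T (christoffel q i j (to_coord q q')) =
    D i j + (chris C q' (T 'e_i) (T 'e_j) : 'rV[R]_n).
  have E : christoffel q i j (to_coord q q') =
      tchange q q' q' (nabla C (coord_field q 'e_i) (coord_field q 'e_j) q').
    exact: (@local_reprE R n n N N id).
  apply: etrans (congr1 _ E) _; apply: etrans (tchangeK _ q'q' qq') _.
  rewrite /nabla /cov_deriv !coord_fieldE -/T; congr (_ + _).
  exact: field_deriv_coord_field_at.
have Tsum z : T z = \sum_i z 0 i *: T 'e_i by exact: diff_row_sum.
have Dsum : 'd (fun y => 'd (transition q' q) y w) (to_coord q q') u =
    \sum_i \sum_j (u 0 i * w 0 j) *: D i j.
  have st := smooth_transition qq' q'q'.
  apply: etrans (diff_row_sum _ _ _) _; apply: eq_bigr => i _.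
  apply: etrans (congr1 ( *:%R (u 0 i)) (diff2_coord w 'e_i st)) _.
  by rewrite scaler_sumr; apply: eq_bigr => j _; rewrite scalerA.
have Csum : chris C q' (T u) (T w) =
    \sum_i \sum_j (u 0 i * w 0 j) *: (chris C q' (T 'e_i) (T 'e_j) : 'rV[R]_n) :> 'rV[R]_n.
  rewrite (Tsum w) chris_sumr exchange_big; apply: eq_bigr => j _.
  rewrite chrisZr (Tsum u).
  have -> : chris C q' (\sum_i u 0 i *: T 'e_i) (T 'e_j) =
      \sum_i u 0 i *: (chris C q' (T 'e_i) (T 'e_j) : 'rV[R]_n) :> 'rV[R]_n.
    elim: (index_enum _) => [|i r IH]; first by rewrite !big_nil; exact: chris0l.
    by rewrite !big_cons -IH -chrisZl; exact: chrisDl.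
  by rewrite scaler_sumr; apply: eq_bigr => i _; rewrite scalerA mulrC.
apply: etrans _ (esym (congr2 (fun a b : 'rV[R]_n => a + b) Dsum Csum)).
clearbody D; rewrite -big_split /christoffel_form.
apply: etrans (linear_sum _ _ _ _) _; apply: eq_bigr => i _.
apply: etrans (linear_comb T _ _ _) _; rewrite -big_split; apply: eq_bigr => j _.
by rewrite (TG i j) scalerDr.
Qed.

(** The geodesic spray in the chart at [q]: [z] holds position and velocity side by side, which
    makes the second order equation a first order one. *)
Definition geodesic_field q (z : 'rV[R]_(n + n)) : 'rV[R]_(n + n) :=
  row_mx (rsubmx z) (- christoffel_form q (lsubmx z) (rsubmx z) (rsubmx z)).

Lemma smooth_at_row_mx (V : normedModType R) k l (f : V -> 'rV[R]_k) (g : V -> 'rV[R]_l) x :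
  smooth_at f x -> smooth_at g x -> smooth_at (fun y => row_mx (f y) (g y)) x.
Proof.
move=> /smooth_at_coordP hf /smooth_at_coordP hg; apply/smooth_at_coordP => i.
case: (splitP i) => j ij.
  apply: smooth_at_near (hf j); near=> y; have -> : i = lshift l j by exact/val_inj.
  by rewrite row_mxEl.
apply: smooth_at_near (hg j); near=> y; have -> : i = rshift k j by exact/val_inj.
by rewrite row_mxEr.
Unshelve. all: by end_near. Qed.

Lemma lsubmx_linear k l : linear (lsubmx : 'rV[R]_(k + l) -> 'rV[R]_k).
Proof. by move=> a u v; rewrite linearP. Qed.

Lemma rsubmx_linear k l : linear (rsubmx : 'rV[R]_(k + l) -> 'rV[R]_l).
Proof. by move=> a u v; rewrite linearP. Qed.

Lemma smooth_geodesic_field q v :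
  smooth_at (geodesic_field q) (row_mx (to_coord q q) v).
Proof.
set z0 := row_mx _ _.
have sl : smooth_at (lsubmx : 'rV[R]_(n + n) -> 'rV[R]_n) z0.
  by apply: smooth_at_linear; exact: lsubmx_linear.
have sr : smooth_at (rsubmx : 'rV[R]_(n + n) -> 'rV[R]_n) z0.
  by apply: smooth_at_linear; exact: rsubmx_linear.
apply: smooth_at_row_mx => //.
apply: (smooth_at_near (f := fun z => (-1) *: christoffel_form q (lsubmx z) (rsubmx z) (rsubmx z))).
  by near=> z; rewrite scaleN1r.
apply: smooth_at_scale; first exact: smooth_at_cst.
apply: smooth_at_sum => i; apply: smooth_at_sum => j.
have sri k := iffLR (smooth_at_coordP _ _) sr k.
apply: smooth_at_scale; first exact: smooth_atM (sri i) (sri j).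
apply: (smooth_at_comp (h := christoffel q i j) sl).
by rewrite /z0 row_mxKl; exact: smooth_christoffel.
Unshelve. all: by end_near. Qed.

Lemma is_derive_linear k l (f : 'rV[R]_k -> 'rV[R]_l) (z : R -> 'rV[R]_k) (t : R)
    (w : 'rV[R]_k) :
  linear f -> is_derive t 1 z w -> is_derive t 1 (f \o z) (f w).
Proof.
move=> lf hz; have [dz ez] := is_derive_diff 1 hz; rewrite scale1r in ez.
have [df ef] := linear_fun_diff (z t) lf.
have dfz : differentiable (f \o z) t by exact: differentiable_comp.
have E := diff_compE (1 : R) (erefl (z t)) dz df.
apply: DeriveDef; first exact/derivable1_diffP.
by rewrite deriveE //; apply: etrans E _; rewrite ez ef.
Qed.

Lemma geodesic_exists q v : exists (e : R) (b : R -> N),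
  [/\ 0 < e, geodesic C [set t | `|t| < e] b, b 0 = q & velocity b 0 = v :> 'rV[R]_n].
Proof.
have [e0 [z [e00 z0 hz]]] := ode_local (smooth_geodesic_field q v).
have smz := ode_smooth hz.
pose x t := lsubmx (z t); pose y t := rsubmx (z t).
have sx (t : R) : `|t| < e0 -> smooth_at (x : R^o -> _) t.
  by move=> /smz h; apply: (smooth_at_comp h); apply: smooth_at_linear; exact: lsubmx_linear.
have sy (t : R) : `|t| < e0 -> smooth_at (y : R^o -> _) t.
  by move=> /smz h; apply: (smooth_at_comp h); apply: smooth_at_linear; exact: rsubmx_linear.
have dx (t : R) : `|t| < e0 -> diff_val_at x t (1 : R) (y t).
  move=> /hz[_ h]; have := is_derive_linear (@lsubmx_linear n n) h.
  by rewrite /geodesic_field row_mxKl => /(is_derive_diff 1)[d]; rewrite scale1r.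
have dy (t : R) : `|t| < e0 -> diff_val_at y t (1 : R) (- christoffel_form q (x t) (y t) (y t)).
  move=> /hz[_ h]; have := is_derive_linear (@rsubmx_linear n n) h.
  by rewrite /geodesic_field row_mxKr => /(is_derive_diff 1)[d]; rewrite scale1r.
have x0 : x 0 = to_coord q q by rewrite /x z0 row_mxKl.
have y0 : y 0 = v by rewrite /y z0 row_mxKr.
have cod0 : chart_cod (chart_at q) (x 0) by rewrite x0; exact: chart_map_cod (mem_dom q).
have n0 : `|0 : R| < e0 by rewrite normr0.
have ncod : \forall t \near (0 : R), chart_cod (chart_at q) (x t).
  have cx := smooth_at_continuous (sx 0 n0).
  exact: cx _ (open_nbhs_nbhs (conj (@chart_cod_open _ _ _ (chart_at q)) cod0)).
have [e1 e10 he1] := nbhs_norm_ex ncod.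
(* [e0] bounds the time of existence, [e1] the time during which the solution stays in the image of
   the chart. *)
pose e := Num.min e0 e1.
have ee0 (t : R) : `|t| < e -> `|t| < e0 by rewrite lt_min => /andP[].
have xcod (t : R) : `|t| < e -> chart_cod (chart_at q) (x t).
  by rewrite lt_min => /andP[_ te1]; apply: he1; rewrite sub0r normrN.
pose b t := of_coord q (x t).
have qb (t : R) : `|t| < e -> dom q (b t) by move=> /xcod; exact: chart_inv_dom.
have xb (t : R) : `|t| < e -> to_coord q (b t) = x t by move=> /xcod; exact: chart_invK.
have cb (t : R) : `|t| < e -> {for t, continuous b}.
  move=> te; apply: (@continuous_comp _ _ _ x (of_coord q)).
    by have h := smooth_at_continuous (sx t (ee0 t te)); exact: h.
  exact: chart_inv_cont (xcod t te).
have nI (t : R) : `|t| < e -> nbhs t (fun s => `|s| < e) by exact: (@nbhs_norm_lt R R^o).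
have stb (t t0 : R) : `|t| < e -> dom (b t0) (b t) -> smooth_at (transition (b t0) q) (x t).
  by move=> te h; rewrite -(xb t te); exact: smooth_transition (qb t te) h.
have vel (t : R) : `|t| < e -> velocity b t = tchange (b t) q (b t) (y t).
  move=> te; apply: diff_val_at_derive.
  have H := diff_val_at_compE (erefl (x t)) (dx t (ee0 t te))
    (smooth_at_differentiable (stb t t te (mem_dom _))).
  have E := congr1 (fun z => 'd (transition (b t) q) z (y t)) (xb t te).
  exact: diff_val_at_eq (esym E) H.
have b0 : b 0 = q by rewrite /b x0 to_coordK //; exact: mem_dom.
have e_gt0 : 0 < e by rewrite lt_min e00.
have ne0 : `|0 : R| < e by rewrite normr0.
exists e, b; split=> //; last first.
  by rewrite vel // b0 y0; apply: tchange_id; exact: mem_dom.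
split; first split.
- by move=> t; exact: cb.
- move=> t0 t0e.
  have oS : open [set t : R^o | [set t | `|t| < e] t /\ chart_dom (chart_at (b t0)) (b t)].
    rewrite openE => t [te bt]; apply: filterI; first exact: nI.
    exact: (cb t te _ (nbhs_dom bt)).
  apply/(smooth_onP _ oS) => t [te bt].
  exact: (smooth_at_comp (sx t (ee0 t te)) (stb t t0 te bt)).
move=> t te; rewrite /nabla_curve (vel t te).
set T := tchange (b t) q (b t); set psi := transition (b t) q.
have stt := stb t t te (mem_dom _).
have H := diff_val_at_diff_along erefl stt (dx t (ee0 t te)) (dy t (ee0 t te)).
have E : \forall s \near t, 'd psi (x s) (y s) =
    coord_change (b t) (b s) (velocity b s).
  apply: filterS2 (nI t te) (cb t te _ (nbhs_dom (mem_dom (b t)))) => s se bs.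
  rewrite coord_changeE vel //.
  apply: etrans (congr1 (fun z => 'd psi z (y s)) (esym (xb s se))) _.
  apply: esym; apply: tchange_comp => //; [exact: qb|exact: mem_dom].
have D := diff_val_at_derive (diff_val_at_near E H).
apply: etrans (congr1 (fun a : 'rV[R]_n => a + (chris C (b t) (T (y t)) (T (y t)) : 'rV[R]_n)) D) _.
(* Transporting the velocity from the chart at [q] to the preferred chart at [b t] produces a second
   derivative of the transition map; it cancels against the inhomogeneous term of this law. *)
have TC := tchange_christoffel (y t) (y t) (qb t te).
rewrite -/T -/psi (xb t te) in TC.
have E2 : 'd psi (x t) (- christoffel_form q (x t) (y t) (y t)) =
    - T (christoffel_form q (x t) (y t) (y t)).
  have TN (w : 'rV[R]_n) : T (- w) = - T w by exact: linearN.
  apply: etrans _ (TN _).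
  by case: _ / (xb t te).
have cancel (V : zmodType) (a c d : V) : d = a + c -> a + - d + c = 0.
  by move=> ->; rewrite opprD addrA subrr add0r addNr.
apply: etrans (congr1 (fun a : 'rV[R]_n =>
  'd (fun y0 => 'd psi y0 (y t)) (x t) (y t) + a + (chris C (b t) (T (y t)) (T (y t)) : 'rV[R]_n)) E2) _.
exact: cancel TC.
Qed.

End Geodesics.

Lemma smooth_field_at (R : realType) n (N : manifold R n) (Y : vector_field N) (q : N) :
  smooth_field setT Y -> smooth_at (field_repr Y q) (to_coord q q).
Proof. by move=> sY; apply: (iffLR (smooth_fieldP Y (@openT N)) sY). Qed.

Lemma zero_derivative_constant (R : realType) (f : R -> R^o) (e t : R) :
  (forall s : R, `|s| < e -> diff_val_at f s (1 : R) 0) -> `|t| < e -> f t = f 0.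
Proof.
move=> df te; have [->//|t0] := eqVneq t 0.
have ht : 0 < `|t| by rewrite normr_gt0.
have d0 (s : R) (u : R) : `|s| < e -> diff_val_at f s u 0.
  move=> se; have [d E] := df s se; split=> //.
  have -> : u = u *: (1 : R) by rewrite /GRing.scale /= mulr1.
  by rewrite linearZ /= E scaler0.
(* [line_MVT] moves by a positive amount, so a negative [t] is reached by going [|t|] in direction
   [Num.sg t]. *)
have [s /andP[s0 sh] E] : exists2 s, 0 <= s <= `|t| &
    f (0 + `|t| *: Num.sg t) - f 0 = 'd f (0 + s *: Num.sg t : R^o) (Num.sg t) * `|t|.
  apply: (@line_MVT R R^o) => // s /andP[s0 sh].
  apply: (d0 _ 0 _).1; rewrite add0r normrZ normr_sg t0 mulr1 ger0_norm //.
  exact: le_lt_trans te.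
move: E; rewrite !add0r (d0 _ _ _).2 ?mul0r; last first.
  rewrite normrZ normr_sg t0 mulr1 ger0_norm //.
  exact: le_lt_trans te.
have -> : `|t| *: Num.sg t = t by rewrite /GRing.scale /= mulrC -numEsg.
by move/subr0_eq.
Qed.

(** * The metric along a geodesic *)

Section CurvesInMetric.
Variables (R : realType) (n : nat) (N : manifold R n).
Variables (g : metric N) (C : connection N) (I : set R) (b : R -> N).
Hypotheses (oI : open I) (gb : geodesic C I b).
Hypothesis lc : levi_civita g C.

Let nI (t : R) : I t -> nbhs t I.
Proof. by move=> It; exact: open_nbhs_nbhs (conj oI It). Qed.

Lemma curve_near (t : R) (A : set N) : I t -> nbhs (b t) A ->
  \forall s \near t, I s /\ A (b s).
Proof.
move=> It hA; have [[cb _] _] := gb.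
by apply: nbhsI; [exact: nI|exact: cb t It _ hA].
Qed.

Lemma smooth_curve_at (t0 t : R) : I t0 -> I t -> dom (b t0) (b t) ->
  smooth_at (to_coord (b t0) \o b : R^o -> 'rV[R]_n) t.
Proof.
move=> It0 It bt; have [[cb sb] _] := gb.
have oS : open [set t : R^o | I t /\ chart_dom (chart_at (b t0)) (b t)].
  by rewrite openE => s [Is bs]; apply: curve_near => //; exact: (nbhs_dom bs).
have := sb t0 It0; move/(smooth_onP _ oS); apply.
by [].
Qed.

Lemma curve_velocity (t : R) : I t ->
  diff_val_at (to_coord (b t) \o b : R -> 'rV[R]_n) t (1 : R) (velocity b t).
Proof.
move=> It; have d := smooth_at_differentiable (smooth_curve_at It It (mem_dom _)).
by split=> //; apply: esym; exact: (diff_val_at_derive (conj d erefl)).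
Qed.

Lemma coord_velocity (t0 t : R) : I t0 -> I t -> dom (b t0) (b t) ->
  coord_change (b t0) (b t) (velocity b t) = 'd (to_coord (b t0) \o b : R -> 'rV[R]_n) t (1 : R).
Proof.
move=> It0 It bt; rewrite coord_changeE.
have st := smooth_at_differentiable (smooth_transition (mem_dom (b t)) bt).
have H := diff_val_at_compE (erefl (to_coord (b t) (b t))) (curve_velocity It) st.
have E : \forall s \near t, (transition (b t0) (b t) \o (to_coord (b t) \o b)) s = (to_coord (b t0) \o b) s.
  apply: filterS (curve_near It (nbhs_dom (mem_dom (b t)))) => s [_ bs].
  by rewrite /= /transition /= to_coordK.
have [_ E2] := diff_val_at_near E H.
exact: esym E2.
Qed.

(** [derive1] is total, so the geodesic equation alone does not say that the velocity is
    differentiable; smoothness of the curve supplies this. *)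
Lemma nabla_curve_velocity (t : R) : I t -> exists d : 'rV[R]_n,
  diff_val_at (fun s : R => coord_change (b t) (b s) (velocity b s)) t (1 : R) d /\
  d + (chris C (b t) (velocity b t) (velocity b t) : 'rV[R]_n) = 0.
Proof.
move=> It; have sb := smooth_curve_at It It (mem_dom _).
have sv := smooth_at_diff (1 : R^o) sb.
have E : \forall s \near t, 'd (to_coord (b t) \o b : R -> 'rV[R]_n) s (1 : R) =
    coord_change (b t) (b s) (velocity b s).
  apply: filterS (curve_near It (nbhs_dom (mem_dom (b t)))) => s [Is bs].
  by rewrite coord_velocity.
have H v := diff_val_at_near E (conj (smooth_at_differentiable sv) (erefl ('d _ _ v))).
have D := diff_val_at_derive (H (1 : R)).
exists (derive1 (fun s => coord_change (b t) (b s) (velocity b s)) t); split.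
  exact: diff_val_at_eq (esym D) (H (1 : R)).
by have [_ /(_ t It)] := gb.
Qed.

Lemma nabla_curve_field (Y : vector_field N) (t : R) : smooth_field setT Y -> I t ->
  diff_val_at (fun s : R => coord_change (b t) (b s) (Y (b s))) t (1 : R)
    (field_deriv Y (b t) (velocity b t)).
Proof.
move=> sY It; have sr := smooth_field_at (b t) sY.
have H := diff_val_at_compE (erefl (to_coord (b t) (b t))) (curve_velocity It)
  (smooth_at_differentiable sr).
apply: diff_val_at_near H.
apply: filterS (curve_near It (nbhs_dom (mem_dom (b t)))) => s [_ bs].
exact: (@local_reprE R n n N N id _ _ _ bs).
Qed.

Lemma metric_along_curve (W1 W2 : forall t : R, tangent (b t)) (t : R) (d1 d2 : 'rV[R]_n) :
  I t ->
  diff_val_at (fun s : R => coord_change (b t) (b s) (W1 s)) t (1 : R) d1 ->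
  diff_val_at (fun s : R => coord_change (b t) (b s) (W2 s)) t (1 : R) d2 ->
  diff_val_at (fun s : R => g (b s) (W1 s) (W2 s) : R^o) t (1 : R)
    (g (b t) (d1 + chris C (b t) (velocity b t) (W1 t)) (W2 t) +
     g (b t) (W1 t) (d2 + chris C (b t) (velocity b t) (W2 t))).
Proof.
move=> It h1 h2.
have H := diff_mcoef_along lc (erefl (to_coord (b t) (b t))) (curve_velocity It) h1 h2.
have E (W : forall t : R, tangent (b t)) : coord_change (b t) (b t) (W t) = W t.
  by rewrite coord_changeE; apply: tchange_id; exact: mem_dom.
rewrite !E in H; apply: diff_val_at_near H.
apply: filterS (curve_near It (nbhs_dom (mem_dom (b t)))) => s [_ bs].
rewrite /mcoef /= to_coordK // !coord_fieldE !coord_changeE.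
have K w : tchange (b s) (b t) (b s) (tchange (b t) (b s) (b s) w) = w.
  by apply: tchangeK => //; exact: mem_dom.
have H2 := congr2 (fun u w : 'rV[R]_n => g (b s) u w) (K (W1 s)) (K (W2 s)).
exact: H2.
Qed.

End CurvesInMetric.

Section GeodesicSpeed.
Variables (R : realType) (n : nat) (N : manifold R n).
Variables (g : metric N) (C : connection N) (e : R) (b : R -> N).
Hypothesis gb : geodesic C [set t | `|t| < e] b.
Hypothesis lc : levi_civita g C.

Lemma open_norm_lt : open [set t : R | `|t| < e].
Proof. by rewrite openE => t te; exact: (@nbhs_norm_lt R R^o). Qed.

Lemma geodesic_speed (t : R) : `|t| < e ->
  g (b t) (velocity b t) (velocity b t) = g (b 0) (velocity b 0) (velocity b 0).
Proof.
apply: (zero_derivative_constant (f := fun s => g (b s) (velocity b s) (velocity b s))) => s se.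
have [d [hd d0]] := nabla_curve_velocity open_norm_lt gb se.
have := metric_along_curve open_norm_lt gb lc se hd hd.
by rewrite d0 ip0l ip0r addr0.
Qed.

Lemma geodesic_ip_field (Y : vector_field N) (t : R) : smooth_field setT Y -> `|t| < e ->
  diff_val_at (fun s : R => g (b s) (velocity b s) (Y (b s)) : R^o) t (1 : R)
    (g (b t) (velocity b t) (nabla_at C Y (b t) (velocity b t))).
Proof.
move=> sY te; have [d [hd d0]] := nabla_curve_velocity open_norm_lt gb te.
have := metric_along_curve open_norm_lt gb lc te hd (nabla_curve_field open_norm_lt gb sY te).
by rewrite d0 ip0l add0r.
Qed.

Lemma geodesic_norm_field (Y : vector_field N) (t : R) : smooth_field setT Y -> `|t| < e ->
  diff_val_at (fun s : R => g (b s) (Y (b s)) (Y (b s)) : R^o) t (1 : R)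
    (2 * g (b t) (Y (b t)) (nabla_at C Y (b t) (velocity b t))).
Proof.
move=> sY te; have hY := nabla_curve_field open_norm_lt gb sY te.
have := metric_along_curve open_norm_lt gb lc te hY hY.
by rewrite [X in X + _](ipC g) -mulr2n mulr_natl.
Qed.

Lemma geodesic_fun (f : N -> R) (t : R) : smooth_fun setT f -> `|t| < e ->
  diff_val_at (f \o b : R -> R^o) t (1 : R) (fun_deriv f (b t) (velocity b t)).
Proof.
move=> sf te; have sft := smooth_at_differentiable (smooth_fun_at sf (mem_dom (b t))).
have H := diff_val_at_compE (erefl (to_coord (b t) (b t))) (curve_velocity open_norm_lt gb te) sft.
apply: diff_val_at_near H.
apply: filterS (curve_near open_norm_lt gb te (nbhs_dom (mem_dom (b t)))) => s [_ bs].
by rewrite /= to_coordK.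
Qed.

End GeodesicSpeed.

(** * Subbundles and Riemannian maps *)

Section OrthogonalDecomposition.
Variables (R : realType) (n : nat) (N : manifold R n) (g : metric N) (q : N).
Implicit Types (u v w : 'rV[R]_n) (s : seq 'rV[R]_n).

Lemma orthogonal_projection s v : exists2 u, u \in span s &
  forall w, w \in span s -> g q (v - u) w = 0.
Proof.
elim: s v => [|a s IH] v.
  exists 0; first exact: mem0v.
  by move=> w; rewrite span_nil memv0 => /eqP ->; rewrite ip0r.
have [a' a's aO] := IH a; have [v' v's vO] := IH v.
(* A Gram-Schmidt step. If [a] already lies in the span of [s], then [a2 = 0], and division by zero
   gives [c = 0]: no correction is added. *)
set a2 := a - a' in aO *; set c := g q v a2 / g q a2 a2.
have sub w : w \in span s -> w \in span (a :: s).
  by apply/subvP; rewrite span_cons addvSr.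
have as_ : a \in span (a :: s) by apply: memv_span; exact: mem_head.
exists (v' + c *: a2).
  apply: memvD; first exact: sub.
  by apply: memvZ; apply: memvB => //; exact: sub.
move=> w; rewrite span_cons => /memv_addP[x /vlineP[k ->] [y ys ->]].
have Oy : g q (v - (v' + c *: a2)) y = 0.
  by rewrite opprD addrA ipBl ipZl vO // aO // mulr0 subrr.
rewrite ipDr Oy addr0 ipZr -(subrK a' a) -/a2 ipDr.
have -> : g q (v - (v' + c *: a2)) a' = 0.
  by rewrite opprD addrA ipBl ipZl vO // aO // mulr0 subrr.
rewrite addr0 opprD addrA ipBl ipZl ipBl (ipC g q v' a2) aO // subr0 /c.
have [-> |/(ip_pos g q)/lt0r_neq0 a2n] := eqVneq a2 0; first by rewrite !ip0r mulr0 subr0 mulr0.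
by rewrite divfK // subrr mulr0.
Qed.

End OrthogonalDecomposition.

Section Subbundles.
Variables (R : realType) (m n : nat) (M : manifold R m) (N : manifold R n).
Variables (F : M -> N) (k : nat) (D : forall p : M, set (tangent (F p))).
Arguments D : clear implicits.
Hypothesis smF : smooth_map F.
Hypothesis sD : subbundle_along k D.
Implicit Types (p q : M) (u v w : 'rV[R]_n).

Lemma subbundle_span p : exists e : k.-tuple 'rV[R]_n,
  free e /\ forall v, D p v <-> v \in span e.
Proof.
have [U [W [_ Up _ /(_ p Up)]]] := sD p => /= -[fe DE].
by exists [tuple W i p | i < k]; split=> // v; rewrite DE.
Qed.

Lemma subbundleD p u v : D p u -> D p v -> D p (u + v).
Proof. by have [e [_ DE]] := subbundle_span p; rewrite !DE; exact: memvD. Qed.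

Lemma subbundleZ p a v : D p v -> D p (a *: v).
Proof. by have [e [_ DE]] := subbundle_span p; rewrite !DE => h; exact: memvZ. Qed.

Lemma subbundle0 p : D p (0 : 'rV[R]_n).
Proof. by have [e [_ DE]] := subbundle_span p; rewrite !DE; exact: mem0v. Qed.

Lemma subbundle_projection (g : metric N) p v : exists2 u, D p u &
  forall w, D p w -> g (F p) (v - u) w = 0.
Proof.
have [e [_ DE]] := subbundle_span p.
have [u ue uO] := orthogonal_projection g (F p) e v.
by exists u; [exact/DE|move=> w /DE; exact: uO].
Qed.

Lemma smooth_along_comb (U : set M) (I : finType) (W : I -> section_along F) (c : I -> R) :
  open U -> (forall i, smooth_along U (W i)) ->
  smooth_along U (fun q => \sum_i c i *: (W i q : 'rV[R]_n) : tangent (F q)).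
Proof.
move=> oU sW; apply/smooth_alongP => // p Up.
apply: (smooth_at_near (f := fun x => \sum_i c i *: local_repr (W i) p x)).
  near=> x; rewrite /local_repr.
  set y := of_coord p x.
  have L := linear_comb (tchange (F p) (F y) (F y)) (index_enum I) c (fun i => W i y).
  exact: esym L.
apply: smooth_at_sum => i; apply: smooth_at_scale; first exact: smooth_at_cst.
exact: (iffLR (smooth_alongP smF (W i) oU) (sW i) p Up).
Unshelve. all: by end_near. Qed.

Lemma extend_subbundle p w : D p w -> exists (U : set M) (W : section_along F),
  [/\ open U, U p, smooth_along U W, forall q, U q -> D q (W q) & W p = w].
Proof.
move=> Dw; have [U [W [oU Up sW DE]]] := sD p.
have [fe /= DEp] := DE p Up; rewrite DEp in Dw.
pose c i := coord [tuple W i p | i < k] i w.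
exists U, (fun q => \sum_i c i *: (W i q : 'rV[R]_n)); split=> //.
- exact: smooth_along_comb.
- move=> q /DE[_ ->] /=; apply: memv_suml => i _; apply: memvZ.
  by apply: memv_span; apply: map_f; exact: mem_enum.
have E := coord_span (Dw : w \in span [tuple W i p | i < k]).
apply: etrans _ (esym E); apply: eq_bigr => i _.
by rewrite (nth_map i) ?size_enum_ord // nth_ord_enum.
Qed.

End Subbundles.

Lemma extend_distribution (R : realType) n (N : manifold R n) k
    (D : forall q : N, set (tangent q)) (q : N) (w : 'rV[R]_n) :
  is_distribution k D -> D q w -> exists Y : vector_field N, section D Y /\ Y q = w.
Proof.
move=> sD Dw; have [U [W [oU Uq sW DW Wq]]] := extend_subbundle (smooth_map_id N) sD Dw.
have [chi [chiq chi0 sX]] := extend_field oU Uq sW.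
exists (fun p => chi p *: (W p : 'rV[R]_n)); split; last by rewrite chiq scale1r.
split=> // p; have [Up|nUp] := pselect (U p).
  by apply: (subbundleZ sD); exact: DW.
by rewrite chi0 // scale0r; exact: subbundle0 sD p.
Qed.

Section HorizontalExtension.
Variables (R : realType) (m n r : nat) (M : manifold R m) (N : manifold R n).
Variables (F : M -> N) (gM : metric M).
Hypotheses (smF : smooth_map F) (rkF : has_rank F r).
Implicit Types (p q : M) (u v : 'rV[R]_m).

Lemma horizontalD p u v : horizontal gM F p u -> horizontal gM F p v -> horizontal gM F p (u + v).
Proof. by move=> hu hv w kw; rewrite ipDl hu // hv // addr0. Qed.

Lemma horizontalZ p a v : horizontal gM F p v -> horizontal gM F p (a *: v).
Proof. by move=> hv w kw; rewrite ipZl hv // mulr0. Qed.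

Lemma horizontal0 p : horizontal gM F p (0 : 'rV[R]_m).
Proof. by move=> w kw; rewrite ip0l. Qed.

Lemma horizontal_inj p u v : horizontal gM F p u -> horizontal gM F p v ->
  tangent_map F p u = tangent_map F p v -> u = v.
Proof.
move=> hu hv E; apply: subr0_eq; apply: (ip_eq0 (g := gM) (q := p)).
have k : ker_map F p (u - v).
  have H := tangent_mapB F p u v; rewrite E subrr in H.
  exact: H.
by rewrite ipBl hu // hv // subrr.
Qed.

(** [totally_geodesic] and both conditions of the theorem speak of global sections only; this gives
    one through every vector of the lifted distribution. *)
Lemma extend_horizontal_lift k (D : forall p : M, set (tangent (F p))) p (w : 'rV[R]_n) :
  subbundle_along k D -> (forall q, D q `<=` range_map F q) -> D p w ->
  exists Y : vector_field M, section (horizontal_lift gM D) Y /\ tangent_map F p (Y p) = w.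
Proof.
move=> sD Dr Dw; have [A [W [oA Ap sW DW Wp]]] := extend_subbundle smF sD Dw.
have [U [Y [oU Up UA sY hY]]] := lift_section gM smF rkF oA Ap sW (fun q Aq => Dr q _ (DW q Aq)).
have [chi [chip chi0 sX]] := extend_field oU Up sY.
exists (fun q => chi q *: (Y q : 'rV[R]_m)); split; last first.
  rewrite chip scale1r; rewrite -Wp; exact: (hY p Up).2.
split=> // q; have [Uq|nUq] := pselect (U q).
  have [hq eq] := hY q Uq; split; first exact: horizontalZ.
  have E := tangent_mapZ F q (chi q) (Y q); rewrite eq in E.
  rewrite E; apply: (subbundleZ sD); apply: DW; exact: UA.
rewrite chi0 // scale0r; split; first exact: horizontal0.
by rewrite (tangent_map0 F q); exact: subbundle0 sD q.
Qed.

End HorizontalExtension.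

(** * Consequences of the Clairaut relation *)

Section ClairautRelation.
Variables (R : realType) (n r : nat) (N : manifold R n).
Variables (g : metric N) (C : connection N) (Ran : forall q : N, set (tangent q)).
Variable f : N -> R.
Arguments Ran : clear implicits.
Hypotheses (lc : levi_civita g C) (dRan : is_distribution r Ran).
Hypothesis tgRan : totally_geodesic C (fun q => orth g q (Ran q)).
Hypotheses (sf : smooth_fun setT f) (cl : clairaut g C Ran (fun q => expR (f q))).
Implicit Types (q : N) (u v w h : 'rV[R]_n).

Lemma sin_angle_normal q h v : h + v != 0 -> g q h v = 0 ->
  (sin (angle g q (h + v) v)) ^+ 2 = g q h h / g q (h + v) (h + v).
Proof.
move=> hv0 hO; rewrite /angle.
have c0 := ip_pos g q hv0.
have vh : g q (h + v) v = g q v v by rewrite ipDl hO add0r.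
have cE : g q (h + v) (h + v) = g q h h + g q v v.
  by rewrite ipDl !ipDr (ipC g q v h) hO addr0 add0r.
have hh := ip_ge0 g q h; have vv := ip_ge0 g q v.
set x := _ / _.
have xE : x ^+ 2 = g q v v / g q (h + v) (h + v).
  rewrite /x vh exprMn exprVn exprMn !sqr_sqrtr ?ip_ge0 //.
  (* For [v = 0] the quotient is 0 by the convention on division, which agrees with the right-hand
     side and gives a right angle. *)
  have [->|v0] := eqVneq (g q v v) 0; first by rewrite expr0n !mul0r.
  by rewrite invfM mulrCA expr2 mulfK // mulrC.
have x1 : x ^+ 2 <= 1 by rewrite xE ler_pdivrMr // mul1r cE lerDr.
have xn : -1 <= x <= 1 by rewrite -ler_norml -(@expr_le1 _ 2) // real_normK // num_real.
rewrite sin_acos // sqr_sqrtr ?subr_ge0 // xE.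
rewrite -(divff (lt0r_neq0 c0)) -mulrBl [in X in X - _]cE addrK.
by [].
Qed.

Lemma nabla_atD (Y : vector_field N) q u v :
  nabla_at C Y q (u + v) = nabla_at C Y q u + nabla_at C Y q v.
Proof.
rewrite /nabla_at chrisDl addrACA; congr (_ + _).
exact: linearD.
Qed.

Lemma nabla_atN (Y : vector_field N) q v : nabla_at C Y q (- v) = - nabla_at C Y q v.
Proof.
have H := nabla_atD Y q v (- v); apply/eqP; rewrite -addr_eq0 addrC -H subrr /nabla_at.
by rewrite chris0l addr0; apply/eqP; exact: linear0.
Qed.

Lemma fun_derivD q u v : fun_deriv f q (u + v) = fun_deriv f q u + fun_deriv f q v.
Proof. exact: linearD. Qed.

Lemma fun_derivN q v : fun_deriv f q (- v) = - fun_deriv f q v.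
Proof. exact: linearN. Qed.

Lemma orthogonal_decomposition_unique q h h' v v' : Ran q h -> Ran q h' ->
  orth g q (Ran q) v -> orth g q (Ran q) v' -> h + v = h' + v' -> h = h'.
Proof.
move=> Rh Rh' Ov Ov' E; apply: subr0_eq; apply: (ip_eq0 (g := g) (q := q)).
have {1}-> : h - h' = v' - v.
  by apply/eqP; rewrite subr_eq addrAC eq_sym subr_eq addrC -E addrC.
have oD w : orth g q (Ran q) w -> g q w (h - h') = 0.
  by move=> Ow; rewrite ipBr (Ow _ Rh) (Ow _ Rh') subrr.
by rewrite ipBl !oD // subrr.
Qed.

(** The function [phi] below is the Cauchy-Schwarz defect between the normal part of the velocity
    and [Y]. It is nonnegative and vanishes at time 0, where both vectors are [Y q]; its derivative
    there must be zero, and this is the claim up to a factor. *)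
Lemma clairaut_geodesic (Y : vector_field N) q h :
  section (fun q => orth g q (Ran q)) Y -> Ran q h -> Y q != (0 : 'rV[R]_n) ->
  g q h h * fun_deriv f q (h + Y q) = g q h (nabla_at C Y q (h + Y q)).
Proof.
move=> [sY oY] Rh v0; set v : 'rV[R]_n := Y q.
have hv : g q h v = 0 by rewrite ipC; exact: oY.
have [e [b [e0 gb b0 vb]]] := geodesic_exists C q (h + v).
have hv0 : h + v != 0.
  apply/eqP => E; have := congr1 (fun u => g q v u) E.
  by rewrite ipDr ipC hv add0r ip0r => /ip_eq0; exact/eqP.
have ne0 : `|0 : R| < e by rewrite normr0.
subst q; set q := b 0 in h Rh v0 v hv hv0 vb *.
pose c2 := g q (h + v) (h + v).
have c20 : 0 < c2 by exact: ip_pos.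
have speed (t : R) : `|t| < e -> g (b t) (velocity b t) (velocity b t) = c2.
  by move=> te; rewrite (geodesic_speed gb lc te) /c2 -vb.
(* The decomposition is chosen at each time separately, so nothing is known about the regularity of
   [H] and [V] in [t]. *)
have dec (t : R) : exists u : 'rV[R]_n, Ran (b t) u /\
    orth g (b t) (Ran (b t)) ((velocity b t : 'rV[R]_n) - u).
  by have [u] := subbundle_projection (F := id) dRan g (b t) (velocity b t); exists u.
have [H HP] := choice dec.
pose V (t : R) : 'rV[R]_n := (velocity b t : 'rV[R]_n) - H t.
have HV (t : R) : velocity b t = H t + V t by rewrite addrC subrK.
have H0 : H 0 = h.
  apply: (orthogonal_decomposition_unique (HP 0).1 Rh (HP 0).2 (oY q)).
  by rewrite addrC subrK vb.
have HO (t : R) : g (b t) (H t) (V t) = 0 by rewrite ipC; exact: (HP t).2 (HP t).1.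
have V0 : V 0 = v by rewrite /V H0 vb addrC addKr.
have VO (t : R) : orth g (b t) (Ran (b t)) (V t) := (HP t).2.
clearbody V.
have itv : is_interval [set t : R | `|t| < e].
  move=> x y /=; rewrite !ltr_norml => /andP[x1 x2] /andP[y1 y2] z /andP[xz zy].
  by rewrite ltr_norml (lt_le_trans x1 xz) (le_lt_trans zy y2).
have [_ cl'] := cl.
have sinE (t : R) : `|t| < e ->
    (expR (f (b t))) ^+ 2 * g (b t) (H t) (H t) = (expR (f q)) ^+ 2 * g q h h.
  move=> te; have := cl' _ b H V (@open_norm_lt R e) itv gb
    (fun s _ => And3 (HP s).1 (VO s) (HV s)) t 0 te ne0.
  (* Squaring and multiplying by the constant squared speed [c2] replaces the sine by the squared
     length of the tangential part. *)
  move=> /(congr1 (fun x => x ^+ 2 * c2)); rewrite !exprMn.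
  have sE (s : R) : `|s| < e -> sin (angle g (b s) (velocity b s) (V s)) ^+ 2 * c2 = g (b s) (H s) (H s).
    move=> se; have cE := speed s se; rewrite HV in cE *.
    have hv0' : H s + V s != 0.
      by apply/eqP => E0; move: c20; rewrite -cE E0 ip0r ltxx.
    have sA := sin_angle_normal hv0' (HO s).
    by apply: etrans (congr1 ( *%R^~ c2) sA) _; rewrite cE divfK // lt0r_neq0.
  move=> EE; have EH : g q (H 0) (H 0) = g q h h by rewrite H0.
  rewrite -EH -(sE t te) -(sE 0 ne0).
  apply: etrans (mulrA _ _ _) _; apply: etrans EE _; exact: esym (mulrA _ _ _).
pose k := g q h h * expR (f q) ^+ 2.
pose E (t : R) : R := expR (- 2 * f (b t)).
have HE (t : R) : `|t| < e -> g (b t) (H t) (H t) = k * E t.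
  move=> te; have eE : (expR (f (b t))) ^+ 2 * E t = 1.
    rewrite /E expr2 -!expRD (_ : _ + _ = 0) ?expR0 //; ring.
  by rewrite /k (mulrC (g q h h)) -(sinE t te) mulrAC eE mul1r.
have VE (t : R) : `|t| < e -> g (b t) (V t) (V t) = c2 - k * E t.
  move=> te; rewrite -HE // -(speed t te) HV ipDl !ipDr (ipC g _ (V t) (H t)) !HO.
  by rewrite add0r addr0 addrC addKr.
have velY (t : R) : g (b t) (velocity b t) (Y (b t)) = g (b t) (V t) (Y (b t)).
  by rewrite HV ipDl [X in X + _](ipC g) (oY _ _ (HP t).1) add0r.
(* [c2 - k * E t] stands for the squared length of [V t] and the velocity for [V t] in the inner
   product with [Y], so that only differentiable functions occur. *)
pose phi (t : R) : R^o := (c2 - k * E t) * g (b t) (Y (b t)) (Y (b t)) -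
  g (b t) (velocity b t) (Y (b t)) ^+ 2.
have phi_ge0 (t : R) : `|t| < e -> 0 <= phi t.
  by move=> te; rewrite /phi subr_ge0 velY -VE //; exact: cauchy_schwarz.
have phi0 : phi 0 = 0.
  have -> : phi 0 = (c2 - k * E 0) * g q v v - g q (h + v) v ^+ 2 by rewrite /phi vb.
  rewrite -(VE 0 ne0).
  by rewrite V0 ipDl hv add0r expr2 subrr.
pose df (t : R) := fun_deriv f (b t) (velocity b t).
have hE (t : R) : `|t| < e -> diff_val_at (E : R -> R^o) t (1 : R) (- 2 * df t * E t).
  move=> te; have h2 := diff_val_atM (diff_val_at_cst (- 2 : R^o) t (1 : R)) (geodesic_fun gb sf te).
  have [de ee] := is_derive_diff (- 2 * df t) (is_derive_expR (- 2 * f (b t))).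
  have := diff_val_at_compE (erefl _) h2 de.
  rewrite mulr0 addr0; apply: diff_val_at_eq.
  exact: ee.
have hphi (t : R) : `|t| < e -> diff_val_at phi t (1 : R)
   (2 * k * df t * E t * g (b t) (Y (b t)) (Y (b t)) +
    (c2 - k * E t) * (2 * g (b t) (Y (b t)) (nabla_at C Y (b t) (velocity b t))) -
    2 * g (b t) (velocity b t) (Y (b t)) * g (b t) (velocity b t) (nabla_at C Y (b t) (velocity b t))).
  move=> te; have hp := geodesic_ip_field gb lc sY te; have hY := geodesic_norm_field gb lc sY te.
  have h1 := diff_val_atD (diff_val_at_cst (c2 : R^o) t (1 : R))
    (diff_val_atM (diff_val_at_cst (- k : R^o) t (1 : R)) (hE t te)).
  have h2 := diff_val_atD (diff_val_atM h1 hY)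
    (diff_val_atM (diff_val_at_cst (- 1 : R^o) t (1 : R)) (diff_val_atM hp hp)).
  have h3 : \forall s \near t, (c2 + - k * E s) * g (b s) (Y (b s)) (Y (b s)) +
      - 1 * (g (b s) (velocity b s) (Y (b s)) * g (b s) (velocity b s) (Y (b s))) = phi s.
    by near=> s; rewrite /phi; ring.
  apply: diff_val_at_eq (diff_val_at_near h3 h2); ring.
have min0 : is_derive (0 : R) 1 phi 0.
  apply: (@derive1_at_min R phi (- e) e 0).
  - by rewrite -subr_ge0 opprK addr_ge0 // ltW.
  - move=> t; rewrite in_itv /= -ltr_norml => /hphi[d _].
    exact/derivable1_diffP.
  - by rewrite in_itv /= oppr_lt0 e0.
  - by move=> t; rewrite in_itv /= -ltr_norml phi0; exact: phi_ge0.
have [dphi ephi] := hphi 0 ne0.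
have E0 : 'd phi 0 (1 : R) = 0 by rewrite -deriveE //; exact: derive_val.
have kE0 : k * E 0 = g q h h by rewrite -HE // H0.
have vv := VE 0 ne0; rewrite V0 kE0 -/q in vv.
move: ephi; rewrite E0 -/q kE0 -vv /df vb.
set D := fun_deriv f _ _; set w := nabla_at _ _ _ _.
have -> : 2 * k * D * E 0 = 2 * D * g q h h by rewrite -kE0; ring.
rewrite -/v !ipDl hv add0r => eq0.
have v2 : g q v v != 0 by apply/eqP => /ip_eq0; exact/eqP.
(* At time 0 the derivative of [phi] is [2 * g q v v] times the difference of the two sides; here
   [Y q != 0] is used. *)
apply: (mulfI (mulf_neq0 (_ : 2 != 0 :> R) v2)); first by rewrite pnatr_eq0.
apply/eqP; rewrite -subr_eq0; apply/eqP; rewrite [RHS]eq0; ring.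
Unshelve. all: by end_near. Qed.

(** [clairaut_geodesic] for [h] and for [- h]: combining the two separates the parts even and odd in
    [h]. *)
Lemma clairaut_second_fundamental (Y : vector_field N) q h :
  section (fun q => orth g q (Ran q)) Y -> Ran q h -> Y q != (0 : 'rV[R]_n) ->
  g q h (nabla_at C Y q h) = g q h h * fun_deriv f q (Y q).
Proof.
move=> sY Rh Y0.
have RNh : Ran q (- h) by rewrite -scaleN1r; exact: (subbundleZ dRan).
have h1 := clairaut_geodesic sY Rh Y0; have h2 := clairaut_geodesic sY RNh Y0.
have O : g q h (nabla_at C Y q (Y q)) = 0.
  by rewrite ipC; have [_ O] := tgRan sY sY; exact: O.
move: h1 h2 O; rewrite !nabla_atD !fun_derivD nabla_atN fun_derivN.
move: (nabla_at C Y q h) (nabla_at C Y q (Y q)) => a b.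
rewrite !ipNl !ipNr !ipDr !ipNr; lra.
Qed.

(** Polarization determines a quadratic form's symmetric part only. At a general point of [N] the
    form may fail to be symmetric on [Ran], so symmetry is a hypothesis; over the image of [F] it
    comes from [sff_sym]. *)
Lemma clairaut_polarized (Y : vector_field N) q h k :
  section (fun q => orth g q (Ran q)) Y -> Ran q h -> Ran q k -> Y q != (0 : 'rV[R]_n) ->
  g q h (nabla_at C Y q k) = g q k (nabla_at C Y q h) ->
  g q h (nabla_at C Y q k) = g q h k * fun_deriv f q (Y q).
Proof.
move=> sY Rh Rk Y0 sym.
have Rhk : Ran q (h + k) by exact: (subbundleD dRan).
have := clairaut_second_fundamental sY Rhk Y0.
have := clairaut_second_fundamental sY Rk Y0; have := clairaut_second_fundamental sY Rh Y0.
rewrite nabla_atD; move: sym; move: (nabla_at C Y q h) (nabla_at C Y q k) => a b.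
rewrite !ipDl !ipDr (ipC g q k h); lra.
Qed.

End ClairautRelation.

(** * Horizontal geometry of semi-invariant Riemannian maps *)

Section HorizontalGeometry.
Variables (R : realType) (m n r k1 k2 : nat) (M : manifold R m) (N : manifold R n).
Variables (gM : metric M) (gN : metric N) (CM : connection M) (CN : connection N).
Variables (P : forall q : N, tangent q -> tangent q) (F : M -> N).
Variables (D1 D2 : forall p : M, set (tangent (F p))).
Arguments P : clear implicits.
Arguments D1 : clear implicits.
Arguments D2 : clear implicits.
Hypotheses (lcM : levi_civita gM CM) (lcN : levi_civita gN CN).
Hypotheses (smF : smooth_map F) (rkF : has_rank F r).
Hypothesis iso : riemannian_map gM gN F.
Hypothesis semi : semi_invariant gN P k1 k2 D1 D2.
Implicit Types (p : M) (X Y Z U : vector_field M) (u v w : 'rV[R]_m).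

Local Notation hor := (horizontal gM F).

Lemma D1_sub_range p : D1 p `<=` range_map F p.
Proof.
case: semi => _ s2 rE _ _ u Du; rewrite rE; exists u, 0; split=> //; last by rewrite addr0.
exact: subbundle0 s2 p.
Qed.

Lemma D2_sub_range p : D2 p `<=` range_map F p.
Proof.
case: semi => s1 _ rE _ _ u Du; rewrite rE; exists 0, u; split=> //; last by rewrite add0r.
exact: subbundle0 s1 p.
Qed.

(** The local frames come from [D1] and [D2], so the vector is split along them and the two
    extensions are added. *)
Lemma extend_range p (w : 'rV[R]_n) : range_map F p w ->
  exists Y, section hor Y /\ tangent_map F p (Y p) = w.
Proof.
case: semi => s1 s2 rE _ _ rw; move: (rw); rewrite rE => -[u [v [Du Dv ->]]].
have [Y1 [[sY1 hY1] e1]] := extend_horizontal_lift gM smF rkF s1 D1_sub_range Du.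
have [Y2 [[sY2 hY2] e2]] := extend_horizontal_lift gM smF rkF s2 D2_sub_range Dv.
exists (fun q => (Y1 q : 'rV[R]_m) + Y2 q); split; first split.
- exact: smooth_field_add openT sY1 sY2.
- by move=> q; apply: horizontalD; [exact: (hY1 q).1|exact: (hY2 q).1].
by rewrite -e1 -e2; exact: tangent_mapD.
Qed.

Lemma extend_horizontal p v : hor p v -> exists Y, section hor Y /\ Y p = v.
Proof.
move=> hv; have rv : range_map F p (tangent_map F p v) by exists v.
have [Y [[sY hY] e]] := extend_range rv.
by exists Y; split=> //; apply: horizontal_inj (hY p) hv e.
Qed.

(** Pointwise form of [riemannian_map]. Only [v] has to be horizontal: the vertical part of [u] is
    invisible on both sides. *)
Lemma isometry p u v : hor p v ->
  gN (F p) (tangent_map F p u) (tangent_map F p v) = gM p u v.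
Proof.
move=> hv; have ru : range_map F p (tangent_map F p u) by exists u.
have [X [sX eX]] := extend_range ru; have [Y [sY <-]] := extend_horizontal hv.
rewrite -eX (iso sX sY).
have kE : ker_map F p ((X p : 'rV[R]_m) - u).
  have E := tangent_mapB F p (X p) u; rewrite eX subrr in E; exact: E.
apply/eqP; rewrite -subr_eq0 -ipBl ipC; apply/eqP; exact: sY.2 p _ kE.
Qed.

Lemma diff_push Y p : smooth_field setT Y -> diff_along (push F Y) p.
Proof.
by move=> sY; apply: smooth_at_differentiable; apply: smooth_push => //; exact: smooth_field_at.
Qed.

Lemma push_derivative Y p v : smooth_field setT Y ->
  nabla_along CN (push F Y) p v =
  sff F CM CN p v (Y p) + tangent_map F p (nabla_at CM Y p v).
Proof.
move=> sY; have vE : coord_field p v p = v by exact: coord_field_center.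
have d := smooth_at_differentiable (smooth_field_at p sY).
have := nabla_along_push smF CM CN (coord_field p v) d.
rewrite /nabla /cov_deriv vE; exact.
Qed.

Lemma orthogonal_along (W1 W2 : section_along F) p v : diff_along W1 p -> diff_along W2 p ->
  (forall q, gN (F q) (W1 q) (W2 q) = 0) ->
  gN (F p) (nabla_along CN W1 p v) (W2 p) = - gN (F p) (W1 p) (nabla_along CN W2 p v).
Proof.
move=> d1 d2 O; have [_ e] := metric_along smF v lcN d1 d2.
have [_ e0] : diff_val_at (fun x => gN (F (of_coord p x)) (W1 (of_coord p x)) (W2 (of_coord p x)) : R^o)
    (to_coord p p) v 0.
  by apply: diff_val_at_near (diff_val_at_cst (0 : R^o) _ _); near=> x; rewrite O.
apply/eqP; rewrite -addr_eq0; apply/eqP; exact: etrans (esym e) e0.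
Unshelve. all: by end_near. Qed.

(** Differentiate the isometry identity for horizontal [Y], [Z] along [u], once in [N] and once in
    [M]. The terms containing the derivatives of [Y] and [Z] in [M] agree by [isometry], and the two
    [sff] terms must cancel. *)
Lemma sff_skew p u v w : hor p v -> hor p w ->
  gN (F p) (sff F CM CN p u v) (tangent_map F p w) +
  gN (F p) (sff F CM CN p u w) (tangent_map F p v) = 0.
Proof.
move=> hv hw; have [Y [sY Yp]] := extend_horizontal hv; have [Z [sZ Zp]] := extend_horizontal hw.
set X := coord_field p u; have Xp : X p = u by exact: coord_field_center.
have [_ e] := metric_along smF u lcN (diff_push p sY.1) (diff_push p sZ.1).
have [_ e2] := lcM (@dom_open _ _ M p) (smooth_coord_field p u)
  (smooth_field_sub openT (@dom_open _ _ M p) (@subsetT _ _) sY.1)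
  (smooth_field_sub openT (@dom_open _ _ M p) (@subsetT _ _) sZ.1) (mem_dom p).
rewrite -/X Xp in e2.
have E : (fun q => gN (F q) (push F Y q) (push F Z q)) = (fun q => gM q (Y q) (Z q)).
  by apply/funext => q; exact: iso.
have E3 := congr1 (fun h : M -> R => fun_deriv h p u) E.
have := etrans (esym e) (etrans E3 e2).
have nE V : nabla CM X V p = nabla_at CM V p u.
  by rewrite /nabla /cov_deriv Xp.
rewrite !nE !push_derivative ?(sY.1, sZ.1) //; [|exact: sZ.1|exact: sY.1].
move: (nabla_at CM Y p u) (nabla_at CM Z p u) => a b.
rewrite /push Yp Zp ipDl ipDr (isometry a hw) [gN _ _ (tangent_map F p b)]ipC (isometry b hv).
rewrite (ipC gM p v b) (ipC gN (F p) (tangent_map F p v)).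
have cancel (x y c d : R) : x + c + (y + d) = c + d -> x + y = 0.
  by rewrite addrACA => /eqP; rewrite -subr_eq0 addrK => /eqP.
exact: cancel.
Qed.

(* By [sff_skew], [gN(sff u v, F_* w)] is skew in [v, w]; it is symmetric in [u, v]. *)
Lemma sff_orth_range p u v : hor p u -> hor p v ->
  orth gN (F p) (range_map F p) (sff F CM CN p u v).
Proof.
move=> hu hv x rx; have [Z [sZ <-]] := extend_range rx.
have hw := sZ.2 p; move: (Z p) hw => w hw.
have sym := sff_sym smF lcM lcN p.
have h1 := sff_skew u hv hw; have h2 := sff_skew w hu hv; have h3 := sff_skew v hw hu.
rewrite (sym w u) (sym w v) in h2; rewrite (sym v w) (sym v u) in h3.
rewrite (sym v w) in h2.
move: h1 h2 h3; rewrite (sym w v); lra.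
Qed.

Lemma nabla_along_vertical U Y p v : section (ker_map F) U -> section hor Y ->
  gN (F p) (nabla_along CN (push F U) p v) (push F Y p) = 0.
Proof.
move=> [sU kU] [sY hY].
have U0 q : push F U q = 0 :> 'rV[R]_n by exact: kU.
have := orthogonal_along v (diff_push p sU) (diff_push p sY).
rewrite U0 ip0l oppr0; apply => q; have E := U0 q.
by rewrite E ip0l.
Qed.

Lemma ip_nabla_vertical X Y U p : smooth_field setT X -> section hor Y ->
  section (ker_map F) U -> gM p (nabla CM X Y p) (U p) = - gM p (Y p) (nabla CM X U p).
Proof.
move=> sX [sY hY] [sU kU]; have [_ e] := lcM openT sX sY sU (I : setT p).
have E : (fun q => gM q (Y q) (U q)) = (fun=> 0).
  by apply/funext => q; exact: hY q _ (kU q).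
have e0 : fun_deriv (fun q => gM q (Y q) (U q)) p (X p) = 0.
  rewrite E; exact: (congr1 (@^~ (X p)) (diff_cst (0 : R^o) (to_coord p p))).
by apply/eqP; rewrite -addr_eq0 -e e0.
Qed.

(** The pushforward of [U] is zero, so only the image of [nabla CM X U] contributes; [gM] vanishes
    on [Y] and [U], which moves the derivative from [U] to [Y] at the cost of the remaining sign. *)
Lemma second_fundamental_form_vertical X Y U p : smooth_field setT X -> section hor Y ->
  section (ker_map F) U ->
  gN (F p) (second_fundamental_form F CM CN X U p) (tangent_map F p (Y p)) =
  gM p (nabla CM X Y p) (U p).
Proof.
move=> sX sY sU; rewrite ip_nabla_vertical //.
have V := nabla_along_vertical p (X p) sU sY.
apply: etrans (ipBl _ _ _ _ _) _.
have I1 := isometry (nabla CM X U p) (sY.2 p).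
rewrite I1 (ipC gM p (Y p)).
have V' : gN (F p) (nabla_pullback CN X (fun q => tangent_map F q (U q) : tangent (F q)) p)
  (tangent_map F p (Y p)) = 0 by exact: V.
by rewrite V' sub0r.
Qed.

Variables (Ran : forall q : N, set (tangent q)) (f : N -> R).
Arguments Ran : clear implicits.
Hypothesis rdRan : range_distribution gN F r Ran.
Hypothesis tgRan : totally_geodesic CN (fun q => orth gN q (Ran q)).
Hypotheses (sf : smooth_fun setT f) (cl : clairaut gN CN Ran (fun q => expR (f q))).

Lemma sff_umbilical p u v (w : 'rV[R]_n) : hor p u -> hor p v ->
  orth gN (F p) (range_map F p) w ->
  gN (F p) (sff F CM CN p u v) w = - (gM p u v * fun_deriv f (F p) w).
Proof.
move=> hu hv ow; have [dR dO rE] := rdRan.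
(* The Clairaut lemmas ask for a nonvanishing normal field at the point, so [w = 0] is treated
   apart. *)
have [w0|w0] := eqVneq w 0.
  rewrite w0 ip0r; have -> : fun_deriv f (F p) (0 : 'rV[R]_n) = 0 by exact: linear0.
  by rewrite mulr0 oppr0.
rewrite -rE in ow; have [V [sV Vp]] := extend_distribution dO ow.
have dV := smooth_at_differentiable (smooth_field_at (F p) sV.1).
(* Weingarten's formula: orthogonality of the pushed field and [V] trades the second fundamental
   form for the derivative of [V]. *)
have normal a b : hor p a -> hor p b ->
    gN (F p) (tangent_map F p a) (nabla_at CN V (F p) (tangent_map F p b)) =
    - gN (F p) (sff F CM CN p b a) w.
  move=> ha hb; have [X [sX Xp]] := extend_horizontal ha.
  have [dW eW] := nabla_along_comp CN smF b dV.
  have oXV q : gN (F q) (push F X q) (V (F q)) = 0.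
    rewrite ipC; have := sV.2 (F q); apply; rewrite rE; by exists (X q).
  have := orthogonal_along b (diff_push p sX.1) dW oXV.
  rewrite push_derivative ?sX.1 //; last exact: sX.1.
  rewrite eW Vp ipDl => E.
  have E0 : gN (F p) (tangent_map F p (nabla_at CM X p b)) w = 0.
    by rewrite ipC; apply: ow; rewrite rE; exists (nabla_at CM X p b).
  move: E; rewrite E0 addr0 /push Xp => ->.
  by rewrite opprK.
have rr a : Ran (F p) (tangent_map F p a) by rewrite rE; exists a.
have Vn : V (F p) != (0 : 'rV[R]_n) by rewrite Vp.
have sym : gN (F p) (tangent_map F p u) (nabla_at CN V (F p) (tangent_map F p v)) =
    gN (F p) (tangent_map F p v) (nabla_at CN V (F p) (tangent_map F p u)).
  by rewrite !normal // (sff_sym smF lcM lcN).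
have := clairaut_polarized lcN dR tgRan sf cl sV (rr v) (rr u) Vn (esym sym).
rewrite normal // isometry // Vp (ipC gM) => <-.
by rewrite opprK.
Qed.

(** Needed for sections such as [P] applied to a pushed field, which are not given as pushforwards.
    The normal part of the derivative of [S] depends on [S p] alone, because it equals minus the
    pairing of [S p] with the derivative of a normal field; [S] may thus be replaced by the push of
    a horizontal field with the same value at [p]. *)
Lemma range_section_umbilical (S : section_along F) p u (w : 'rV[R]_n) :
  diff_along S p -> (forall q, range_map F q (S q)) -> hor p u ->
  orth gN (F p) (range_map F p) w ->
  gN (F p) (nabla_along CN S p u) w =
  - (gN (F p) (S p) (tangent_map F p u) * fun_deriv f (F p) w).
Proof.
move=> dS rS hu ow; have [_ dO rE] := rdRan.
have [X [sX Xp]] := extend_range (rS p).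
have ow' := ow; rewrite -rE in ow'; have [V [sV Vp]] := extend_distribution dO ow'.
have dV := smooth_at_differentiable (smooth_field_at (F p) sV.1).
have [dW _] := nabla_along_comp CN smF u dV.
have oV q x : range_map F q x -> gN (F q) x (V (F q)) = 0.
  by move=> rx; rewrite ipC; have := sV.2 (F q); apply; rewrite rE.
have h1 := orthogonal_along u dS dW (fun q => oV q _ (rS q)).
have h2 := orthogonal_along u (diff_push p sX.1) dW
  (fun q => oV q _ (ex_intro2 _ _ (X q) I erefl)).
rewrite Vp in h1 h2; apply: etrans h1 _.
rewrite -{1}Xp; apply: etrans (esym h2) _.
rewrite push_derivative; last exact: sX.1.
rewrite ipDl sff_umbilical //; last exact: sX.2.
have E0 : gN (F p) (tangent_map F p (nabla_at CM X p u)) w = 0.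
  by rewrite ipC; apply: ow; exists (nabla_at CM X p u).
by rewrite E0 addr0 -Xp isometry // (ipC gM).
Qed.

Hypothesis kah : kahler gN CN P.

Lemma kahler_skew q (u v : 'rV[R]_n) : gN q (P q u) v = - gN q u (P q v).
Proof.
have [_ _ PP Pi _] := kah.
by rewrite -(Pi q (P q u) v) PP ipNl.
Qed.

Lemma D2_normal p (u : 'rV[R]_n) : D2 p u -> orth gN (F p) (range_map F p) (P (F p) u).
Proof. by case: semi => _ _ _ _ /(_ p)[_ h] Du; apply: h; exists u. Qed.

Lemma D1_stable p (u : 'rV[R]_n) : D1 p u -> D1 p (P (F p) u).
Proof. by case: semi => _ _ _ _ /(_ p)[h _] Du; rewrite -h; exists u. Qed.

Hypothesis k2_gt1 : (1 < k2)%N.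

Lemma D2_orthogonal_vector p (w : 'rV[R]_n) :
  exists u : 'rV[R]_n, [/\ D2 p u, u != 0 & gN (F p) u w = 0].
Proof.
case: semi => _ s2 _ _ _; have [e [fe De]] := subbundle_span s2 p.
have k0 : (0 < k2)%N by exact: ltn_trans k2_gt1.
pose i0 := Ordinal k0; pose i1 := Ordinal k2_gt1.
have De_ (i : 'I_k2) : D2 p e`_i.
  by apply/De; apply: memv_span; rewrite mem_nth // size_tuple.
pose u : 'rV[R]_n := gN (F p) e`_i1 w *: e`_i0 - gN (F p) e`_i0 w *: e`_i1.
have Du : D2 p u.
  by rewrite /u -scaleNr; apply: (subbundleD s2); apply: (subbundleZ s2); exact: De_.
have uw : gN (F p) u w = 0 by rewrite /u ipBl !ipZl mulrC subrr.
have [u0|u0] := eqVneq u 0; last by exists u.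
have c (i j : 'I_k2) : coord e i e`_j = (i == j)%:R.
  by rewrite (coord_free j i fe) eq_sym.
have cu : coord e i1 u = gN (F p) e`_i1 w * coord e i1 e`_i0 - gN (F p) e`_i0 w * coord e i1 e`_i1.
  by rewrite /u linearB !linearZ.
rewrite !c u0 linear0 eqxx mulr0 sub0r mulr1 in cu.
exists e`_i0; split; first exact: De_.
  apply/eqP => e0; have := c i0 i0; rewrite e0 linear0 eqxx.
  by move/eqP; rewrite eq_sym oner_eq0.
by apply/eqP; rewrite -oppr_eq0 -cu.
Qed.

Lemma extend_D1 p (w : 'rV[R]_n) : D1 p w -> exists Y,
  section (horizontal_lift gM D1) Y /\ tangent_map F p (Y p) = w.
Proof.
by case: semi => s1 _ _ _ _; exact: (extend_horizontal_lift gM smF rkF s1 D1_sub_range).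
Qed.

Lemma extend_D2 p (w : 'rV[R]_n) : D2 p w -> exists Y,
  section (horizontal_lift gM D2) Y /\ tangent_map F p (Y p) = w.
Proof.
by case: semi => _ s2 _ _ _; exact: (extend_horizontal_lift gM smF rkF s2 D2_sub_range).
Qed.

(** Take a nonzero [u] in [D2] orthogonal to [w], extend both to [Y1] and [Y2], and differentiate
    the orthogonality of the push of [Y1] to [P] of the push of [Y2] along [Y1]. As [P] is parallel
    and skew, umbilicity turns this into g(u,u) df(P w) = g(w,u) df(P u), whose right-hand side is
    zero. *)
Lemma grad_orthogonal_PD2 p (w : 'rV[R]_n) : D2 p w -> fun_deriv f (F p) (P (F p) w) = 0.
Proof.
move=> Dw; have [u [Du u0 uw]] := D2_orthogonal_vector p w.
have [Y1 [[sY1 hY1] e1]] := extend_D2 Du; have [Y2 [[sY2 hY2] e2]] := extend_D2 Dw.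
have d1 := diff_push p sY1; have d2 := diff_push p sY2.
have [dP2 eP2] := kahler_along smF kah (Y1 p) d2.
have n2 q : gN (F q) (push F Y1 q) (P (F q) (push F Y2 q)) = 0.
  by rewrite ipC; apply: (D2_normal (hY2 q).2); exists (Y1 q).
have := orthogonal_along (Y1 p) d1 dP2 n2.
have rY Y q : range_map F q (push F Y q) by exists (Y q).
have oPw : orth gN (F p) (range_map F p) (P (F p) (push F Y2 p)).
  exact: (D2_normal (hY2 p).2).
have oPu : orth gN (F p) (range_map F p) (P (F p) (push F Y1 p)).
  exact: (D2_normal (hY1 p).2).
rewrite eP2 (range_section_umbilical d1 (rY Y1) (hY1 p).1 oPw).
rewrite -kahler_skew (ipC gN _ (P (F p) (push F Y1 p))) (range_section_umbilical d2 (rY Y2) (hY1 p).1 oPu).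
rewrite /push e1 e2 (ipC gN _ w) uw mul0r oppr0 => /eqP; rewrite oppr_eq0 mulf_eq0.
by move=> /orP[/eqP/ip_eq0/eqP|/eqP //]; rewrite (negPf u0).
Qed.

(** Apply the isometry [P] to both arguments in [N]. The push of [Y] stays in [D1], hence in the
    range, while that of [Z] becomes normal; umbilicity leaves a multiple of the derivative of [f]
    along [P] of [D2], which is zero. *)
Lemma ip_nabla_D1_D2 X Y Z p : hor p (X p) -> section (horizontal_lift gM D1) Y ->
  section (horizontal_lift gM D2) Z -> gM p (nabla CM X Y p) (Z p) = 0.
Proof.
move=> hX [sY hY] [sZ hZ]; have d := diff_push p sY.
have [_ _ _ Pi _] := kah.
have [dP eP] := kahler_along smF kah (X p) d.
rewrite -(isometry _ (hZ p).1).
have E := push_derivative p (X p) sY.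
have S0 := sff_orth_range hX (hY p).1 (ex_intro2 _ _ (Z p) I erefl).
have := congr1 (fun a => gN (F p) a (tangent_map F p (Z p))) E.
rewrite ipDl S0 add0r => <-.
rewrite -Pi -eP range_section_umbilical //.
- by rewrite (grad_orthogonal_PD2 (hZ p).2) mulr0 oppr0.
- by move=> q; apply: D1_sub_range; apply: D1_stable; exact: (hY q).2.
- exact: (D2_normal (hZ p).2).
Qed.

(** Differentiating the orthogonality of [Y] and [Z] reduces this to [ip_nabla_D1_D2]. *)
Lemma ip_nabla_D2_D1 X Y Z p : section hor X -> section (horizontal_lift gM D2) Y ->
  section (horizontal_lift gM D1) Z -> gM p (nabla CM X Y p) (Z p) = 0.
Proof.
move=> [sX hX] sY sZ; have h := ip_nabla_D1_D2 (hX p) sZ sY.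
have [_ e] := lcM openT sX sY.1 sZ.1 (I : setT p).
have E : (fun q => gM q (Y q) (Z q)) = (fun=> 0).
  apply/funext => q; rewrite -(isometry _ (sZ.2 q).1) ipC.
  by case: semi => _ _ _ O _; apply: O; [exact: (sZ.2 q).2|exact: (sY.2 q).2].
have e0 : fun_deriv (fun q => gM q (Y q) (Z q)) p (X p) = 0.
  rewrite E; exact: (congr1 (@^~ (X p)) (diff_cst (0 : R^o) (to_coord p p))).
by move: e; rewrite e0 [X in _ + X]ipC h addr0 => <-.
Qed.

End HorizontalGeometry.

Unset Implicit Arguments.
Theorem theorem12 (R : realType) (m n r k1 k2 : nat)
    (M : manifold R m) (N : manifold R n) (gM : metric M) (gN : metric N)
    (CM : connection M) (CN : connection N)
    (P : forall q : N, tangent q -> tangent q) (F : M -> N)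
    (Ran : forall q : N, set (tangent q))
    (D1 D2 : forall p : M, set (tangent (F p))) (f : N -> R) :
  levi_civita gM CM -> levi_civita gN CN -> kahler gN CN P ->
  smooth_map F -> has_rank F r -> (0 < r < minn m n)%N ->
  range_distribution gN F r Ran ->
  riemannian_map gM gN F ->
  semi_invariant gN P k1 k2 D1 D2 ->
  smooth_fun setT f -> clairaut gN CN Ran (fun q => expR (f q)) ->
  totally_geodesic CN (fun q => orth gN q (Ran q)) ->
  (1 < k2)%N ->
  locally_product CM (horizontal_lift gM D1) (horizontal_lift gM D2) <->
  (forall X U : vector_field M, section (horizontal_lift gM D1) X ->
     section (ker_map F) U ->
     forall p, orth gN (F p) (D1 p) (second_fundamental_form F CM CN X U p)) /\
  (forall X2 U : vector_field M, section (horizontal_lift gM D2) X2 ->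
     section (ker_map F) U ->
     forall p, orth gN (F p) (D2 p) (second_fundamental_form F CM CN X2 U p)).
Proof.
move=> lcM lcN kah smF rkF _ rdRan iso semi sf cl tg k2_gt1.
have sub1 := D1_sub_range semi; have sub2 := D2_sub_range semi.
have [sD1 sD2 rE O12 _] := semi.
have vert := second_fundamental_form_vertical lcM lcN smF rkF iso semi.
have n12 := ip_nabla_D1_D2 lcM lcN smF rkF iso semi rdRan tg sf cl kah k2_gt1.
have n21 := ip_nabla_D2_D1 lcM lcN smF rkF iso semi rdRan tg sf cl kah k2_gt1.
have lift1 := extend_D1 gM smF rkF semi.
have lift2 := extend_D2 gM smF rkF semi.
have isoE := isometry smF rkF iso semi.
split=> [[tg1 tg2]|[c1 c2]]; split.
(* Any [w] in [D1] is the image of a section [Y] of the lift; total geodesy makes [nabla CM X Y]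
   horizontal, hence orthogonal to [U]. *)
- move=> X U sX sU p w Dw; have [Y [sY <-]] := lift1 p w Dw.
  rewrite (vert X Y U) //; [|exact: sX.1|by split; [exact: sY.1|move=> q; exact: (sY.2 q).1]].
  by have [_ h] := tg1 X Y sX sY; apply: (h p).1; exact: sU.2.
- move=> X U sX sU p w Dw; have [Y [sY <-]] := lift2 p w Dw.
  rewrite (vert X Y U) //; [|exact: sX.1|by split; [exact: sY.1|move=> q; exact: (sY.2 q).1]].
  by have [_ h] := tg2 X Y sX sY; apply: (h p).1; exact: sU.2.
- move=> X Y sX sY; split=> [|p]; first exact: cov_deriv_smooth openT sX.1 sY.1.
  have rN : range_map F p (tangent_map F p (nabla CM X Y p)) by exists (nabla CM X Y p).
  split.
    (* Condition (i) is exactly the vanishing of the vertical part of the derivative. *)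
    move=> w kw; have [U [sU <-]] := extend_kernel smF rkF kw.
    rewrite -(vert X Y U) //; [|exact: sX.1|by split; [exact: sY.1|move=> q; exact: (sY.2 q).1]].
    by apply: c1 => //; exact: (sY.2 p).2.
  rewrite rE in rN; have [u [v [Du Dv uv]]] := rN.
  (* Testing against a lift of the [D2] component [v] itself gives that [v] has zero length. *)
  have [Z [sZ Zv]] := lift2 p v Dv.
  have := n12 X Y Z p (sX.2 p).1 sY sZ.
  rewrite -(isoE _ _ _ (sZ.2 p).1) uv Zv ipDl O12 // add0r => /ip_eq0 v0.
  by rewrite v0 addr0.
- move=> X Y sX sY; split=> [|p]; first exact: cov_deriv_smooth openT sX.1 sY.1.
  have rN : range_map F p (tangent_map F p (nabla CM X Y p)) by exists (nabla CM X Y p).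
  split.
    move=> w kw; have [U [sU <-]] := extend_kernel smF rkF kw.
    rewrite -(vert X Y U) //; [|exact: sX.1|by split; [exact: sY.1|move=> q; exact: (sY.2 q).1]].
    by apply: c2 => //; exact: (sY.2 p).2.
  rewrite rE in rN; have [u [v [Du Dv uv]]] := rN.
  (* The same test for the second distribution, now with the [D1] component [u]. *)
  have [Z [sZ Zu]] := lift1 p u Du.
  have sXh : section (horizontal gM F) X.
    by split; [exact: sX.1|move=> q; exact: (sX.2 q).1].
  have := n21 X Y Z p sXh sY sZ.
  rewrite -(isoE _ _ _ (sZ.2 p).1) uv Zu ipDl (ipC gN _ v) (O12 p u v Du Dv) addr0 => /ip_eq0 u0.
  by rewrite u0 add0r.
Qed.
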